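(* Let $F$ be a finite extension of $\mathbb{Q}_p$ with ramification index $e$ and residue field $\mathbb{F}_q$, $q=p^f$. Let $0<r<q-1$ and write $r=r_0+r_1p+\dots+r_{f-1}p^{f-1}$ with $0<r_j<p-1$ for all $0\leq j\leq f-1$. When $f=1$, assume moreover $2<r<p-3$. Then a basis of the space of $I(1)$-invariants of \[\pi_r=\frac{\mathrm{ind}_{IZ}^G \chi_r}{(\mathrm{Ker}\,T_{-1,0},\mathrm{Ker}\,T_{1,2})}\] as an $\overline{\mathbb F}_p$-vector space is given by the images in $\pi_r$ of the following sets: (1) $\{[\mathrm{Id},1],[\beta,1]\}$ when $F=\mathbb{Q}_p$; (2) $\mathcal{S}_2\cup\{[\mathrm{Id},1],[\beta,1]\}\cup\mathcal{T}_2$ when $F\neq\mathbb{Q}_p$.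
   Context: $F$ has ring of integers $\mathcal O$, fixed uniformizer $\varpi$; for $x\in\mathbb F_q$, $[x]\in\mathcal O$ is its multiplicative (Teichmüller) representative; $\overline{\mathbb F}_p$ is an algebraic closure of $\mathbb F_p$ containing $\mathbb F_q$, and for $a\in\mathcal O$, $\bar a\in\mathbb F_q$ is its reduction. $G=\mathrm{GL}_2(F)$, $K=\mathrm{GL}_2(\mathcal O)$, $Z$ the centre of $G$, $I\subset K$ the Iwahori subgroup (lower-left entry in $\varpi\mathcal O$), $I(1)\subset I$ the pro-$p$ Iwahori subgroup (elements of $I$ with diagonal entries $\equiv 1 \bmod \varpi$). $\chi_r:IZ\to\overline{\mathbb F}_p^\times$ is the character $\begin{pmatrix} a&b\\ \varpi c&d\end{pmatrix}\mapsto \bar d^{\,r}$, $\mathrm{diag}(\varpi,\varpi)\mapsto 1$. $\mathrm{ind}_{IZ}^G\chi_r$ is the compact induction (compactly supported $\phi:G\to\overline{\mathbb F}_p$ with $\phi(hg)=\chi_r(h)\phi(g)$ for $h\in IZ$, $G$ acting by right translation). For $g\in G$, $[g,1]$ is the element supported on $IZg^{-1}$ with value $1$ at $g^{-1}$; thus $h\cdot[g,1]=[hg,1]$. Let $\beta=\begin{pmatrix}0&1\\ \varpi&0\end{pmatrix}$, $w=\begin{pmatrix}0&1\\1&0\end{pmatrix}$. $T_{-1,0},T_{1,2}$ are the $G$-equivariant endomorphisms of $\mathrm{ind}_{IZ}^G\chi_r$ given by $T_{-1,0}[g,1]=\sum_{\lambda\in I_1}[g\begin{pmatrix}\varpi&\lambda\\0&1\end{pmatrix},1]$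 and $T_{1,2}[g,1]=\sum_{\lambda\in I_1}[g\beta\begin{pmatrix}1&\lambda\\0&1\end{pmatrix}w,1]$; $(\mathrm{Ker}\,T_{-1,0},\mathrm{Ker}\,T_{1,2})$ denotes the subrepresentation $\mathrm{Ker}\,T_{-1,0}+\mathrm{Ker}\,T_{1,2}$. Here $I_0=\{0\}$ and for $n\ge1$, $I_n=\{[\mu_0]+[\mu_1]\varpi+\dots+[\mu_{n-1}]\varpi^{n-1}:\mu_i\in\mathbb F_q\}\subset\mathcal O$; for $\mu\in I_n$, $\mu_i\in\mathbb F_q$ denotes its $i$-th digit and $[\mu]_m=\sum_{i<m}[\mu_i]\varpi^i$. For $n\ge1$ and $0\le k,s\le q-1$ (with $0^0=1$): $s_n^k=\sum_{\mu\in I_n}\mu_{n-1}^k\left[\begin{pmatrix}\varpi^n&\mu\\0&1\end{pmatrix},1\right]$, $t_n^s=\sum_{\mu\in I_n}\mu_{n-1}^s\left[\begin{pmatrix}\varpi^{n-1}&[\mu]_{n-1}\\0&1\end{pmatrix}\begin{pmatrix}1&[\mu_{n-1}]\\0&1\end{pmatrix}w,1\right]$. $\mathcal S_2=\bigcup_{l=0}^{f-1}\big(\{s_n^{q-1-r+p^l}\}_{n\ge2}\cup\{\beta s_n^{q-1-r+p^l}\}_{n\ge2}\big)$ and $\mathcal T_2=\bigcup_{l=0}^{f-1}\big(\{t_n^{r+p^l}\}_{n\ge2}\cup\{\beta t_n^{r+p^l}\}_{n\ge2}\big)$. *)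

(* Defs.v *)
From HB Require Import structures.
From mathcomp Require Import all_boot all_order all_algebra.
Set Implicit Arguments. Unset Strict Implicit. Unset Printing Implicit Defensive.
Import Order.TTheory GRing.Theory Num.Theory.
Local Open Scope ring_scope.

(* Index type for the candidate basis vectors of pi_r^{I(1)}:
   BId ~ [Id,1], BBeta ~ [beta,1],
   BS l n b ~ s_n^{q-1-r+p^l} (b = false) or beta s_n^{q-1-r+p^l} (b = true),
   BT l n b ~ t_n^{r+p^l}     (b = false) or beta t_n^{r+p^l}     (b = true). *)
Inductive bidx := BId | BBeta | BS (l n : nat) (b : bool) | BT (l n : nat) (b : bool).

Definition bidx_eq_dec (a b : bidx) : {a = b} + {a <> b}.
Proof. decide equality; exact: (decP eqP). Defined.
Definition bidx_eqb (a b : bidx) : bool := if bidx_eq_dec a b then true else false.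
Lemma bidx_eqP : Equality.axiom bidx_eqb.
Proof. by move=> a b; rewrite /bidx_eqb; case: bidx_eq_dec => h; constructor. Qed.
HB.instance Definition _ := hasDecEq.Build bidx bidx_eqP.

Section Defs.
Variables (p f : nat) (F : fieldType) (v : F -> int) (w0 : F)
  (Fq : finFieldType) (res : F -> Fq) (teich : Fq -> F)
  (k : fieldType) (iota : Fq -> k) (r : nat).

Definition vge (x : F) (N : int) : bool := (x == 0) || (N <= v x).
Definition inO (x : F) : bool := vge x 0.
Definition inPO (x : F) : bool := vge x 1.
Definition unitO (x : F) : bool := (x != 0) && (v x == 0).

Definition i0 : 'I_2 := ord0.
Definition i1 : 'I_2 := ord_max.

Definition mx2 (a b c d : F) : 'M[F]_2 :=
  \matrix_(i < 2, j < 2)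
    if (i : nat) == 0%N then (if (j : nat) == 0%N then a else b)
    else (if (j : nat) == 0%N then c else d).

Definition inI (M : 'M[F]_2) : bool :=
  [&& inO (M i0 i0), inO (M i0 i1), inPO (M i1 i0), inO (M i1 i1) & unitO (\det M)].

Definition normz (M : 'M[F]_2) : 'M[F]_2 := (w0 ^ (- v (M i1 i1))) *: M.

Definition inIZ (M : 'M[F]_2) : bool := (M i1 i1 != 0) && inI (normz M).

Definition inI1 (M : 'M[F]_2) : bool :=
  [&& inI M, res (M i0 i0) == 1 & res (M i1 i1) == 1].

(* chi_r on IZ: chi_r(varpi^n u g) = (reduction of u d)^r *)
Definition chi (M : 'M[F]_2) : k := iota (res (normz M i1 i1)) ^+ r.
Definition chiT (M : 'M[F]_2) : k := if inIZ M then chi M else 0.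

(* [g,1] as a function on G: supported on IZ g^{-1}, value chi_r(h) at h g^{-1} *)
Definition br (g : 'M[F]_2) (x : 'M[F]_2) : k := chiT (x *m g).

(* finite formal combinations sum c_i [g_i,1] *)
Definition fsum := seq (k * 'M[F]_2).
Definition ev (s : fsum) (x : 'M[F]_2) : k := \sum_(cg <- s) cg.1 * br cg.2 x.
Definition actL (h : 'M[F]_2) (s : fsum) : fsum := [seq (cg.1, h *m cg.2) | cg <- s].
Definition scalef (c : k) (s : fsum) : fsum := [seq (c * cg.1, cg.2) | cg <- s].

Definition betam : 'M[F]_2 := mx2 0 1 w0 0.
Definition wm : 'M[F]_2 := mx2 0 1 1 0.

Definition T10 (s : fsum) : fsum :=
  flatten [seq [seq (cg.1, cg.2 *m mx2 w0 (teich l) 0 1) | l <- enum Fq] | cg <- s].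
Definition T12 (s : fsum) : fsum :=
  flatten [seq [seq (cg.1, cg.2 *m betam *m mx2 1 (teich l) 0 1 *m wm)
              | l <- enum Fq] | cg <- s].

Definition inW (phi : 'M[F]_2 -> k) : Prop :=
  exists s1 s2 : fsum,
    (forall x, ev (T10 s1) x = 0) /\ (forall x, ev (T12 s2) x = 0) /\
    (forall x, phi x = ev s1 x + ev s2 x).

Definition I1invariant (s : fsum) : Prop :=
  forall h, inI1 h -> inW (fun x => ev (actL h s) x - ev s x).

Definition tsum (mu : seq Fq) (m : nat) : F :=
  \sum_(i < m) teich (nth 0 mu i) * w0 ^+ i.

Definition s_el (n e : nat) : fsum :=
  [seq (iota (nth 0 mu n.-1) ^+ e, mx2 (w0 ^+ n) (tsum mu n) 0 1)
  | mu <- map val (enum {: n.-tuple Fq})].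
Definition t_el (n e : nat) : fsum :=
  [seq (iota (nth 0 mu n.-1) ^+ e,
        mx2 (w0 ^+ n.-1) (tsum mu n.-1) 0 1 *m mx2 1 (teich (nth 0 mu n.-1)) 0 1 *m wm)
  | mu <- map val (enum {: n.-tuple Fq})].

Definition elem (i : bidx) : fsum :=
  match i with
  | BId => [:: (1, 1%:M)]
  | BBeta => [:: (1, betam)]
  | BS l n b => let s := s_el n ((p ^ f).-1 - r + p ^ l)%N in if b then actL betam s else s
  | BT l n b => let s := t_el n (r + p ^ l)%N in if b then actL betam s else s
  end.

Definition comb (L : seq (k * bidx)) : fsum :=
  flatten [seq scalef c.1 (elem c.2) | c <- L].

End Defs.

(* Main.v *)
Require Import Defs.
From HB Require Import structures.
From mathcomp Require Import all_boot all_order all_algebra all_field.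
From mathcomp Require Import ring zify.
Set Implicit Arguments. Unset Strict Implicit. Unset Printing Implicit Defensive.
Import Order.TTheory GRing.Theory Num.Theory.
Local Open Scope ring_scope.

(* The cosets G/IZ are the oriented edges of the Bruhat-Tits
   tree; up to the two halves exchanged by beta they are represented, for n >= 0
   and x in O modulo w0^n, by A_n(x) = (w0^n x; 0 1) and B_n(x) = A_n(x) beta.
   T_{-1,0} and T_{1,2} act separately at every vertex, and their kernels can be
   read off: put q_A = q-1-r, q_B = r, and for a function phi on F_q let
   m_s = Sum_a phi(a) a^s.  In pi_r the sum Sum_a phi(a) A_{n+1}(x + w0^n [a])
   depends only on the moments m_s with binomial(q_B, s) <> 0 mod p, and if all
   those with s < q_B vanish it equals m_{q_B} B_n(x) (and symmetrically for B,
   up to sign).  So pi_r is a union of levels, and the moments with s < q_B,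
   resp. s < q_A, are coordinates on the successive quotients.

   I(1) acts on the x of A_n(x) and B_n(x) by Moebius transformations.  Let v be
   an invariant vector of level N.  Translations by w0^(N-1) [c] kill all top
   moments of v except those with s = q_B - p^l (resp. q_A - p^l), and
   translations by O show that these are constant: the top part of v is a
   combination of the s_N and t_N.  Conversely h s_N - s_N is a multiple of
   Sum psi^(p^l) B_{N-1}, where the digit psi moved by h is a quadratic polynomial
   in the last digit of x plus the carry of a sum of two Teichmueller
   representatives.  The carry is p/w0 times a sum of monomials a^(i p^m) with
   0 < i < p; all its relevant moments vanish, unless F = Q_p, where its moment of
   order 0 does not, which excludes the s_N and t_N from the invariants. *)

(** Every claim about [pi_r] is a claim about membership in the sum [W] of the two kernels.
    Membership is always reduced to one explicit family of kernel elements, [inW_moment].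
    Non-membership, needed for independence and for bounding the invariants, is tested with linear
    forms: a form kills both kernels as soon as it factors through each Hecke operator.
    [functional_ex] prescribes such a form at one level of the tree, continues it upwards and writes
    down its preimages under both operators; no basis of [pi_r] itself is constructed. The
    conditions on r keep exponents away from q-1, the only exponent below 2(q-1) whose power sum is
    nonzero. For f = 1 the quadratic digit polynomial adds up to 2 to an exponent of size at most r
    or q-1-r, whence 2 < r < p-3. For f > 1 the digits of r, being neither 0 nor p-1, leave a
    position where the total cannot have the digit p-1. The index n starts at 2 because the defect
    [h s_n - s_n] lives one level lower, and its vanishing needs a last digit there to sum over. *)

Section Binomials.

(** * Binomial coefficients modulo p and digitwise domination in base p *)

Local Open Scope nat_scope.
Variable p : nat.
Hypothesis Hp : prime p.

(** Vandermonde: in the convolution with ['C(p, i)] only i = 0 and i = p survive modulo p. *)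
Lemma bin_addp n k :
  'C(n + p, k) = 'C(n, k) + (if p <= k then 'C(n, k - p) else 0) %[mod p].
Proof.
have p0 : 0 < p by exact: prime_gt0.
rewrite addnC -binomial.Vandermonde big_ord_recl /= bin0 mul1n subn0.
apply/eqP; rewrite eqn_modDl; apply/eqP.
have vanish m : 0 < m -> m != p -> p %| 'C(p, m).
  move=> m0 mp; have [mlt|] := ltnP m p; first by apply: prime_dvd_bin; rewrite ?m0.
  by move=> le; rewrite bin_small ?dvdn0 // ltn_neqAle eq_sym mp.
case: ifP => pk.
  have ltpk : p.-1 < k by rewrite prednK.
  rewrite (bigD1 (Ordinal ltpk)) //= /bump /= add1n prednK // binn mul1n.
  rewrite -[in RHS](addn0 'C(n, k - p)); apply/eqP; rewrite eqn_modDl mod0n.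
  apply: dvdn_sum => i ne; apply: dvdn_mulr; apply: vanish => //.
  by apply: contraNneq ne => /eqP; rewrite add1n => /eqP e; apply/eqP/val_inj => /=; rewrite -e.
rewrite mod0n; apply/eqP; apply: dvdn_sum => i _; apply: dvdn_mulr.
apply: vanish; rewrite // neq_ltn; apply/orP; left.
by rewrite /bump /= add1n; have := ltn_ord i; lia.
Qed.

(** Induction on the high part [A]: by [bin_addp], adding p to the upper index becomes Pascal's rule
    for [A] and [C]. *)
Lemma lucas_step A b C d : b < p -> d < p ->
  'C(A * p + b, C * p + d) = 'C(A, C) * 'C(b, d) %[mod p].
Proof.
move=> bp dp; elim: A C => [|A IH] [|C].
- by rewrite !mul0n !add0n bin0 mul1n.
- by rewrite mul0n add0n bin0n /= mul0n bin_small //; lia.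
- rewrite mul0n add0n bin0 mul1n mulSnr -addnA (addnC p) addnA bin_addp.
  rewrite leqNgt dp /= addn0; have := IH 0.
  by rewrite mul0n add0n bin0 mul1n.
rewrite mulSnr -addnA (addnC p) addnA bin_addp.
have -> : p <= C.+1 * p + d by lia.
have -> : C.+1 * p + d - p = C * p + d by lia.
by rewrite -modnDm (IH C.+1) (IH C) modnDm binS mulnDl.
Qed.

(* [k] is dominated by [n] digit by digit in base [p] (Lucas). *)
Definition bsub (n k : nat) : bool := ~~ (p %| 'C(n, k)).

Lemma bsub_le n k : bsub n k -> k <= n.
Proof. by rewrite /bsub leqNgt; apply: contra => lt; rewrite bin_small ?dvdn0. Qed.

Lemma bsub_lucas n k : bsub n k = bsub (n %/ p) (k %/ p) && (k %% p <= n %% p).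
Proof.
have p0 : 0 < p by exact: prime_gt0.
have bp := ltn_pmod n p0; have dp := ltn_pmod k p0.
rewrite /bsub {1}(divn_eq n p) {1}(divn_eq k p) /dvdn lucas_step // -!/(dvdn _ _).
rewrite Euclid_dvdM // negb_or; congr (_ && _).
apply/idP/idP; first by rewrite leqNgt; apply: contra => lt; rewrite bin_small ?dvdn0.
(* The binomial coefficient of the last digits divides the factorial of a number smaller than p, so
   p does not divide it. *)
move=> le; have := bin_fact le; have fb : ~~ (p %| (n %% p)`!).
  elim: (n %% p) bp => [|m IHm] mp; first by rewrite Euclid_dvd1.
  by rewrite factS Euclid_dvdM // negb_or IHm ?gtnNdvd //; exact: ltnW.
by move=> e; apply: contra fb => h; rewrite -e; apply: dvdn_mulr.
Qed.

Lemma bsub_digit n k j : bsub n k -> (k %/ p ^ j) %% p <= (n %/ p ^ j) %% p.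
Proof.
elim: j n k => [|j IH] n k; rewrite bsub_lucas => /andP[h1 h2].
  by rewrite expn0 !divn1.
by rewrite expnS !divnMA; exact: IH.
Qed.

Lemma bsub_exp n l : bsub n (p ^ l) = (0 < (n %/ p ^ l) %% p).
Proof.
have p1 : 1 < p by exact: prime_gt1.
elim: l n => [|l IH] n; first by rewrite expn0 divn1 /bsub bin1 /dvdn lt0n.
have p0 := ltnW p1.
by rewrite bsub_lucas expnS mulKn // modnMr leq0n andbT IH divnMA.
Qed.

(** Modulo p this governs chains in the domination order: it gives transitivity, and decides what
    lies between two comparable numbers. *)
Lemma bin_trinomial n m k : k <= m -> m <= n ->
  'C(n, m) * 'C(m, k) = 'C(n, k) * 'C(n - k, m - k).
Proof.
move=> km mn; apply/eqP.
rewrite -(eqn_pmul2r (fact_gt0 k)) -(eqn_pmul2r (fact_gt0 (m - k))).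
rewrite -(eqn_pmul2r (fact_gt0 (n - m))); apply/eqP.
have e1 := bin_fact mn; have e2 := bin_fact km.
have e3 := bin_fact (leq_trans km mn).
have le4 : m - k <= n - k by lia.
have e4 := bin_fact le4; have e5 : n - k - (m - k) = n - m by lia.
rewrite e5 in e4.
transitivity n`!.
  by rewrite -e1 -[in RHS]e2; ring.
by rewrite -e3 -[in LHS]e4; ring.
Qed.

Lemma bsub_trans n m k : bsub n m -> bsub m k -> bsub n k.
Proof.
move=> h1 h2; have le1 := bsub_le h1; have le2 := bsub_le h2.
have := bin_trinomial le2 le1; move: h1 h2; rewrite /bsub => h1 h2 e.
have : ~~ (p %| 'C(n, m) * 'C(m, k)) by rewrite Euclid_dvdM // negb_or h1.
by rewrite e Euclid_dvdM // negb_or => /andP[].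
Qed.

(** From [i * 'C(p^l, i) = p^l * 'C(p^l - 1, i - 1)]: if the binomial were prime to p, then [p^l]
    would divide the smaller number i. *)
Lemma dvd_bin_exp l i : 0 < i < p ^ l -> p %| 'C(p ^ l, i).
Proof.
move=> /andP[i0 il]; apply/negPn/negP => h.
have e := mul_bin_diag (p ^ l) i.-1.
rewrite prednK // in e.
have : p ^ l %| i * 'C(p ^ l, i) by rewrite -e dvdn_mulr.
rewrite Gauss_dvdl; first by move/dvdn_leq => /(_ i0); lia.
by rewrite coprimeXl // prime_coprime.
Qed.

(** Witness: [n - p^l] with [p^l] the leading power in [n - k], whose digits are those of n minus
    those of k. Hence the numbers [n - p^l] are the only ones that can be covered by n in the
    domination order. *)
Lemma bsub_between n f k : n < p ^ f -> k < n -> bsub n k ->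
  (forall l, l < f -> k != n - p ^ l) ->
  exists m, [/\ k < m, m < n, bsub n m & bsub m k].
Proof.
move=> nf kn h hl; set d := n - k; have d0 : 0 < d by rewrite subn_gt0.
have p1 := prime_gt1 Hp.
have [lo hi] := andP (trunc_log_bounds p1 d0).
set l := trunc_log p d in lo hi; have P0 : 0 < p ^ l by rewrite expn_gt0 prime_gt0.
have lf : l < f by rewrite -(ltn_exp2l _ _ p1) (leq_ltn_trans lo) //; lia.
have := hl l lf => ne; exists (n - p ^ l).
have km : k < n - p ^ l by lia.
have mn : n - p ^ l <= n by lia.
have e := bin_trinomial (ltnW km) mn.
have hd : bsub d (p ^ l).
  rewrite bsub_exp modn_small; first by rewrite divn_gt0.
  by rewrite ltn_divLR // -expnS.
have : ~~ (p %| 'C(n, k) * 'C(n - k, n - p ^ l - k)).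
  rewrite Euclid_dvdM // negb_or -/d; move: (h); rewrite /bsub => -> /=.
  by rewrite subnAC bin_sub.
rewrite -e Euclid_dvdM // negb_or => /andP[h1 h2].
by split=> //; lia.
Qed.

(** Nothing lies strictly between [n - p^l] and n for domination: trinomial revision produces a
    factor ['C(p^l, i)] with 0 < i < p^l, divisible by p. *)
Lemma bsub_top n l k : p ^ l <= n -> k < n -> bsub n k -> n - p ^ l < k ->
  ~~ bsub k (n - p ^ l).
Proof.
move=> ln kn h lk; have mn : k <= n by exact: ltnW.
have e := bin_trinomial (ltnW lk) mn.
have hd : p %| 'C(n - (n - p ^ l), k - (n - p ^ l)).
  by rewrite subKn //; apply: dvd_bin_exp; lia.
have : p %| 'C(n, k) * 'C(k, n - p ^ l) by rewrite e dvdn_mull.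
by rewrite Euclid_dvdM // => /orP[h'|h']; rewrite /bsub ?h' //; move: h; rewrite /bsub h'.
Qed.

Lemma bsub_sub_exp n l : 0 < (n %/ p ^ l) %% p -> bsub n (n - p ^ l).
Proof.
rewrite -bsub_exp => h; have le := bsub_le h.
by rewrite /bsub bin_sub //; exact: h.
Qed.

(** All digits of [p^f - 1] are p-1, so the subtraction never borrows. *)
Lemma digit_compl f j x : x < p ^ f -> j < f ->
  (((p ^ f).-1 - x) %/ p ^ j) %% p = p.-1 - (x %/ p ^ j) %% p.
Proof.
have p0 := prime_gt0 Hp.
(* Quotient and remainder of the complement at once; the quotient is used with [P = p^j], the
   remainder with [P = p]. *)
have aux N P y : 0 < P -> y < N * P ->
    ((N * P).-1 - y) %/ P = N.-1 - y %/ P /\ ((N * P).-1 - y) %% P = P.-1 - y %% P.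
  move=> P0 yN; have lt : y %/ P < N by rewrite ltn_divLR.
  have ltm : y %% P < P by rewrite ltn_pmod.
  have e : (N * P).-1 - y = (N.-1 - y %/ P) * P + (P.-1 - y %% P).
    have ey := divn_eq y P.
    have eN : N = (y %/ P + (N.-1 - y %/ P)).+1 by lia.
    move: (y %/ P) (y %% P) ey eN lt ltm => a b ey; move: (N.-1 - a) => c eN _ ltm.
    by rewrite ey eN; nia.
  have lt2 : P.-1 - y %% P < P by lia.
  by rewrite e; split; rewrite ?divnMDl // ?modnMDl ?(divn_small lt2) ?(modn_small lt2) ?addn0.
move=> xf jf; have P0 : 0 < p ^ j by rewrite expn_gt0 p0.
have ef : p ^ f = (p ^ (f - j.+1) * p) * p ^ j by rewrite -expnSr -expnD; congr (_ ^ _); lia.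
have xf' : x < (p ^ (f - j.+1) * p) * p ^ j by rewrite -ef.
rewrite ef; have [-> _] := aux _ _ x P0 xf'.
have lt : x %/ p ^ j < p ^ (f - j.+1) * p by rewrite ltn_divLR // -ef.
by have [_ ->] := aux _ _ _ p0 lt.
Qed.

Lemma digit_mul_exp i m j : i < p -> j != m -> (i * p ^ m %/ p ^ j) %% p = 0.
Proof.
have p0 := prime_gt0 Hp.
move=> ip; rewrite neq_ltn => /orP[lt|lt].
  have -> : p ^ m = p ^ (m - j.+1) * p * p ^ j.
    by rewrite -expnSr -expnD; congr (_ ^ _); lia.
  by rewrite !mulnA mulnK ?expn_gt0 ?p0 // modnMl.
rewrite divn_small ?mod0n //; apply: (@leq_trans (p ^ m.+1)).
  by rewrite expnS ltn_pmul2r ?expn_gt0 ?p0.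
by rewrite leq_exp2l ?prime_gt1.
Qed.

(** Since f > 1 there is a digit position other than m. There [p^f - 1 - i p^m] has the digit p-1,
    while k, dominated by n, has a smaller one. *)
Lemma bsub_no_carry f n k i m : 1 < f -> n < p ^ f ->
  (forall j, j < f -> (n %/ p ^ j) %% p < p.-1) ->
  bsub n k -> i < p -> m < f -> i * p ^ m + k != (p ^ f).-1.
Proof.
move=> f1 nf hd h ip mf; apply/eqP => e.
have [j jf jm] : exists2 j, j < f & j != m.
  by case: m {mf e} (mf) => [|m] mf; [exists 1 | exists 0 => //; lia].
have xf : i * p ^ m < p ^ f.
  have : 0 < p ^ f by rewrite expn_gt0 prime_gt0.
  by lia.
have := digit_compl xf jf; rewrite digit_mul_exp // subn0.
have -> : (p ^ f).-1 - i * p ^ m = k by lia.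
move=> e'; have := leq_ltn_trans (bsub_digit j h) (hd j jf).
by rewrite e' ltnn.
Qed.

End Binomials.

(** * Power sums over the residue field and moments of functions on it *)

Section PowerSums.
Variables (p f : nat) (Fq : finFieldType) (k : fieldType) (iota : {rmorphism Fq -> k}).
Hypotheses (Hp : prime p) (Hf : (0 < f)%N) (HFq : #|Fq| = (p ^ f)%N) (Hpk : p \in [pchar k]).

Let q := (p ^ f)%N.

Lemma card_gt1 : (1 < q)%N.
Proof. by rewrite /q -HFq; apply: finRing_gt1. Qed.

Lemma iota_frob a : iota a ^+ q = iota a.
Proof. by rewrite -rmorphXn /= /q -HFq expf_card. Qed.

Lemma iota_period a m : (0 < m)%N -> iota a ^+ (m + q.-1) = iota a ^+ m.
Proof.
case: m => // m _; rewrite addSn -addnS prednK; last exact: ltnW card_gt1.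
by rewrite exprD iota_frob exprSr.
Qed.

Lemma iota_unit_exp a : a != 0 -> iota a ^+ q.-1 = 1.
Proof.
move=> a0; have i0 : iota a != 0 by rewrite fmorph_eq0.
apply: (mulfI i0); rewrite -exprS prednK ?mulr1 ?iota_frob //.
exact: ltnW card_gt1.
Qed.

Definition psum m : k := \sum_(a : Fq) iota a ^+ m.

Lemma psum0 : psum 0 = 0.
Proof.
rewrite /psum (eq_bigr (fun=> 1)) => [|a _]; last by rewrite expr0.
by rewrite sumr_const HFq natrX pcharf0 // expr0n gtn_eqF.
Qed.

Lemma psum_mulr m b : b != 0 -> psum m = iota b ^+ m * psum m.
Proof.
move=> b0; rewrite /psum mulr_sumr (reindex_inj (mulfI b0)) /=.
by apply: eq_bigr => a _; rewrite rmorphM exprMn.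
Qed.

(** Scaling the variable by b multiplies the sum by [b^m], and [X^m - 1] has too few roots for all
    nonzero b to satisfy [b^m = 1]. *)
Lemma psum_small m : (0 < m < q.-1)%N -> psum m = 0.
Proof.
move=> /andP[m0 mq].
have [b /andP[b0 bm]] : exists b : Fq, (b != 0) && (b ^+ m != 1).
  case: (pickP [pred b : Fq | (b != 0) && (b ^+ m != 1)]) => [b hb|h]; first by exists b.
  suff : (q.-1 <= m)%N by rewrite leqNgt mq.
  have P0 : 'X^m - 1 != 0 :> {poly Fq} by rewrite -size_poly_eq0 size_XnsubC.
  have := max_poly_roots P0 (rs := enum [pred b : Fq | b != 0]).
  rewrite enum_uniq size_XnsubC // -cardE => /(_ _ isT).
  rewrite ltnS (_ : #|_| = q.-1); last first.
    by rewrite (@eq_card _ _ (predC1 0)) // cardC1 HFq.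
  apply; apply/allP => b; rewrite mem_enum inE => b0.
  have := h b; rewrite /= b0 /= => /negbFE/eqP e.
  by rewrite /root !hornerE e subrr.
have h := psum_mulr m b0.
have : (iota b ^+ m - 1) * psum m = 0 by rewrite mulrBl mul1r -h subrr.
move/eqP; rewrite mulf_eq0 subr_eq0 => /orP[|/eqP //].
by rewrite -rmorphXn fmorph_eq1 (negbTE bm).
Qed.

Lemma psum_pred : psum q.-1 = -1.
Proof.
have q1 := card_gt1.
rewrite /psum (bigD1 0) //= rmorph0 expr0n.
have -> : (q.-1 == 0)%N = false by apply/negbTE; lia.
rewrite add0r (eq_bigr (fun=> 1)) => [|a a0]; last by rewrite iota_unit_exp.
rewrite sumr_const; have -> : #|[pred a : Fq | a != 0]| = q.-1.
  by rewrite (@eq_card _ _ (predC1 0)) // cardC1 HFq.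
apply/eqP; rewrite -subr_eq0 opprK natr1 prednK; last exact: ltnW.
by rewrite /q natrX pcharf0 // expr0n gtn_eqF.
Qed.

(** All exponents met below stay under 2(q-1), so that q-1 is the only one that counts. Exponent 0
    gives q = 0 in [k]. *)
Lemma psum_eq m : (m < q.-1.*2)%N -> psum m = if m == q.-1 then -1 else 0.
Proof.
have q1 := card_gt1.
move=> mq; case: eqVneq => [->|ne]; first exact: psum_pred.
have [lt|ge] := ltnP m q.-1.
  by case: m {mq ne} lt => [|m] lt; [exact: psum0 | exact: psum_small].
have [m' e m'0] : exists2 m', m = (m' + q.-1)%N & (0 < m')%N by exists (m - q.-1)%N; lia.
rewrite e {1}/psum (eq_bigr (fun a => iota a ^+ m')) => [|a _]; last exact: iota_period.
by apply: psum_small; rewrite m'0; lia.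
Qed.

Lemma poly_fun_eq0 (c : nat -> k) : (forall a, \sum_(i < q) c i * iota a ^+ i = 0) ->
  forall i, (i < q)%N -> c i = 0.
Proof.
move=> h; set P := \poly_(i < q) c i.
have P0 : P = 0.
  apply/eqP; apply/negPn/negP => nz.
  have := max_poly_roots nz (rs := [seq iota a | a <- enum Fq]).
  rewrite map_inj_uniq ?enum_uniq; last exact: fmorph_inj.
  rewrite size_map -cardE HFq ltnNge size_poly => H.
  suff: false by []. apply: H => //.
  by apply/allP => _ /mapP[a _ ->]; rewrite /root horner_poly h.
by move=> i iq; have := congr1 (fun R : {poly k} => R`_i) P0; rewrite coef_poly iq coef0.
Qed.

Definition power_moment (phi : Fq -> k) m : k := \sum_a phi a * iota a ^+ m.

Lemma moment_shift (phi : Fq -> k) m c :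
  \sum_a phi a * iota (a + c) ^+ m =
  \sum_(i < m.+1) power_moment phi i * 'C(m, i)%:R * iota c ^+ (m - i).
Proof.
transitivity (\sum_a \sum_(i < m.+1) phi a * iota a ^+ i * 'C(m, i)%:R * iota c ^+ (m - i)).
  apply: eq_bigr => a _; rewrite rmorphD addrC exprDn mulr_sumr.
  by apply: eq_bigr => i _; rewrite -mulr_natr; ring.
rewrite exchange_big; apply: eq_bigr => i _.
by rewrite -!mulr_suml.
Qed.

Lemma natr_bin_eq0 n m : ('C(n, m)%:R == 0 :> k) = ~~ bsub p n m.
Proof. by rewrite /bsub negbK (dvdn_pcharf Hpk). Qed.

(** The shifted moment is a polynomial in c of degree m < q. If it is constant as a function of c,
    its coefficients ['C(m, i) * m_i] of [c^(m-i)] vanish for i < m. *)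
Lemma moment_shift_inv (phi : Fq -> k) m : (m < q)%N ->
  (forall c, \sum_a phi a * iota (a + c) ^+ m = power_moment phi m) ->
  forall i, (i < m)%N -> bsub p m i -> power_moment phi i = 0.
Proof.
move=> mq h i im hi.
(* Coefficients indexed by the power of the shift; the constant term is 0 because the assumed value
   has been subtracted. *)
pose c j := if (j == 0)%N || (m < j)%N then 0 else power_moment phi (m - j) * 'C(m, m - j)%:R.
have H a : \sum_(j < q) c j * iota a ^+ j = 0.
  have := h a; rewrite moment_shift big_ord_recr /= binn mulr1 subnn mulr1.
  move/(canRL (addrK _)); rewrite subrr => e0; rewrite -[RHS]e0.
  rewrite -(big_mkord xpredT (fun j => c j * iota a ^+ j)).
  rewrite (big_cat_nat (n := m.+1)) //= [X in _ + X]big1_seq ?addr0; last first.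
    by move=> j /andP[_]; rewrite mem_index_iota /c => /andP[-> _]; rewrite orbT mul0r.
  rewrite big_nat_recl // {1}/c eqxx mul0r add0r -(big_mkord xpredT (fun i => power_moment phi i * 'C(m, i)%:R * iota a ^+ (m - i))).
  rewrite [RHS]big_nat_rev /= add0n; apply: eq_big_nat => j /andP[_ jm].
  by rewrite /c /= ltnNge jm /= subKn.
have lt : (m - i < q)%N by lia.
have := poly_fun_eq0 H lt; rewrite /c subKn ?(ltnW im) //.
have -> : ((m - i == 0) || (m < m - i))%N = false by apply/negbTE; lia.
by move/eqP; rewrite mulf_eq0 natr_bin_eq0 hi orbF => /eqP.
Qed.

End PowerSums.

(** * Two-by-two matrices through their four entries *)

Section TwoByTwo.
Variable F : fieldType.

Lemma mx2E00 (a b c d : F) : mx2 a b c d i0 i0 = a. Proof. by rewrite mxE. Qed.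
Lemma mx2E01 (a b c d : F) : mx2 a b c d i0 i1 = b. Proof. by rewrite mxE. Qed.
Lemma mx2E10 (a b c d : F) : mx2 a b c d i1 i0 = c. Proof. by rewrite mxE. Qed.
Lemma mx2E11 (a b c d : F) : mx2 a b c d i1 i1 = d. Proof. by rewrite mxE. Qed.
Definition mx2E := (mx2E00, mx2E01, mx2E10, mx2E11).

Lemma mx2_eq (A B : 'M[F]_2) :
  A i0 i0 = B i0 i0 -> A i0 i1 = B i0 i1 -> A i1 i0 = B i1 i0 -> A i1 i1 = B i1 i1 -> A = B.
Proof.
move=> e00 e01 e10 e11; apply/matrixP => i j.
have two (l : 'I_2) : l = i0 \/ l = i1.
  by case: l => [[|[|//]]] h; [left|right]; apply: val_inj.
by case: (two i) => ->; case: (two j) => ->.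
Qed.

Lemma mx2_eta (A : 'M[F]_2) : A = mx2 (A i0 i0) (A i0 i1) (A i1 i0) (A i1 i1).
Proof. by apply: mx2_eq; rewrite mx2E. Qed.

Lemma sum_I2 (G : 'I_2 -> F) : \sum_i G i = G i0 + G i1.
Proof. by rewrite big_ord_recl big_ord1; congr (_ + G _); apply: val_inj. Qed.

Lemma mx2M (a b c d a' b' c' d' : F) : mx2 a b c d *m mx2 a' b' c' d' =
  mx2 (a * a' + b * c') (a * b' + b * d') (c * a' + d * c') (c * b' + d * d').
Proof. by apply: mx2_eq; rewrite !mx2E mxE sum_I2 !mx2E. Qed.

Lemma mx2Z (y a b c d : F) : y *: mx2 a b c d = mx2 (y * a) (y * b) (y * c) (y * d).
Proof. by apply: mx2_eq; rewrite !mx2E mxE mx2E. Qed.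

Lemma mx2_1 : 1%:M = mx2 1 0 0 1 :> 'M[F]_2.
Proof. by apply: mx2_eq; rewrite !mx2E mxE. Qed.

Lemma det_mx2 (a b c d : F) : \det (mx2 a b c d) = a * d - b * c.
Proof.
rewrite (expand_det_row _ i0) sum_I2 !mx2E /cofactor !det_mx11 !mxE /=.
by rewrite expr0 expr1 /=; ring.
Qed.

(** Turns a linear consequence of a known equation into a [ring] identity, once the multiplier c is
    supplied. *)
Lemma lincomb c (a b x y : F) : a = b -> x - y = c * (a - b) -> x = y.
Proof. by move=> ->; rewrite subrr mulr0 => /eqP; rewrite subr_eq0 => /eqP. Qed.

End TwoByTwo.

(** * Arithmetic of the valuation ring and of the residue map *)

Section Iwahori.
Variables (p f ram : nat) (F : fieldType) (v : F -> int) (w0 : F)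
  (Fq : finFieldType) (res : F -> Fq) (teich : Fq -> F)
  (k : fieldType) (iota : {rmorphism Fq -> k}) (r : nat).
Hypotheses (Hp : prime p) (Hf : (0 < f)%N)
  (HvM : forall x y : F, x != 0 -> y != 0 -> v (x * y) = v x + v y)
  (HvD : forall x y : F, x != 0 -> y != 0 -> x + y != 0 ->
           Num.min (v x) (v y) <= v (x + y))
  (Hw0 : w0 != 0) (Hvw0 : v w0 = 1)
  (HFq : #|Fq| = (p ^ f)%N)
  (HresD : forall x y, inO v x -> inO v y -> res (x + y) = res x + res y)
  (HresM : forall x y, inO v x -> inO v y -> res (x * y) = res x * res y)
  (Hres1 : res 1 = 1)
  (Hresker : forall x, inO v x -> (res x == 0) = inPO v x)
  (Ht0 : teich 0 = 0) (HtM : forall a b, teich (a * b) = teich a * teich b)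
  (HtO : forall a, inO v (teich a)) (Htres : forall a, res (teich a) = a)
  (Hpk : p \in [pchar k]).

Local Notation O := (inO v).

Lemma v1 : v 1 = 0.
Proof.
have := HvM (oner_neq0 F) (oner_neq0 F); rewrite mulr1 => h.
by apply: (@addrI _ (v 1)); rewrite -h addr0.
Qed.

Lemma vN x : x != 0 -> v (- x) = v x.
Proof.
move=> x0; have m0 : (-1 : F) != 0 by rewrite oppr_eq0 oner_neq0.
have := HvM m0 m0; rewrite mulrNN mulr1 v1 => h.
by rewrite -mulN1r HvM //; lia.
Qed.

Lemma vV x : x != 0 -> v x^-1 = - v x.
Proof.
move=> x0; have xi : x^-1 != 0 by rewrite invr_eq0.
by have := HvM x0 xi; rewrite divff // v1; lia.
Qed.

Lemma vgeM x y M N : vge v x M -> vge v y N -> vge v (x * y) (M + N).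
Proof.
rewrite /vge mulf_eq0; have [-> //|x0] := eqVneq x 0.
have [//|y0 /=] := eqVneq y 0; by rewrite HvM //; lia.
Qed.

Lemma vgeD x y N : vge v x N -> vge v y N -> vge v (x + y) N.
Proof.
rewrite /vge; have [->|x0] := eqVneq x 0; first by rewrite add0r.
have [->|y0] := eqVneq y 0; first by rewrite addr0 (negbTE x0).
have [//|s0 /= h1 h2] := eqVneq (x + y) 0.
by apply: le_trans (HvD x0 y0 s0); rewrite le_min h1.
Qed.

Lemma OM x y : O x -> O y -> O (x * y).
Proof. exact: vgeM. Qed.
Lemma OD x y : O x -> O y -> O (x + y).
Proof. exact: vgeD. Qed.
Lemma ON x : O x -> O (- x).
Proof. by rewrite /inO /vge oppr_eq0; have [//|x0] := eqVneq x 0; rewrite vN. Qed.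
Lemma OB x y : O x -> O y -> O (x - y).
Proof. by move=> h1 h2; apply: OD => //; apply: ON. Qed.
Lemma O0 : O 0. Proof. by rewrite /inO /vge eqxx. Qed.
Lemma O1 : O 1. Proof. by rewrite /inO /vge v1 lexx orbT. Qed.
Lemma Ow : O w0. Proof. by rewrite /inO /vge Hvw0 orbT. Qed.
Lemma OX x n : O x -> O (x ^+ n).
Proof. by move=> h; elim: n => [|n IH]; [exact: O1 | rewrite exprS; exact: OM]. Qed.
Lemma On n : O n%:R.
Proof. by elim: n => [|n IH]; [exact: O0 | rewrite -natr1; apply: OD => //; exact: O1]. Qed.
Lemma OMn x n : O x -> O (x *+ n).
Proof. by move=> h; rewrite -mulr_natr; apply: OM => //; apply: On. Qed.
Lemma Osum (I : finType) (P : pred I) (G : I -> F) :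
  (forall i, P i -> O (G i)) -> O (\sum_(i | P i) G i).
Proof. by move=> h; apply: (big_ind O) => //; [exact: O0 | exact: OD]. Qed.

Ltac solveO := repeat first [ assumption | exact: O0 | exact: O1 | exact: Ow
  | apply: HtO | apply: On | apply: OMn | apply: OX | apply: ON | apply: OM | apply: OD ].

Lemma PO_w0 x : inPO v (w0 * x) = O x.
Proof.
rewrite /inPO /inO /vge mulf_eq0 (negbTE Hw0) /=.
by have [//|x0] := eqVneq x 0; rewrite HvM // Hvw0 /=; lia.
Qed.

Lemma res0 : res 0 = 0.
Proof. by apply/eqP; rewrite (Hresker O0) /inPO /vge eqxx. Qed.
Lemma resN x : O x -> res (- x) = - res x.
Proof.
move=> h; apply/eqP; rewrite -subr_eq0 opprK -HresD ?addNr ?res0 //; exact: ON.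
Qed.
Lemma resB x y : O x -> O y -> res (x - y) = res x - res y.
Proof. by move=> hx hy; rewrite HresD ?resN //; apply: ON. Qed.
Lemma resX x n : O x -> res (x ^+ n) = res x ^+ n.
Proof.
by move=> h; elim: n => [|n IH]; rewrite ?expr0 // !exprS HresM ?IH //; apply: OX.
Qed.
Lemma res_w0 x : O x -> res (w0 * x) = 0.
Proof. by move=> h; apply/eqP; rewrite Hresker ?PO_w0 //; solveO. Qed.
Lemma res_nat n : res n%:R = n%:R.
Proof.
elim: n => [|n IH]; first exact: res0.
by rewrite -!natr1 HresD ?IH ?Hres1 //; [exact: On | exact: O1].
Qed.
Lemma res_sum (I : finType) (P : pred I) (G : I -> F) :
  (forall i, P i -> O (G i)) -> res (\sum_(i | P i) G i) = \sum_(i | P i) res (G i).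
Proof.
move=> h; suff [] : O (\sum_(i | P i) G i) /\ res (\sum_(i | P i) G i) = \sum_(i | P i) res (G i) by [].
apply: (big_ind2 (fun x y => O x /\ res x = y)).
- by rewrite res0 O0.
- by move=> x1 x2 y1 y2 [o1 <-] [o2 <-]; split; [exact: OD | exact: HresD].
- by move=> i /h.
Qed.

Lemma res_eq0P x : O x -> res x = 0 -> exists2 y, O y & x = w0 * y.
Proof.
move=> hx /eqP; rewrite Hresker // => h; exists (w0^-1 * x); last by rewrite mulVKf.
by rewrite -PO_w0 mulVKf.
Qed.

Lemma res_neq0 x : O x -> (res x != 0) = unitO v x.
Proof.
move=> hx; rewrite Hresker // /inPO /vge /unitO negb_or; case: eqVneq => //= x0.
by move: hx; rewrite /inO /vge (negbTE x0) /=; lia.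
Qed.

Lemma res_neq0_neq0 x : O x -> res x != 0 -> x != 0.
Proof. by move=> hx; rewrite res_neq0 // => /andP[]. Qed.

Lemma OV x : O x -> res x != 0 -> O x^-1.
Proof.
move=> hx; rewrite res_neq0 // => /andP[x0 /eqP vx].
by rewrite /inO /vge invr_eq0 (negbTE x0) vV //= vx.
Qed.

Lemma resV x : O x -> res x != 0 -> res x^-1 = (res x)^-1.
Proof.
move=> hx rx; have x0 := res_neq0_neq0 hx rx.
by apply: (mulfI rx); rewrite -HresM ?divff // OV.
Qed.

Lemma vw_exp n : v (w0 ^+ n) = n%:Z.
Proof.
by elim: n => [|n IH]; rewrite ?expr0 ?v1 // exprS HvM ?expf_neq0 // IH Hvw0.
Qed.

Lemma vw_expz (z : int) : v (w0 ^ z) = z.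
Proof.
case: z => n; first by rewrite -exprnP vw_exp.
by rewrite NegzE -exprnN vV ?expf_neq0 // vw_exp.
Qed.

Lemma decomp x : x != 0 -> exists2 u, O u /\ res u != 0 & x = w0 ^ (v x) * u.
Proof.
move=> x0; have w := expfz_neq0 (v x) Hw0; have wn := expfz_neq0 (- v x) Hw0.
pose u := w0 ^ (- v x) * x.
have u0 : u != 0 by rewrite mulf_neq0.
have vu : v u = 0 by rewrite HvM // vw_expz addrC subrr.
have uO : O u by rewrite /inO /vge vu lexx orbT.
exists u; last by rewrite /u mulrA -expfzDr // subrr expr0z mul1r.
by split=> //; rewrite res_neq0 // /unitO u0 vu eqxx.
Qed.

(** * The Iwahori subgroup modulo the centre *)

Lemma inIZ_mx (z : int) a b c d : O a -> O b -> O c -> O d -> res a != 0 -> res d != 0 ->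
  inIZ v w0 (w0 ^ z *: mx2 a b (w0 * c) d) /\
  chiT v w0 res iota r (w0 ^ z *: mx2 a b (w0 * c) d) = iota (res d) ^+ r.
Proof.
move=> ha hb hc hd ra rd; have d0 := res_neq0_neq0 hd rd.
have w := expfz_neq0 z Hw0.
(* As d is a unit, the corner entry has valuation z, and [normz] removes exactly the scalar
   [w0^z]. *)
have N : normz v w0 (w0 ^ z *: mx2 a b (w0 * c) d) = mx2 a b (w0 * c) d.
  rewrite /normz mxE mx2E HvM // vw_expz scalerA -expfzDr //.
  have /andP[_ /eqP ->] : unitO v d by rewrite -res_neq0.
  by rewrite addr0 addrC subrr expr0z scale1r.
have I : inIZ v w0 (w0 ^ z *: mx2 a b (w0 * c) d).
  rewrite /inIZ N mxE mx2E mulf_neq0 //= /inI !mx2E ha hb hd PO_w0 hc /=.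
  have od : O (a * d - b * (w0 * c)) by solveO.
  rewrite det_mx2 -res_neq0 // mulrCA resB; [|by solveO|by solveO].
  by rewrite res_w0 ?HresM ?subr0 ?mulf_neq0 //; solveO.
by rewrite /chiT I /chi N mx2E.
Qed.

Lemma inIZ_ex M : inIZ v w0 M -> exists (z : int) a b c d,
  [/\ [/\ O a, O b, O c & O d], res a != 0, res d != 0 & M = w0 ^ z *: mx2 a b (w0 * c) d].
Proof.
case/andP => m0; set N := normz v w0 M.
have eM : M = w0 ^ (v (M i1 i1)) *: N.
  by rewrite scalerA -expfzDr // subrr expr0z scale1r.
case/and5P => h00 h01 h10 h11 hdet.
have r1 : res (N i1 i1) != 0.
  rewrite res_neq0 // /unitO /N !mxE mulf_neq0 ?expfz_neq0 //=.
  by rewrite HvM ?expfz_neq0 // vw_expz addrC subrr.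
have o10 : O (w0^-1 * N i1 i0) by rewrite -PO_w0 mulVKf.
have eN := mx2_eta N; rewrite -[N i1 i0](mulVKf Hw0) in eN.
exists (v (M i1 i1)), (N i0 i0), (N i0 i1), (w0^-1 * N i1 i0), (N i1 i1).
split=> //; last by rewrite -eN.
move: hdet; rewrite [\det _](congr1 determinant eN) det_mx2 -res_neq0; last by solveO.
rewrite [X in _ - X]mulrCA resB; [|by solveO|by solveO].
rewrite res_w0 ?HresM ?subr0 //; last by solveO.
by apply: contraNneq => ->; rewrite mul0r.
Qed.

Lemma chiTN h : ~~ inIZ v w0 h -> chiT v w0 res iota r h = 0.
Proof. by rewrite /chiT => /negbTE ->. Qed.

(** Modulo [w0] the integral parts are upper triangular, so their diagonal residues multiply. *)
Lemma inIZM g h : inIZ v w0 g -> inIZ v w0 h ->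
  inIZ v w0 (g *m h) /\
  chiT v w0 res iota r (g *m h) = chiT v w0 res iota r g * chiT v w0 res iota r h.
Proof.
case/inIZ_ex => z [a] [b] [c] [d] [[ha hb hc hd] ra rd ->].
case/inIZ_ex => z' [a'] [b'] [c'] [d'] [[ha' hb' hc' hd'] ra' rd' ->].
have [_ ->] := inIZ_mx z ha hb hc hd ra rd.
have [_ ->] := inIZ_mx z' ha' hb' hc' hd' ra' rd'.
rewrite -scalemxAl -scalemxAr scalerA -expfzDr // mx2M.
have -> : w0 * c * a' + d * (w0 * c') = w0 * (c * a' + d * c') by ring.
have R1 : res (a * a' + b * (w0 * c')) = res a * res a'.
  by rewrite mulrCA HresD ?res_w0 ?addr0 ?HresM //; solveO.
have R2 : res (w0 * c * b' + d * d') = res d * res d'.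
  by rewrite -mulrA HresD ?res_w0 ?add0r ?HresM //; solveO.
have [||||||-> ->] := @inIZ_mx (z + z') (a * a' + b * (w0 * c')) (a * b' + b * d')
   (c * a' + d * c') (w0 * c * b' + d * d'); try by solveO.
- by rewrite R1 mulf_neq0.
- by rewrite R2 mulf_neq0.
by rewrite R2 rmorphM exprMn.
Qed.

Lemma inIZ_inv h : inIZ v w0 h -> exists2 h', inIZ v w0 h' & h *m h' = 1%:M.
Proof.
case/inIZ_ex => z [a] [b] [c] [d] [[ha hb hc hd] ra rd ->].
set D := a * d - b * (w0 * c); have oD : O D by rewrite /D; solveO.
have rD : res D = res a * res d.
  rewrite /D mulrCA resB; [|by solveO|by solveO].
  by rewrite res_w0 ?HresM ?subr0 //; solveO.
have rD0 : res D != 0 by rewrite rD mulf_neq0.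
have oV := OV oD rD0; have D0 := res_neq0_neq0 oD rD0.
have rV0 : res D^-1 != 0 by rewrite resV // invr_eq0.
exists (w0 ^ (- z) *: mx2 (D^-1 * d) (D^-1 * (- b)) (w0 * (D^-1 * (- c))) (D^-1 * a)).
  apply: (proj1 (inIZ_mx _ _ _ _ _ _ _)); try by solveO.
  - by rewrite HresM ?mulf_neq0.
  - by rewrite HresM ?mulf_neq0.
rewrite -scalemxAl -scalemxAr scalerA -expfzDr // subrr expr0z scale1r mx2M mx2_1.
by congr mx2; rewrite /D; field.
Qed.

Lemma chiTM g h : inIZ v w0 h ->
  chiT v w0 res iota r (g *m h) = chiT v w0 res iota r g * chiT v w0 res iota r h.
Proof.
move=> hh; have [hg|hg] := boolP (inIZ v w0 g); first exact: (proj2 (inIZM hg hh)).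
rewrite (chiTN hg) mul0r chiTN //; apply: contra hg => hgh.
have [h' ih' e1] := inIZ_inv hh.
by have [] := inIZM hgh ih'; rewrite -mulmxA e1 mulmx1.
Qed.

Lemma inIZ_unit h : inIZ v w0 h -> h \in unitmx.
Proof. by case/inIZ_inv => h' _ /mulmx1_unit[]. Qed.

(* Through [[g,1] |-> lam g] these are the linear forms on the compact induction. *)
Definition eqf (lam : 'M[F]_2 -> k) : Prop :=
  forall g h, inIZ v w0 h -> lam (g *m h) = chiT v w0 res iota r h * lam g.

Lemma eqf_br X : eqf (fun g => br v w0 res iota r g X).
Proof. by move=> g h hh; rewrite /br mulmxA chiTM // mulrC. Qed.

Lemma eqfL lam M : eqf lam -> eqf (fun g => lam (M *m g)).
Proof. by move=> h g x hx; rewrite mulmxA h. Qed.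

Lemma eqf_mx lam g (z : int) a b c d : eqf lam ->
  O a -> O b -> O c -> O d -> res a != 0 -> res d != 0 ->
  lam (g *m (w0 ^ z *: mx2 a b (w0 * c) d)) = iota (res d) ^+ r * lam g.
Proof.
move=> hl ha hb hc hd ra rd; have [h1 h2] := inIZ_mx z ha hb hc hd ra rd.
by rewrite hl // h2.
Qed.

Lemma eqf_scale lam g (z : int) : eqf lam -> lam (w0 ^ z *: g) = lam g.
Proof.
move=> hl; have := @eqf_mx lam g z 1 0 0 1 hl O1 O0 O0 O1.
rewrite Hres1 oner_neq0 => /(_ isT isT).
by rewrite mulr0 -mx2_1 -scalemxAr mulmx1 rmorph1 expr1n mul1r.
Qed.

(** * Normal forms for the cosets [g IZ] *)

Definition bt (b : bool) : 'M[F]_2 := if b then betam w0 else 1%:M.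

(* [rp false false n x] and [rp false true n x] are the edges of the tree with
   end points at distances [n] and [n - 1] from the standard vertex, pointing
   towards it, resp. away from it; [rp true] is the other half of the tree. *)
Definition rp (i j : bool) (n : nat) (x : F) : 'M[F]_2 :=
  bt i *m (mx2 (w0 ^+ n) x 0 1 *m bt j).

Lemma inIZ_scale y a b c d : y != 0 -> O a -> O b -> O c -> O d ->
  res a != 0 -> res d != 0 -> inIZ v w0 (y *: mx2 a b (w0 * c) d).
Proof.
move=> /decomp[u [ou ru] ->] ha hb hc hd ra rd.
have -> : (w0 ^ v y * u) *: mx2 a b (w0 * c) d =
   w0 ^ v y *: mx2 (u * a) (u * b) (w0 * (u * c)) (u * d).
  by rewrite -scalerA mx2Z; congr (_ *: mx2 _ _ _ _); ring.
by apply: (proj1 (inIZ_mx _ _ _ _ _ _ _)); rewrite ?HresM ?mulf_neq0 //; solveO.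
Qed.

(** [betam] normalizes [IZ], exchanging the two diagonal entries. The character is not preserved by
    this exchange, so only membership is recorded. *)
Lemma inIZ_bt b h : inIZ v w0 h -> exists2 h', inIZ v w0 h' & h *m bt b = bt b *m h'.
Proof.
case: b => /= hh; last by exists h; rewrite ?mul1mx ?mulmx1.
case/inIZ_ex: hh => z [a] [b] [c] [d] [[ha hb hc hd] ra rd ->].
exists (w0 ^ z *: mx2 d c (w0 * b) a); first by case: (inIZ_mx z hd hc hb ha rd ra).
by rewrite /betam -scalemxAl -scalemxAr !mx2M; congr (_ *: mx2 _ _ _ _); ring.
Qed.

Lemma bt_bt b c : bt b *m bt c = w0 ^ (Posz (b && c)) *: bt (b (+) c).
Proof.
case: b; case: c; rewrite ?mul1mx ?mulmx1 ?expr0z ?scale1r //= /betam mx2M mx2_1.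
by rewrite -exprnP expr1 mx2Z; congr mx2; ring.
Qed.

(** Column operations that clear the bottom row. The right factor lies in [IZ] when c / d is in
    [w0 O] here, when d / c is in [O] in [row_red2]; [bottom_cases] says that one of these always
    holds. *)
Lemma row_red1 (a b c d : F) : d != 0 ->
  mx2 a b c d = mx2 ((a * d - b * c) / d ^+ 2) (b / d) 0 1 *m (d *: mx2 1 0 (c / d) 1).
Proof. by move=> d0; rewrite mx2Z mx2M; congr mx2; field. Qed.

Lemma row_red2 (a b c d : F) : c != 0 ->
  mx2 a b c d = mx2 (- w0 * (a * d - b * c) / c ^+ 2) (a / c) 0 1 *m betam w0
                *m ((c / w0) *: mx2 1 (d / c) 0 1).
Proof. by move=> c0; rewrite mx2Z /betam !mx2M; congr mx2; field; rewrite ?c0 ?Hw0. Qed.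

Lemma bottom_cases c d : (c != 0) || (d != 0) ->
  (d != 0 /\ O (c / (w0 * d))) \/ (c != 0 /\ O (d / c)).
Proof.
have [->|c0] := eqVneq c 0; first by move=> /= d0; left; rewrite mul0r O0.
have [->|d0 _] := eqVneq d 0; first by right; rewrite mul0r O0.
rewrite /inO /vge !mulf_eq0 !invr_eq0 mulf_eq0 (negbTE c0) (negbTE d0) (negbTE Hw0) /=.
rewrite !HvM ?invr_eq0 ?mulf_neq0 // !vV ?mulf_neq0 // HvM // Hvw0.
by case: (leP 0 (v c - (1 + v d))) => h; [left | right]; split=> //; lia.
Qed.

Lemma nf_tri A B : A != 0 -> 0 <= v A -> O B ->
  exists n h, inIZ v w0 h /\ mx2 A B 0 1 = mx2 (w0 ^+ n) B 0 1 *m h.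
Proof.
move=> A0 vA oB; have [u [ou ru] e] := decomp A0.
exists `|v A|%N, (1 *: mx2 u 0 (w0 * 0) 1); split.
  by apply: inIZ_scale; rewrite ?oner_neq0 ?Hres1 ?oner_neq0 //; solveO.
rewrite scale1r mx2M; congr mx2; try ring.
by rewrite {1}e -[v A]gez0_abs //= exprnP /=; ring.
Qed.

(** If [A] and [B] are not both integral the edge lies in the half i = true: after splitting off
    [betam] on the left, the bottom row is cleared a second time and the new entries are
    integral. *)
Lemma nf_upper A B : A != 0 -> exists i j n x h,
  [/\ O x, inIZ v w0 h & mx2 A B 0 1 = rp i j n x *m h].
Proof.
move=> A0; have [/andP[vA oB]|no] := boolP ((0 <= v A) && O B).
  have [n [h [hh e]]] := nf_tri A0 vA oB.
  by exists false, false, n, B, h; rewrite /rp /= mul1mx mulmx1.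
have w1 : w0^-1 != 0 by rewrite invr_eq0.
have e0 : mx2 A B 0 1 = betam w0 *m mx2 0 w0^-1 A B.
  by rewrite /betam mx2M; congr mx2; field.
have [[B0 hB]|[_ hB]] := @bottom_cases A B (introT orP (or_introl A0)).
  rewrite (@row_red1 0 w0^-1 A B B0) in e0.
  have vB : v B <= -1.
    move: no hB; rewrite /inO /vge mulf_eq0 invr_eq0 mulf_eq0 (negbTE A0) (negbTE B0) (negbTE Hw0) /=.
    by rewrite HvM ?invr_eq0 ?mulf_neq0 // vV ?mulf_neq0 // HvM // Hvw0; clear; lia.
  have vA : v B + 1 <= v A.
    move: hB; rewrite /inO /vge mulf_eq0 invr_eq0 mulf_eq0 (negbTE A0) (negbTE B0) (negbTE Hw0) /=.
    by rewrite HvM ?invr_eq0 ?mulf_neq0 // vV ?mulf_neq0 // HvM // Hvw0; clear; lia.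
  have B2 : (B ^+ 2)^-1 != 0 by rewrite invr_eq0 expf_neq0.
  have A'0 : (0 * B - w0^-1 * A) / B ^+ 2 != 0.
    by rewrite mulf_neq0 // mul0r add0r oppr_eq0 mulf_neq0.
  have oB' : O (w0^-1 / B).
    by rewrite /inO /vge HvM ?invr_eq0 // !vV // Hvw0; apply/orP; right; lia.
  have vA' : 0 <= v ((0 * B - w0^-1 * A) / B ^+ 2).
    rewrite mul0r add0r HvM ?oppr_eq0 ?mulf_neq0 // vN ?mulf_neq0 // HvM // !vV ?expf_neq0 //.
    by rewrite Hvw0 expr2 HvM //; move: vB vA; clear; lia.
  have [n [h [hh e]]] := nf_tri A'0 vA' oB'.
  exists true, false, n, (w0^-1 / B), (h *m (B *: mx2 1 0 (A / B) 1)); split=> //.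
    have -> : A / B = w0 * (A / (w0 * B)) by field; rewrite B0 Hw0.
    by apply: (proj1 (inIZM _ _)) => //; apply: inIZ_scale; rewrite ?Hres1 ?oner_neq0 //; solveO.
  by rewrite e0 e /rp /= mulmx1 !mulmxA.
rewrite (@row_red2 0 w0^-1 A B A0) in e0.
have eA : - w0 * (0 * B - w0^-1 * A) / A ^+ 2 = A^-1 by field; rewrite A0 Hw0.
rewrite eA mul0r in e0.
have vA : 0 <= v A^-1.
  rewrite vV //; move: no hB; rewrite /inO /vge mulf_eq0 invr_eq0 (negbTE A0) orbF.
  have [->|B0 /=] := eqVneq B 0; first by rewrite /= andbT; lia.
  by rewrite HvM ?invr_eq0 // vV //; clear; lia.
have A1 : A^-1 != 0 by rewrite invr_eq0.
have [n [h [hh e]]] := nf_tri A1 vA O0.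
have [h' hh' eh'] := inIZ_bt true hh.
exists true, true, n, 0, (h' *m ((A / w0) *: mx2 1 (B / A) 0 1)); split=> //.
- exact: O0.
- rewrite -(mulr0 w0); apply: (proj1 (inIZM _ _)) => //.
  apply: inIZ_scale; rewrite ?Hres1 ?oner_neq0 ?mulf_neq0 //; solveO.
rewrite e0 e /rp; move: eh'; rewrite /bt => eh'.
by rewrite -!mulmxA; congr (_ *m (_ *m _)); rewrite !mulmxA eh'.
Qed.

Lemma normal_form g : \det g != 0 -> exists i j n x h,
  [/\ O x, inIZ v w0 h & g = rp i j n x *m h].
Proof.
rewrite (mx2_eta g) det_mx2.
move: (g i0 i0) (g i0 i1) (g i1 i0) (g i1 i1) => a b c d hD.
have [A [B [j [h [A0 hh ->]]]]] : exists A B j h,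
    [/\ A != 0, inIZ v w0 h & mx2 a b c d = mx2 A B 0 1 *m bt j *m h].
  have cd : (c != 0) || (d != 0).
    by rewrite -negb_and; apply: contra hD => /andP[/eqP -> /eqP ->]; rewrite !mulr0 subrr.
  have [[d0 h]|[c0 h]] := bottom_cases cd.
    exists ((a * d - b * c) / d ^+ 2), (b / d), false, (d *: mx2 1 0 (c / d) 1); split.
    - by rewrite mulf_neq0 // invr_eq0 expf_neq0.
    - have -> : c / d = w0 * (c / (w0 * d)) by field; rewrite d0 Hw0.
      by apply: inIZ_scale; rewrite ?Hres1 ?oner_neq0 //; solveO.
    by rewrite /= mulmx1 -row_red1.
  exists (- w0 * (a * d - b * c) / c ^+ 2), (a / c), true, ((c / w0) *: mx2 1 (d / c) 0 1); split.
  - by rewrite mulf_neq0 ?invr_eq0 ?expf_neq0 // mulf_neq0 // oppr_eq0.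
  - rewrite -(mulr0 w0).
    by apply: inIZ_scale; rewrite ?mulf_neq0 ?invr_eq0 ?Hres1 ?oner_neq0 //; solveO.
  by rewrite /= -row_red2.
have [i [j' [n [x [h' [ox hh' ->]]]]]] := nf_upper B A0.
have [h2 hh2 e2] := inIZ_bt j hh'.
exists i, (j' (+) j), n, x, (w0 ^ (Posz (j' && j)) *: (h2 *m h)); split=> //.
  have [] := @inIZM (h2 *m h) (w0 ^ (Posz (j' && j)) *: 1%:M) (proj1 (inIZM hh2 hh)); last first.
    by rewrite -scalemxAr mulmx1.
  rewrite mx2_1 -[X in mx2 _ _ X](mulr0 w0).
  by apply: inIZ_scale; rewrite ?expfz_neq0 ?Hres1 ?oner_neq0 //; solveO.
rewrite /rp -(mulmxA _ h') e2 -!mulmxA -scalemxAr; congr (_ *m (_ *m _)).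
by rewrite !mulmxA bt_bt -!scalemxAl.
Qed.

Definition cong n x y := O ((y - x) / w0 ^+ n).

Lemma congE n x y : cong n x y -> exists2 z, O z & y = x + w0 ^+ n * z.
Proof.
move=> h; exists ((y - x) / w0 ^+ n) => //.
by rewrite mulrCA divff ?expf_neq0 // mulr1; ring.
Qed.
Lemma congI n x z : O z -> cong n x (x + w0 ^+ n * z).
Proof. by rewrite /cong addrC addKr mulrC mulKf // expf_neq0. Qed.
Lemma cong_refl n x : cong n x x.
Proof. by rewrite /cong subrr mul0r O0. Qed.
Lemma cong_sym n x y : cong n x y -> cong n y x.
Proof. by move=> /ON; rewrite -mulNr opprB. Qed.
Lemma cong_trans n x y z : cong n x y -> cong n y z -> cong n x z.
Proof. by move=> h1 h2; have := OD h1 h2; rewrite -mulrDl addrC addrA subrK. Qed.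
Lemma cong0 x y : O x -> O y -> cong 0 x y.
Proof. by move=> hx hy; rewrite /cong expr0 divr1; apply: OB. Qed.
Lemma congS n x y : cong n.+1 x y -> cong n x y.
Proof. by case/congE => z oz ->; rewrite exprSr -mulrA; apply: congI; solveO. Qed.

Lemma exp_unit (z z' : int) u u' : O u -> res u != 0 -> O u' -> res u' != 0 ->
  w0 ^ z * u = w0 ^ z' * u' -> z = z' /\ u = u'.
Proof.
move=> ou ru ou' ru' e; have w1 := expfz_neq0 z Hw0; have w2 := expfz_neq0 z' Hw0.
have := congr1 v e; move: (ru) (ru'); rewrite !res_neq0 // => /andP[u0 /eqP e1] /andP[u0' /eqP e2].
rewrite !HvM // e1 e2 !vw_expz !addr0 => ez; split=> //.
by rewrite ez in e; apply: (mulfI w2).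
Qed.

Lemma exp_le0 (z : int) y : w0 ^ z * y = 1 -> O y -> z <= 0.
Proof.
move=> e; have y0 : y != 0 by apply: contra_eq_neq e => ->; rewrite mulr0 eq_sym oner_neq0.
have := congr1 v e; rewrite HvM ?expfz_neq0 // vw_expz v1 /inO /vge (negbTE y0) /=.
by lia.
Qed.

Lemma exp_ge1 (z : int) u y : O u -> res u != 0 -> O y -> w0 ^ z * u = w0 * y -> 1 <= z.
Proof.
move=> ou ru oy e.
have u0 := res_neq0_neq0 ou ru; have w1 := expfz_neq0 z Hw0.
have y0 : y != 0.
  by apply: contra_eq_neq e => ->; rewrite mulr0 mulf_neq0.
have := congr1 v e; move: (ru); rewrite res_neq0 // => /andP[_ /eqP vu].
rewrite !HvM // vu vw_expz Hvw0; move: oy; rewrite /inO /vge (negbTE y0) /=; clear; lia.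
Qed.

Lemma res_expw n : res (w0 ^+ n) = (n == 0)%:R.
Proof. by case: n => [|n]; rewrite ?expr0 // exprS res_w0 //; apply: OX; apply: Ow. Qed.

Lemma mx2_inj (a b c d a' b' c' d' : F) : mx2 a b c d = mx2 a' b' c' d' ->
  [/\ a = a', b = b', c = c' & d = d'].
Proof.
move=> E; split; [have := congr1 (fun A : 'M_2 => A i0 i0) E | have := congr1 (fun A : 'M_2 => A i0 i1) E
  | have := congr1 (fun A : 'M_2 => A i1 i0) E | have := congr1 (fun A : 'M_2 => A i1 i1) E]; by rewrite !mx2E.
Qed.

Lemma bt_unit b : bt b \in unitmx.
Proof.
case: b; rewrite ?unitmx1 //= unitmxE det_mx2 unitfE mul0r add0r oppr_eq0 mul1r.
exact: Hw0.
Qed.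

Lemma rp_unit i j n x : rp i j n x \in unitmx.
Proof. by rewrite !unitmx_mul !bt_unit unitmxE det_mx2 mulr1 mulr0 subr0 unitfE expf_neq0. Qed.

Lemma one_unit z n n' x t d : O x -> O t -> O d ->
  w0 ^ z * (w0 ^+ n * d + x * (w0 * t)) = 1 -> z == Posz n' ->
  [/\ n' = 0%N, n = 0%N & res d = 1].
Proof.
move=> ox ot od e6 /eqP ez; have := exp_le0 e6 _; rewrite !OD ?OM ?OX ?Ow // => /(_ isT) zle.
have n'0 : n' = 0%N by lia.
have /(congr1 res) := e6; rewrite ez n'0 expr0z mul1r mulrCA.
rewrite HresD ?HresM ?res_expw ?Hres1 ?res_w0; try by solveO.
rewrite (_ : res w0 = 0) ?mul0r ?addr0; last by rewrite -[w0]mulr1 res_w0 ?O1.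
by case: n {e6} => [|n] /=; rewrite ?mul1r // mul0r => /eqP; rewrite eq_sym oner_eq0.
Qed.

(** The second alternative is vacuous here, as it contains [i = ~~ i]; it only gives the conclusion
    the shape of [rp_uniq]. *)
Lemma rp_uniq_same i j j' n n' x x' h : O x -> O x' -> inIZ v w0 h ->
  rp i j' n' x' = rp i j n x *m h ->
  chiT v w0 res iota r h = 1 /\
  ([/\ i = i, j' = j, n' = n & cong n x x'] \/
   [/\ i = ~~ i, j' = ~~ j, n = 0%N & n' = 0%N]).
Proof.
move=> ox ox' ih; rewrite /rp -!mulmxA => /(can_inj (mulKmx (bt_unit i))).
have [z [a] [b] [c] [d] [[ha hb hc hd] ra rd ->]] := inIZ_ex ih.
rewrite (proj2 (inIZ_mx z ha hb hc hd ra rd)).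
have rw0 : res 1 != 0 by rewrite Hres1 oner_neq0.
have w1 := expfz_neq0 z Hw0.
case: j; case: j'; rewrite /= ?mul1mx ?mulmx1 /betam -?scalemxAr !mx2M mx2Z => /mx2_inj[e1 e2 e3 e4].
- have e5 : w0 ^ z * a = w0 ^ (Posz 0) * 1.
    by apply: (mulfI Hw0); rewrite expr0z; apply: (lincomb (c := -1) e3); ring.
  have [ez ea] := exp_unit ha ra O1 rw0 e5; rewrite ez expr0z in e4 e2 e1.
  have b0 : b = 0 by apply: (mulfI Hw0); apply: (lincomb (c := -1) e4); ring.
  have e6 : w0 ^ (Posz n) * d = w0 ^ (Posz n') * 1.
    by rewrite -!exprnP; apply: (lincomb (c := -1) e2); rewrite b0; ring.
  have [en ed] := exp_unit hd rd O1 rw0 e6.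
  split; first by rewrite ed Hres1 rmorph1 expr1n.
  left; split=> //; first by case: en.
  suff -> : x' = x + w0 ^+ n * c by apply: congI.
  by apply: (mulfI Hw0); apply: (lincomb (c := 1) e1); rewrite ea; ring.
- exfalso; have /eqP : w0 ^ z * (w0 * a) = 0 by apply: (lincomb (c := -1) e3); ring.
  by rewrite !mulf_eq0 (negbTE w1) (negbTE Hw0) (negbTE (res_neq0_neq0 ha ra)).
- exfalso; have /eqP : w0 ^ z * d = 0 by apply: (lincomb (c := -1) e4); ring.
  by rewrite mulf_eq0 (negbTE w1) (negbTE (res_neq0_neq0 hd rd)).
have e5 : w0 ^ z * d = w0 ^ (Posz 0) * 1.
  by rewrite expr0z; apply: (lincomb (c := -1) e4); ring.
have [ez ed] := exp_unit hd rd O1 rw0 e5; rewrite ez expr0z in e1 e2 e3.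
have c0 : c = 0 by apply: (mulfI Hw0); apply: (lincomb (c := -1) e3); ring.
have e6 : w0 ^ (Posz n) * a = w0 ^ (Posz n') * 1.
  by rewrite -!exprnP; apply: (lincomb (c := -1) e1); rewrite c0; ring.
have [en ea] := exp_unit ha ra O1 rw0 e6.
split; first by rewrite ed Hres1 rmorph1 expr1n.
left; split=> //; first by case: en.
suff -> : x' = x + w0 ^+ n * b by apply: congI.
by apply: (lincomb (c := 1) e2); rewrite ed; ring.
Qed.

(** For j' = j the entries force both [z <= 0] and [1 <= z]; for j' different from j they force both
    levels to be 0. *)
Lemma rp_uniq_flip j j' n n' x x' h : O x -> O x' -> inIZ v w0 h ->
  rp true j' n' x' = rp false j n x *m h ->
  chiT v w0 res iota r h = 1 /\ [/\ j' = ~~ j, n = 0%N & n' = 0%N].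
Proof.
move=> ox ox' /inIZ_ex[z [a] [b] [c] [d] [[ha hb hc hd] ra rd ->]].
rewrite (proj2 (inIZ_mx z ha hb hc hd ra rd)) /rp mul1mx.
have rw0 : res 1 != 0 by rewrite Hres1 oner_neq0.
case: j; case: j'; rewrite /= ?mulmx1 /betam -?scalemxAr !mx2M mx2Z => /mx2_inj[e1 e2 e3 e4].
- exfalso; have e5 : w0 ^ z * a = w0 * x'.
    by apply: (mulfI Hw0); apply: (lincomb (c := -1) e3); ring.
  have e6 : w0 ^ z * (w0 ^+ n * c + x * a) = 1.
    by apply: (mulfI Hw0); apply: (lincomb (c := -1) e1); ring.
  have := exp_ge1 ha ra ox' e5; have := exp_le0 e6 _; rewrite !OD ?OM ?OX ?Ow //.
  by move=> /(_ isT); clear; lia.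
- have e5 : w0 ^ z * a = w0 ^ (Posz n') * 1.
    by apply: (mulfI Hw0); rewrite -exprnP; apply: (lincomb (c := -1) e3); ring.
  have [ez ea] := exp_unit ha ra O1 rw0 e5.
  have e6 : w0 ^ z * (w0 ^+ n * d + x * (w0 * b)) = 1.
    by apply: (lincomb (c := -1) e2); ring.
  have [n'0 n0 rd1] := one_unit ox hb hd e6 (introT eqP ez); split=> //.
  by rewrite rd1 rmorph1 expr1n.
- have e5 : w0 ^ z * d = w0 ^ (Posz n'.+1) * 1.
    by rewrite -exprnP exprS; apply: (lincomb (c := -1) e4); ring.
  have [ez ed] := exp_unit hd rd O1 rw0 e5.
  have e6 : w0 ^ (z - 1) * (w0 ^+ n * a + x * (w0 * c)) = 1.
    have ew := expfzDr 1 (z - 1) Hw0; rewrite expr1z addrC subrK in ew; rewrite ew in e1.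
    by apply: (mulfI Hw0); apply: (lincomb (c := -1) e1); ring.
  have [|n'0 n0 _] := one_unit ox hc ha e6 (n' := n').
    by rewrite ez; apply/eqP; clear; lia.
  by split=> //; rewrite ed Hres1 rmorph1 expr1n.
exfalso; have e5 : w0 ^ z * d = w0 * x'.
  by apply: (lincomb (c := -1) e4); ring.
have e6 : w0 ^ z * (w0 ^+ n * b + x * d) = 1.
  by apply: (lincomb (c := -1) e2); ring.
have := exp_ge1 hd rd ox' e5; have := exp_le0 e6 _; rewrite !OD ?OM ?OX ?Ow //.
by move=> /(_ isT); clear; lia.
Qed.

(** Besides moving x within its class, coincidences occur only at level 0, where [bt i *m bt j]
    depends up to scalars on [i (+) j] alone. In each case the transition matrix has character 1, so
    values on normal forms can be prescribed without a twist. *)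
Lemma rp_uniq i i' j j' n n' x x' h : O x -> O x' -> inIZ v w0 h ->
  rp i' j' n' x' = rp i j n x *m h ->
  chiT v w0 res iota r h = 1 /\ ([/\ i' = i, j' = j, n' = n & cong n x x'] \/
   [/\ i' = ~~ i, j' = ~~ j, n = 0%N & n' = 0%N]).
Proof.
move=> ox ox' ih; have [h' ih' hh'] := inIZ_inv ih.
case: i; case: i'.
- move=> e; exact: (@rp_uniq_same true).
- move=> e; have [||||e1 [e2 e3 e4]] := @rp_uniq_flip j' j n' n x' x h' => //.
    by rewrite e -mulmxA hh' mulmx1.
  split; last by right; rewrite e2 negbK.
  have := proj2 (inIZM ih ih'); rewrite hh' e1 mulr1 => <-.
  have [] := @inIZ_mx 0 1 0 0 1 O1 O0 O0 O1; rewrite ?Hres1 ?oner_neq0 // => _.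
  by rewrite expr0z scale1r mulr0 -mx2_1 rmorph1 expr1n.
- move=> e; have [-> [-> -> ->]] := rp_uniq_flip ox ox' ih e.
  by split=> //; right.
- by move=> e; exact: (@rp_uniq_same false).
Qed.

(** * Digits *)

Definition shift x := (x - teich (res x)) / w0.
Definition dig n x := res (iter n shift x).

Lemma shiftE x : x = teich (res x) + w0 * shift x.
Proof. by rewrite mulrCA divff // mulr1 addrC subrK. Qed.

Lemma shiftO x : O x -> O (shift x).
Proof.
move=> ox; rewrite -PO_w0 /shift mulrCA divff // mulr1 -Hresker; last by solveO.
by rewrite resB ?Htres ?subrr //; solveO.
Qed.

Lemma iter_shiftO n x : O x -> O (iter n shift x).
Proof. by move=> ox; elim: n => //= n IH; apply: shiftO. Qed.

Lemma shiftD x y : O x -> O y -> shift (x + w0 * y) = shift x + y.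
Proof.
move=> ox oy; rewrite /shift HresD ?res_w0 ?addr0 //; last by solveO.
by rewrite addrAC mulrDl mulrAC divff // mul1r.
Qed.

Lemma digD n y z : O y -> O z -> dig n (y + w0 ^+ n * z) = dig n y + res z.
Proof.
elim: n y => [|n IH] y oy oz; first by rewrite /dig /= expr0 mul1r HresD.
rewrite /dig !iterSr exprS -mulrA shiftD //; last by solveO.
by apply: IH => //; apply: shiftO.
Qed.

Lemma dig_cong n i y z : (i < n)%N -> O y -> cong n y z -> dig i z = dig i y.
Proof.
move=> iln oy /congE[t ot ->].
have -> : w0 ^+ n * t = w0 ^+ i * (w0 * (w0 ^+ (n - i.+1) * t)).
  by rewrite !mulrA -!exprSr -exprD; congr (_ ^+ _ * _); lia.
by rewrite digD ?res_w0 ?addr0 //; solveO.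
Qed.

Definition digs n x : n.-tuple Fq := [tuple dig i x | i < n].

Lemma expansion n x : x = tsum w0 teich (digs n x) n + w0 ^+ n * iter n shift x.
Proof.
have -> : tsum w0 teich (digs n x) n = \sum_(i < n) teich (dig i x) * w0 ^+ i.
  by apply: eq_bigr => i _; rewrite -tnth_nth tnth_mktuple.
elim: n => [|n IH]; first by rewrite big_ord0 expr0 mul1r add0r.
rewrite big_ord_recr /= {1}IH -addrA exprSr -mulrA; congr (_ + _).
by rewrite {1}[iter n shift x]shiftE mulrDr mulrC.
Qed.

Lemma tsumO mu n : O (tsum w0 teich mu n).
Proof. by apply: Osum => i _; solveO. Qed.

Lemma cong_digs n x : O x -> cong n (tsum w0 teich (digs n x) n) x.
Proof. by move=> ox; rewrite {2}[x](expansion n); apply: congI; apply: iter_shiftO. Qed.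

Lemma tsumS mu n : tsum w0 teich mu n.+1 = tsum w0 teich mu n + w0 ^+ n * teich (nth 0 mu n).
Proof. by rewrite /tsum big_ord_recr /= mulrC. Qed.

Lemma cong_tsum mu m n : (m <= n)%N -> cong m (tsum w0 teich mu m) (tsum w0 teich mu n).
Proof.
move=> /subnKC <-; elim: (n - m)%N => [|d IH]; first by rewrite addn0 cong_refl.
rewrite addnS tsumS; apply: cong_trans IH _.
by rewrite exprD -mulrA; apply: congI; solveO.
Qed.

(** Both parts are proved together: digit i is read off the truncation to i+1 digits, which requires
    that the shorter sum has digit 0 in position i. *)
Lemma dig_tsum_aux mu n : dig n (tsum w0 teich mu n) = 0 /\
  forall i, (i < n)%N -> dig i (tsum w0 teich mu n) = nth 0 mu i.
Proof.
elim/ltn_ind: n => n IH.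
have H i : (i < n)%N -> dig i (tsum w0 teich mu n) = nth 0 mu i.
  move=> iln; rewrite (dig_cong (ltnSn i) _ (cong_tsum mu iln)); last exact: tsumO.
  by rewrite tsumS digD ?(proj1 (IH i iln)) ?add0r ?Htres //; exact: tsumO.
split=> //; have := expansion n (tsum w0 teich mu n).
have -> : tsum w0 teich (digs n (tsum w0 teich mu n)) n = tsum w0 teich mu n.
  by apply: eq_bigr => i _; rewrite -tnth_nth tnth_mktuple H.
rewrite -{1}[tsum w0 teich mu n]addr0 => /addrI/eqP.
by rewrite eq_sym mulf_eq0 expf_eq0 (negbTE Hw0) andbF /= /dig => /eqP ->; apply: res0.
Qed.

Lemma dig_tsum mu n i : (i < n)%N -> dig i (tsum w0 teich mu n) = nth 0 mu i.
Proof. exact: (proj2 (dig_tsum_aux mu n)). Qed.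
Lemma dig_tsum_top mu n : dig n (tsum w0 teich mu n) = 0.
Proof. exact: (proj1 (dig_tsum_aux mu n)). Qed.

Lemma digs_tsum n (mu : n.-tuple Fq) : digs n (tsum w0 teich mu n) = mu.
Proof. by apply: eq_from_tnth => i; rewrite tnth_mktuple dig_tsum // -tnth_nth. Qed.

Lemma digs_cong n x y : O x -> cong n x y -> digs n y = digs n x.
Proof.
by move=> ox c; apply: eq_from_tnth => i; rewrite !tnth_mktuple (dig_cong _ ox c).
Qed.

Lemma tsum_rcons n (nu : n.-tuple Fq) a :
  tsum w0 teich (rcons nu a) n.+1 = tsum w0 teich nu n + w0 ^+ n * teich a.
Proof.
rewrite tsumS nth_rcons size_tuple ltnn eqxx; congr (_ + _).
by apply: eq_bigr => i _; rewrite nth_rcons size_tuple ltn_ord.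
Qed.

Lemma sum_rcons n (G : seq Fq -> k) :
  \sum_(mu : n.+1.-tuple Fq) G mu = \sum_(nu : n.-tuple Fq) \sum_a G (rcons nu a).
Proof.
rewrite pair_big /=; pose h (u : n.-tuple Fq * Fq) : n.+1.-tuple Fq := [tuple of rcons u.1 u.2].
have hi : injective h.
  move=> [u a] [u' a'] /(congr1 val) /= /rcons_inj[e ->]; congr (_, _).
  exact: val_inj.
have hb : bijective h by apply: inj_card_bij; rewrite // card_prod !card_tuple expnSr.
by rewrite (reindex h) //=; apply: onW_bij.
Qed.

(** * Equivariant functions determined by their values on normal forms *)

Lemma eqf_cong lam i j n x y : eqf lam -> O x -> cong n x y ->
  lam (rp i j n x) = lam (rp i j n y).
Proof.
move=> hl ox /congE[z oz ->]; symmetry; rewrite /rp.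
have [h [a [b [c [d [[oa ob oc od] ra rd eh]]]]] e] :
    exists2 h, (exists a b c d, [/\ [/\ O a, O b, O c & O d], res a = 1, res d = 1 & h = w0 ^ 0 *: mx2 a b (w0 * c) d])
      & mx2 (w0 ^+ n) (x + w0 ^+ n * z) 0 1 *m bt j = mx2 (w0 ^+ n) x 0 1 *m bt j *m h.
  case: j => /=; rewrite ?mulmx1.
    exists (mx2 1 0 (w0 * z) 1); last by rewrite /betam !mx2M; congr mx2; ring.
    exists 1, 0, z, 1; rewrite expr0z scale1r !Hres1; split=> //; split=> //; solveO.
  exists (mx2 1 z (w0 * 0) 1); last by rewrite !mx2M; congr mx2; ring.
  exists 1, z, 0, 1; rewrite expr0z scale1r !Hres1; split=> //; split=> //; solveO.
rewrite e mulmxA eh eqf_mx ?ra ?rd ?oner_neq0 //.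
by rewrite rmorph1 expr1n mul1r.
Qed.

Lemma rp0_flip lam i j x y : eqf lam -> O x -> O y ->
  lam (rp i j 0 x) = lam (rp (~~ i) (~~ j) 0 y).
Proof.
move=> hl ox oy; rewrite (eqf_cong _ _ hl ox (cong0 ox O0)) (eqf_cong _ _ hl oy (cong0 oy O0)).
rewrite /rp expr0 -mx2_1 !mul1mx.
have e b b' : lam (bt b *m bt b') = lam (bt (b (+) b')) by rewrite bt_bt eqf_scale.
by rewrite !e; case: i; case: j.
Qed.

Lemma lam_exists (L : bool -> bool -> nat -> F -> k) :
  (forall i j n x y, O x -> cong n x y -> L i j n x = L i j n y) ->
  (forall i j x y, O x -> O y -> L i j 0%N x = L (~~ i) (~~ j) 0%N y) ->
  exists lam, [/\ eqf lam, forall g, \det g = 0 -> lam g = 0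
    & forall i j n x, O x -> lam (rp i j n x) = L i j n x].
Proof.
move=> hc h0.
pose P g (t : bool * bool * nat * F) :=
  O t.2 && inIZ v w0 (invmx (rp t.1.1.1 t.1.1.2 t.1.2 t.2) *m g).
have nfex g : \det g != 0 -> exists t, P g t.
  move=> /normal_form[i [j [n [x [h [ox hh ->]]]]]]; exists (i, j, n, x).
  by rewrite /P /= ox mulKmx ?rp_unit.
(* A normal form is chosen for each invertible matrix; [rp_uniq] makes the value independent of the
   choice. Singular matrices may occur in formal combinations and get the value 0, which is also
   what [br] gives them. *)
pose lam g := match @idP (\det g != 0) with
  | ReflectT H => let t := xchoose (nfex g H) in
     chiT v w0 res iota r (invmx (rp t.1.1.1 t.1.1.2 t.1.2 t.2) *m g) * L t.1.1.1 t.1.1.2 t.1.2 t.2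
  | ReflectF _ => 0 end.
have lamE i j n x h : O x -> inIZ v w0 h ->
    lam (rp i j n x *m h) = chiT v w0 res iota r h * L i j n x.
  move=> ox hh; have D : \det (rp i j n x *m h) != 0.
    by rewrite -unitfE -unitmxE unitmx_mul rp_unit inIZ_unit.
  rewrite /lam; case: {-}_ / idP => [H|/(_ D) //].
  have := xchooseP (nfex _ H); move: (xchoose (nfex _ H)) => [[[i' j'] n'] x'].
  rewrite /P /= => /andP[ox' hh'].
  set h' := invmx _ *m _ in hh' *.
  have e' : rp i j n x *m h = rp i' j' n' x' *m h' by rewrite mulKVmx ?rp_unit.
  have [h1 ih1 hh1] := inIZ_inv hh.
  have e1 : rp i j n x = rp i' j' n' x' *m (h' *m h1).
    by rewrite mulmxA -e' -mulmxA hh1 mulmx1.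
  have ih2 := proj1 (inIZM hh' ih1).
  have [c1 cs] := rp_uniq ox' ox ih2 e1.
  have -> : chiT v w0 res iota r h' = chiT v w0 res iota r h.
    have := proj2 (inIZM ih2 hh); rewrite c1 mul1r => <-.
    by rewrite -mulmxA (mulmx1C hh1) mulmx1.
  congr (_ * _); case: cs => [[-> -> -> c]|[-> -> -> ->]]; first exact: hc.
  exact: h0.
have lam0 g : \det g = 0 -> lam g = 0.
  move=> D; rewrite /lam; case: {-}_ / idP => [H|//].
  by exfalso; rewrite D eqxx in H.
exists lam; split=> // [g h hh|].
  have [/normal_form[i [j [n [x [h' [ox hh' ->]]]]]]|] := boolP (\det g != 0).
    have [ih c] := inIZM hh' hh.
    by rewrite -mulmxA !lamE // c; ring.
  rewrite negbK => /eqP D; have D' : \det (g *m h) = 0 by rewrite det_mulmx D mul0r.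
  by rewrite !lam0 // mulr0.
move=> i j n x ox; have [] := @inIZ_mx 0 1 0 0 1 O1 O0 O0 O1; rewrite ?Hres1 ?oner_neq0 //.
rewrite expr0z scale1r mulr0 -mx2_1 rmorph1 expr1n => i1 c1.
by rewrite -[rp i j n x]mulmx1 lamE // c1 mul1r.
Qed.

(** * The Hecke operators on normal forms *)

Hypothesis Hr : (0 < r < (p ^ f).-1)%N.

(** Exponent of the character values that [T_rp_opp] produces for the operator j; [sgn] is the
    accompanying sign. *)
Definition qq (j : bool) : nat := if j then r else ((p ^ f).-1 - r)%N.
Definition sgn (j : bool) : k := if j then (-1) ^+ r else 1.

(* [T_{-1,0}] for [j = false], [T_{1,2}] for [j = true]. *)
Definition tm (j : bool) (l : Fq) : 'M[F]_2 :=
  if j then betam w0 *m mx2 1 (teich l) 0 1 *m wm F else mx2 w0 (teich l) 0 1.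

Lemma qq_gt0 j : (0 < qq j)%N.
Proof. by rewrite /qq; case: j; lia. Qed.
Lemma qq_lt j : (qq j < (p ^ f).-1)%N.
Proof. by rewrite /qq; case: j; lia. Qed.
Lemma qq_compl j : (qq j + qq (~~ j) = (p ^ f).-1)%N.
Proof. by rewrite /qq; case: j => /=; lia. Qed.

Lemma tm_true l : tm true l = mx2 1 0 (w0 * teich l) w0.
Proof. by rewrite /tm /betam /wm !mx2M; congr mx2; ring. Qed.

Lemma teich1 : teich 1 = 1.
Proof.
have t0 : teich 1 != 0.
  by apply: (@res_neq0_neq0 _ (HtO 1)); rewrite Htres oner_neq0.
by apply: (mulfI t0); rewrite -HtM !mulr1.
Qed.

Lemma shift_inv_inv (K : fieldType) (a l : K) : (a + l^-1 - a)^-1 = l.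
Proof. by rewrite addrAC subrr add0r invrK. Qed.
Lemma inv_shift_inv (K : fieldType) (a l : K) : a + ((l - a)^-1)^-1 = l.
Proof. by rewrite invrK addrC subrK. Qed.
Lemma shift_inv_neq (K : fieldType) (a l : K) : (a + l^-1 != a) = (l != 0).
Proof. by rewrite -subr_eq0 addrAC subrr add0r invr_eq0. Qed.

(** The operators are written with representatives g. Replacing g by g h permutes the summands by an
    affine substitution [s] of the residue field, each up to an element of [IZ] with the same
    character value as h. *)
Lemma T_eqf lam j : eqf lam -> eqf (fun g => \sum_l lam (g *m tm j l)).
Proof.
move=> hl g h /inIZ_ex[z [a] [b] [c] [d] [[oa ob oc od] ra rd ->]].
rewrite (proj2 (inIZ_mx z oa ob oc od ra rd)) mulr_sumr.
case: j.
- pose s l := (res c + res d * l) / res a.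
  have si : injective s.
    by move=> l l' /(mulIf (invr_neq0 ra)) /addrI /(mulfI rd).
  rewrite [RHS](reindex_inj si); apply: eq_bigr => l _.
  have o1 : O (c + d * teich l - (a + b * (w0 * teich l)) * teich (s l)) by solveO.
  have r1 : res (c + d * teich l - (a + b * (w0 * teich l)) * teich (s l)) = 0.
    rewrite resB; [|by solveO|by solveO].
    rewrite HresD ?HresM ?Htres; try by solveO.
    rewrite HresD ?(mulrCA b) ?res_w0 ?addr0; try by solveO.
    by rewrite /s [res a * _]mulrC divfK // subrr.
  have [t ot et] := res_eq0P o1 r1.
  have -> : g *m (w0 ^ z *: mx2 a b (w0 * c) d) *m tm true l =
      g *m tm true (s l) *m (w0 ^ z *: mx2 (a + b * (w0 * teich l)) (b * w0) (w0 * t) (d - w0 * (teich (s l) * b))).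
    rewrite !tm_true -!mulmxA; congr (g *m _).
    rewrite -scalemxAl -scalemxAr; congr (_ *: _).
    rewrite !mx2M -et; congr mx2; try ring.
  rewrite eqf_mx ?resB ?res_w0 ?subr0 //; try by solveO.
  by rewrite HresD ?(mulrCA b) ?res_w0 ?addr0 //; solveO.
pose s l := (res a * l + res b) / res d.
have si : injective s.
  by move=> l l' /(mulIf (invr_neq0 rd)) /addIr /(mulfI ra).
rewrite [RHS](reindex_inj si); apply: eq_bigr => l _.
have o1 : O (a * teich l + b - (w0 * c * teich l + d) * teich (s l)) by solveO.
have r1 : res (a * teich l + b - (w0 * c * teich l + d) * teich (s l)) = 0.
  rewrite resB; [|by solveO|by solveO].
  rewrite HresD ?HresM ?Htres; try by solveO.
  rewrite HresD -?(mulrA w0) ?res_w0 ?add0r; try by solveO.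
  by rewrite /s [res d * _]mulrC divfK // subrr.
have [t ot et] := res_eq0P o1 r1.
have -> : g *m (w0 ^ z *: mx2 a b (w0 * c) d) *m tm false l =
    g *m tm false (s l) *m (w0 ^ z *: mx2 (a - w0 * (teich (s l) * c)) t (w0 * (w0 * c)) (w0 * (c * teich l) + d)).
  rewrite -!mulmxA; congr (g *m _).
  rewrite -scalemxAl -scalemxAr; congr (_ *: _).
  rewrite /tm !mx2M -et; congr mx2; try ring.
rewrite eqf_mx ?resB ?res_w0 ?subr0 //; try by solveO.
  by rewrite HresD ?res_w0 ?add0r //; solveO.
by rewrite HresD ?res_w0 ?add0r //; solveO.
Qed.

Lemma T_rp (lam : 'M[F]_2 -> k) j i n x : \sum_l lam (rp i j n x *m tm j l) =
  \sum_c lam (rp i j n.+1 (x + w0 ^+ n * teich c)).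
Proof.
apply: eq_bigr => l _; congr (lam _); rewrite /rp -!mulmxA; congr (_ *m _).
by case: j; rewrite ?tm_true /= ?mul1mx ?mulmx1 /betam !mx2M exprS; congr mx2; ring.
Qed.

Lemma T_rp_opp lam j i n x a : eqf lam -> O x ->
  \sum_l lam (rp i (~~ j) n.+1 (x + w0 ^+ n * teich a) *m tm j l) =
  lam (rp i (~~ j) n x) +
  \sum_c sgn j * (iota c - iota a) ^+ qq j * lam (rp i j n.+1 (x + w0 ^+ n * teich c)).
Proof.
move=> hl ox; have hli := eqfL (bt i) hl.
set y := x + w0 ^+ n * teich a; have oy : O y by rewrite /y; solveO.
have cy : cong n y x by apply: cong_sym; apply: congI; solveO.
rewrite (bigD1 0) //=; congr (_ + _).
  rewrite -(eqf_cong i (~~ j) hl oy cy) -[RHS](eqf_scale _ 1) // expr1z /rp -!mulmxA scalemxAr.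
  congr (lam (_ *m _)).
  by case: j; rewrite ?tm_true /= ?mul1mx ?mulmx1 /betam Ht0 !mx2M mx2Z exprS; congr mx2; ring.
rewrite [RHS](bigD1 a) //= subrr expr0n gtn_eqF ?qq_gt0 // mulr0 mul0r add0r.
pose h (l : Fq) : Fq := a + l^-1; pose h' (c : Fq) : Fq := (c - a)^-1.
have hK (l : Fq) : h' (h l) = l by exact: shift_inv_inv.
have h'K (c : Fq) : h (h' c) = c by exact: inv_shift_inv.
have ha (l : Fq) : (h l != a) = (l != 0) by exact: shift_inv_neq.
rewrite [RHS](reindex_onto h h') /=; last by move=> c _; exact: h'K.
apply: eq_big => [l|l l0].
  by rewrite (ha l) (hK l) eqxx andbT.
rewrite /h {h h' hK h'K ha}; set c := a + l^-1.
have il0 : iota l != 0 by rewrite fmorph_eq0.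
have tl : teich a * teich l - teich c * teich l + 1 = teich a * teich l - teich (a * l + 1) + 1.
  by rewrite -!HtM /c mulrDl mulVf.
have r1 : res (teich a * teich l - teich (a * l + 1) + 1) = 0.
  rewrite HresD ?resB ?HresM ?Htres ?Hres1; try by solveO.
  by ring.
have o1 : O (teich a * teich l - teich (a * l + 1) + 1) by solveO.
have [t ot et] := res_eq0P o1 r1.
rewrite -tl in et.
have rac : res (teich a - teich c) = - l^-1.
  by rewrite resB ?Htres /c; [ring | solveO | solveO].
have rn : - l^-1 != 0 by rewrite oppr_eq0 invr_eq0.
have oac : O (teich a - teich c) by solveO.
have key h : chiT v w0 res iota r h = sgn j * (iota c - iota a) ^+ qq j -> inIZ v w0 h ->
   rp i (~~ j) n.+1 y *m tm j l = rp i j n.+1 (x + w0 ^+ n * teich c) *m h ->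
   lam (rp i (~~ j) n.+1 y *m tm j l) =
   sgn j * (iota c - iota a) ^+ qq j * lam (rp i j n.+1 (x + w0 ^+ n * teich c)).
  by move=> <- hh ->; rewrite hl.
have eca : iota c - iota a = (iota l)^-1 by rewrite -rmorphB /c addrC addKr fmorphV.
case: j key => key.
- apply: (key (w0 ^ 0 *: mx2 (teich l) 1 (w0 * t) (teich a - teich c))).
  + rewrite (proj2 (inIZ_mx _ _ _ _ _ _ _)) ?Htres ?rac //; try by solveO.
    by rewrite /= eca rmorphN fmorphV -mulN1r exprMn.
  + by apply: (proj1 (inIZ_mx _ _ _ _ _ _ _)); rewrite ?Htres ?rac //; solveO.
  rewrite expr0z scale1r -et /rp tm_true -!mulmxA; congr (_ *m _).
  by rewrite /= /betam ?mul1mx !mx2M /y exprS; congr mx2; ring.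
apply: (key (w0 ^ 1 *: mx2 (teich a - teich c) t (w0 * 1) (teich l))).
- rewrite (proj2 (inIZ_mx _ _ _ _ _ _ _)) ?Htres ?rac //; try by solveO.
  rewrite /= eca mul1r exprVn; apply: (mulIf (expf_neq0 ((p ^ f).-1 - r) il0)).
  rewrite mulVf ?expf_neq0 // -exprD (_ : (r + ((p ^ f).-1 - r) = (p ^ f).-1)%N); last by move: Hr; clear; lia.
  exact: (iota_unit_exp iota HFq l0).
- by apply: (proj1 (inIZ_mx _ _ _ _ _ _ _)); rewrite ?Htres ?rac //; solveO.
rewrite expr1z /rp -!mulmxA; congr (_ *m _).
rewrite /= ?mul1mx /betam mx2Z -et !mx2M /y exprS; congr mx2; ring.
Qed.

(** * The kernel of the projection to [pi_r] *)

Local Notation W := (inW v w0 res teich iota r).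
Local Notation BR := (br v w0 res iota r).
Local Notation EV := (ev v w0 res iota r).

Definition pairing (lam : 'M[F]_2 -> k) (s : fsum F k) : k := \sum_(cg <- s) cg.1 * lam cg.2.
Definition TT (j : bool) (s : fsum F k) : fsum F k :=
  if j then T12 w0 teich s else T10 w0 teich s.
Definition fs (I : finType) (c : I -> k) (g : I -> 'M[F]_2) : fsum F k :=
  [seq (c i, g i) | i <- enum I].

Lemma EVE s X : EV s X = pairing (fun g => BR g X) s.
Proof. by []. Qed.

Lemma pair_cat lam s t : pairing lam (s ++ t) = pairing lam s + pairing lam t.
Proof. by rewrite /pairing big_cat. Qed.
Lemma pair_scale lam c s : pairing lam (scalef c s) = c * pairing lam s.
Proof. by rewrite /pairing /scalef big_map mulr_sumr; apply: eq_bigr => i _; rewrite mulrA. Qed.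
Lemma pair_act lam h s : pairing lam (actL h s) = pairing (fun g => lam (h *m g)) s.
Proof. by rewrite /pairing /actL big_map. Qed.
Lemma pair_fs lam (I : finType) (c : I -> k) g : pairing lam (fs c g) = \sum_i c i * lam (g i).
Proof. by rewrite /pairing /fs big_map big_enum. Qed.
Lemma eq_pair lam lam' s : lam =1 lam' -> pairing lam s = pairing lam' s.
Proof. by move=> e; apply: eq_bigr => i _; rewrite e. Qed.
Lemma pair_TT j lam s : pairing lam (TT j s) = pairing (fun g => \sum_l lam (g *m tm j l)) s.
Proof.
rewrite /pairing /TT; case: j; rewrite /T12 /T10 big_flatten big_map; apply: eq_bigr => cg _;
  rewrite big_map big_enum mulr_sumr //=.
by apply: eq_bigr => l _; rewrite !mulmxA.
Qed.

Lemma EV_act h s X : EV (actL h s) X = EV s (X *m h).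
Proof. by rewrite !EVE pair_act; apply: eq_pair => g; rewrite /br mulmxA. Qed.

Lemma inIZ1 : inIZ v w0 1%:M /\ chiT v w0 res iota r 1%:M = 1.
Proof.
have [] := @inIZ_mx 0 1 0 0 1 O1 O0 O0 O1; rewrite ?Hres1 ?oner_neq0 //.
by rewrite expr0z scale1r mulr0 -mx2_1 rmorph1 expr1n.
Qed.

(** Induction on the length: the terms in the coset of the first g merge into one, whose coefficient
    is the value of the function at the inverse of g, hence 0. So [pairing lam] depends only on the
    function [EV s]. *)
Lemma pair_eqf0 lam s : eqf lam -> (forall g, \det g = 0 -> lam g = 0) ->
  (forall X, EV s X = 0) -> pairing lam s = 0.
Proof.
move=> hl h0; move: {2}(size s).+1 (ltnSn (size s)) => n; elim: n s => // n IH s.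
case: s => [|[c g] s] sz he; first by rewrite /pairing big_nil.
have [D|D] := eqVneq (\det g) 0.
  rewrite /pairing big_cons /= h0 // mulr0 add0r; apply: IH => // X.
  have := he X; rewrite /ev big_cons /=; have -> : BR g X = 0; last by rewrite mulr0 add0r.
  rewrite /br chiTN //; apply/negP => /inIZ_unit.
  by rewrite unitmxE det_mulmx D mulr0 unitr0.
have gu : g \in unitmx by rewrite unitmxE unitfE.
pose P (cg : k * 'M[F]_2) := inIZ v w0 (invmx g *m cg.2).
pose C := \sum_(cg <- (c, g) :: s | P cg) cg.1 * chiT v w0 res iota r (invmx g *m cg.2).
have split lam' : eqf lam' ->
    pairing lam' ((c, g) :: s) = C * lam' g + pairing lam' [seq cg <- s | ~~ P cg].
  move=> hl'; rewrite /pairing (bigID P) /=; congr (_ + _).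
    rewrite /C mulr_suml; apply: eq_bigr => cg hP.
    by rewrite -mulrA -hl' // mulKVmx.
  by rewrite big_cons /P /= mulVmx // (proj1 inIZ1) /= big_filter.
have C0 : C = 0.
  have := he (invmx g); rewrite EVE (split _ (@eqf_br _)) /br mulVmx // (proj2 inIZ1) mulr1.
  rewrite [pairing _ _]big1_seq ?addr0 // => cg /andP[_]; rewrite mem_filter => /andP[nP _].
  by rewrite chiTN ?mulr0.
rewrite split // C0 mul0r add0r; apply: IH => [|X].
  by rewrite size_filter (leq_ltn_trans (count_size _ _)).
by have := he X; rewrite !EVE (split _ (@eqf_br _)) C0 mul0r add0r.
Qed.

Lemma inW_ext phi psi : phi =1 psi -> W phi -> W psi.
Proof. by move=> e [s1 [s2 [h1 [h2 h3]]]]; exists s1, s2; do 2!split=> //; move=> x; rewrite -e. Qed.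

Lemma TT_scale j c s X : EV (TT j (scalef c s)) X = c * EV (TT j s) X.
Proof. by rewrite !EVE !pair_TT pair_scale. Qed.
Lemma TT_cat j s t X : EV (TT j (s ++ t)) X = EV (TT j s) X + EV (TT j t) X.
Proof. by rewrite !EVE !pair_TT pair_cat. Qed.
Lemma TT_act j h s X : EV (TT j (actL h s)) X = EV (TT j s) (X *m h).
Proof.
rewrite !EVE !pair_TT pair_act; apply: eq_pair => g; apply: eq_bigr => l _.
by rewrite /br !mulmxA.
Qed.

Lemma inWD phi psi : W phi -> W psi -> W (fun X => phi X + psi X).
Proof.
move=> [s1 [s2 [h1 [h2 h3]]]] [t1 [t2 [g1 [g2 g3]]]]; exists (s1 ++ t1), (s2 ++ t2); split; [|split].
- by move=> X; rewrite (TT_cat false) /TT h1 g1 addr0.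
- by move=> X; rewrite (TT_cat true) /TT h2 g2 addr0.
by move=> X; rewrite h3 g3 !EVE !pair_cat addrACA.
Qed.

Lemma inWZ c phi : W phi -> W (fun X => c * phi X).
Proof.
move=> [s1 [s2 [h1 [h2 h3]]]]; exists (scalef c s1), (scalef c s2); split; [|split].
- by move=> X; rewrite (TT_scale false) /TT h1 mulr0.
- by move=> X; rewrite (TT_scale true) /TT h2 mulr0.
by move=> X; rewrite h3 !EVE !pair_scale mulrDr.
Qed.

Lemma inW_ker j s : (forall X, EV (TT j s) X = 0) -> W (EV s).
Proof.
move=> h; have z X : EV [::] X = 0 by rewrite /ev big_nil.
by case: j h => h; [exists [::], s | exists s, [::]]; do 2!split=> //; move=> X;
  rewrite z ?addr0 ?add0r.
Qed.

Lemma inW0 : W (fun=> 0).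
Proof. by apply: (@inW_ext (EV [::])); [move=> X; rewrite /ev big_nil | apply: (@inW_ker true) => X; rewrite /ev big_nil]. Qed.

Lemma inW_sum (I : finType) (phi : I -> 'M[F]_2 -> k) :
  (forall i, W (phi i)) -> W (fun X => \sum_i phi i X).
Proof.
move=> h; elim: (index_enum I) => [|i s IH].
  by apply: inW_ext inW0 => X; rewrite big_nil.
by apply: inW_ext (inWD (h i) IH) => X; rewrite big_cons.
Qed.

Lemma inW_act h phi : W phi -> W (fun X => phi (X *m h)).
Proof.
move=> [s1 [s2 [h1 [h2 h3]]]]; exists (actL h s1), (actL h s2); split; [|split].
- by move=> X; rewrite (TT_act false) /TT h1.
- by move=> X; rewrite (TT_act true) /TT h2.
by move=> X; rewrite h3 !EV_act.
Qed.

(** Leading coefficient, in the variable a, of [sgn j * (c - a)^(qq j)]. *)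
Definition kap j : k := sgn j * (-1) ^+ qq j.

Lemma sgn_neq0 j : sgn j != 0.
Proof. by rewrite /sgn; case: j; rewrite ?signr_eq0 ?oner_neq0. Qed.
Lemma kap_neq0 j : kap j != 0.
Proof. by rewrite mulf_neq0 ?sgn_neq0 // signr_eq0. Qed.

Local Notation moment := (power_moment iota).

Definition null_moments (Q : nat) (phi : Fq -> k) : Prop :=
  forall m, (m < Q)%N -> bsub p Q m -> moment phi m = 0.

(** Binomial expansion: a lower term has either a binomial coefficient that is 0 in [k] or a moment
    that is 0 by assumption. *)
Lemma moment_reflect Q phi c : null_moments Q phi ->
  \sum_a phi a * (c - iota a) ^+ Q = (-1) ^+ Q * moment phi Q.
Proof.
move=> h; transitivity (\sum_a \sum_(i < Q.+1) phi a * iota a ^+ i * ((-1) ^+ i * 'C(Q, i)%:R * c ^+ (Q - i))).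
  apply: eq_bigr => a _; rewrite exprDn mulr_sumr.
  apply: eq_bigr => i _; rewrite (exprNn (iota a)) -mulr_natr.
  by move: ((-1) ^+ i) => z; ring.
rewrite exchange_big big_ord_recr /= big1 => [|i _]; last first.
  rewrite -mulr_suml -/(moment phi i).
  have [hb|nb] := boolP (bsub p Q i); first by rewrite h ?mul0r.
  have /eqP -> : 'C(Q, i)%:R == 0 :> k by rewrite (natr_bin_eq0 Hpk).
  by rewrite mulr0 mul0r mulr0.
by rewrite add0r -mulr_suml binn subnn !mulr1 mulrC.
Qed.

Lemma bsub0 n : bsub p n 0.
Proof. by rewrite /bsub bin0 Euclid_dvd1. Qed.

(** The combination lies in the kernel of the operator j. The part at level n of its image has
    coefficient m_0 = 0; at level n+1 the coefficient of the edge c is a sum of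
    [phi a * (c - a)^(qq j)], independent of c by [moment_reflect], and the last edge compensates
    it. *)
Lemma inW_moment i j n x (phi : Fq -> k) : O x -> null_moments (qq j) phi ->
  W (fun X => \sum_a phi a * BR (rp i (~~ j) n.+1 (x + w0 ^+ n * teich a)) X
     - kap j * moment phi (qq j) * BR (rp i j n x) X).
Proof.
move=> ox h; have key lam : eqf lam ->
   \sum_a phi a * (\sum_l lam (rp i (~~ j) n.+1 (x + w0 ^+ n * teich a) *m tm j l))
   - kap j * moment phi (qq j) * (\sum_l lam (rp i j n x *m tm j l)) = 0.
  move=> hl; rewrite T_rp.
  under eq_bigr => a _ do rewrite T_rp_opp // mulrDr mulr_sumr.
  rewrite big_split /= -mulr_suml; have m0 : \sum_a phi a = 0.
    by rewrite -[RHS](h 0%N (qq_gt0 j) (bsub0 _)); apply: eq_bigr => a _; rewrite expr0 mulr1.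
  rewrite m0 mul0r add0r exchange_big mulr_sumr -sumrB big1 //= => c _.
  under eq_bigr => a _ do rewrite mulrA mulrCA.
  rewrite -mulr_suml -mulr_sumr moment_reflect //.
  by rewrite /kap; move: ((-1) ^+ qq j) => z; ring.
pose s := fs phi (fun a => rp i (~~ j) n.+1 (x + w0 ^+ n * teich a))
  ++ [:: (- (kap j * moment phi (qq j)), rp i j n x)].
apply: (@inW_ext (EV s)).
  by move=> X; rewrite EVE pair_cat pair_fs /pairing big_seq1 mulNr.
apply: (@inW_ker j) => X; rewrite EVE pair_TT pair_cat pair_fs /pairing big_seq1 mulNr.
exact: key (@eqf_br X).
Qed.

(* A form which factors through both Hecke operators kills both kernels. *)
Lemma inW_pair lam s : eqf lam -> (forall g, \det g = 0 -> lam g = 0) ->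
  (forall j, exists2 lam', eqf lam' /\ (forall g, \det g = 0 -> lam' g = 0)
     & forall g, lam g = \sum_l lam' (g *m tm j l)) ->
  W (EV s) -> pairing lam s = 0.
Proof.
move=> hl h0 hT [s1 [s2 [h1 [h2 h3]]]].
have ker j t : (forall X, EV (TT j t) X = 0) -> pairing lam t = 0.
  have [lam' [hl' h0'] e] := hT j; move=> /(pair_eqf0 hl' h0').
  by rewrite pair_TT; apply: etrans; apply: eq_pair.
have : pairing lam (s ++ scalef (-1) (s1 ++ s2)) = 0.
  apply: pair_eqf0 => // X.
  by rewrite EVE pair_cat pair_scale pair_cat -!EVE h3 mulN1r subrr.
by rewrite pair_cat pair_scale pair_cat (ker false s1) // (ker true s2) // addr0 mulr0 addr0.
Qed.

Lemma T_determined lam lam' j : eqf lam -> eqf lam' ->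
  (forall g, \det g = 0 -> lam g = 0) -> (forall g, \det g = 0 -> lam' g = 0) ->
  (forall i j' n x, O x -> lam (rp i j' n x) = \sum_l lam' (rp i j' n x *m tm j l)) ->
  forall g, lam g = \sum_l lam' (g *m tm j l).
Proof.
move=> hl hl' h0 h0' e g; have [/eqP D|] := eqVneq (\det g) 0.
  by rewrite h0 ?(eqP D) // big1 // => l _; apply: h0'; rewrite det_mulmx (eqP D) mul0r.
move=> /normal_form[i [j' [n [x [h [ox hh ->]]]]]].
by rewrite hl // (T_eqf j hl') // e.
Qed.

Definition trunc n x := tsum w0 teich (digs n x) n.

Lemma truncO n x : O (trunc n x). Proof. exact: tsumO. Qed.
Lemma trunc_cong n x : O x -> cong n (trunc n x) x. Proof. exact: cong_digs. Qed.
Lemma trunc_step n x : O x -> cong n.+1 (trunc n x + w0 ^+ n * teich (dig n x)) x.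
Proof.
move=> ox; rewrite {3}[x](expansion n) [iter n shift x]shiftE mulrDr addrA.
by rewrite mulrA -exprSr; apply: congI; apply/shiftO/iter_shiftO.
Qed.

Lemma dig_trunc n x c : dig n (trunc n x + w0 ^+ n * teich c) = c.
Proof. by rewrite digD ?dig_tsum_top ?add0r //; apply: tsumO. Qed.

(* Prescribed at level [n0], zero below, and extended upwards as the relations
   in [pi_r] force. *)
Fixpoint Lf n0 (init : bool -> bool -> F -> k) i j n x : k :=
  if n == n0 then init i j x else
  if (n < n0)%N then 0 else
  if n is m.+1 then kap (~~ j) * iota (dig m x) ^+ qq (~~ j) * Lf n0 init i (~~ j) m x else 0.

Lemma LfE n0 init i j n x : Lf n0 init i j n x =
  if n == n0 then init i j x else
  if (n < n0)%N then 0 else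
  if n is m.+1 then kap (~~ j) * iota (dig m x) ^+ qq (~~ j) * Lf n0 init i (~~ j) m x else 0.
Proof. by case: n. Qed.

Lemma Lf_small n0 init i j n x : (n < n0)%N -> Lf n0 init i j n x = 0.
Proof. by move=> h; rewrite LfE h ltn_eqF. Qed.
Lemma Lf_init n0 init i j x : Lf n0 init i j n0 x = init i j x.
Proof. by rewrite LfE eqxx. Qed.
Lemma Lf_step n0 init i j n x : (n0 <= n)%N ->
  Lf n0 init i j n.+1 x = kap (~~ j) * iota (dig n x) ^+ qq (~~ j) * Lf n0 init i (~~ j) n x.
Proof. by move=> h; rewrite LfE gtn_eqF // ltnNge leqW. Qed.

Section Functional.
Variables (n0 : nat) (init : bool -> bool -> F -> k) (z : bool -> bool -> F -> Fq -> k).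
Hypotheses
  (init_cong : forall i j x y, O x -> cong n0 x y -> init i j x = init i j y)
  (init_flip : n0 = 0%N -> forall i j x y, O x -> O y -> init i j x = init (~~ i) (~~ j) y)
  (z_cong : forall m, n0 = m.+1 -> forall i j x y c, O x -> cong m x y -> z i j x c = z i j y c)
  (z_sum : forall i j x, O x -> \sum_c z i j x c = 0)
  (z_init : forall m, n0 = m.+1 -> forall i j x, O x ->
     init i (~~ j) x = \sum_c sgn j * (iota c - iota (dig m x)) ^+ qq j * z i j x c).

Lemma Lf_cong i j n x y : O x -> cong n x y -> Lf n0 init i j n x = Lf n0 init i j n y.
Proof.
elim: n j x y => [|n IH] j x y ox c.
  by rewrite !LfE; case: eqP => // e; apply: init_cong => //; rewrite -e.
have [lt|ge] := ltnP n n0; last first.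
  by rewrite !Lf_step // (dig_cong _ ox c) // (IH _ x y) //; apply: congS.
move: lt; rewrite leq_eqVlt => /orP[/eqP e|lt]; last by rewrite !Lf_small.
by rewrite e !Lf_init; apply: init_cong; rewrite // -e.
Qed.

(** Vanishing on the kernels is obtained through [inW_pair], by exhibiting for each j a preimage
    under the operator j. [z] is the part of the preimage at level [n0]: [z_sum] makes the form
    vanish just below, [z_init] reproduces [init] on the edges of the opposite type. *)
Lemma functional_ex : exists lam, [/\ eqf lam,
  (forall s, W (EV s) -> pairing lam s = 0) &
  forall i j n x, O x -> lam (rp i j n x) = Lf n0 init i j n x].
Proof.
have [|lam [hl h0 hL]] := lam_exists Lf_cong.
  by move=> i j x y ox oy; rewrite !LfE; case: eqP => // e; apply: init_flip.
exists lam; split=> // s; apply: inW_pair => // j.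
(* The preimage lives on edges of type j only. Above level [n0] the whole value sits on the child
   with last digit 0; any distribution with the right sum has the right image on type j, and this
   one also yields the factor [kap j * dig^(qq j)] on the opposite type. *)
pose L' (i j' : bool) n x : k := if j' == j then
    if n is m.+1 then
      if (n0 <= m)%N then (dig m x == 0)%:R * Lf n0 init i j m x else
      if m.+1 == n0 then z i j x (dig m x) else 0
    else 0 else 0.
have [||lam' [hl' h0' hL']] := @lam_exists L'.
- move=> i j' [|n] x y ox c; rewrite /L'; case: eqP => // _.
  rewrite (dig_cong _ ox c) // (@Lf_cong i j n x y) //; last exact: congS.
  case: ifP => // _; case: eqP => // e.
  by apply: (z_cong (esym e)) => //; apply: congS.
- by move=> i j' x y _ _; rewrite /L' !if_same.
exists lam'; first by split.
apply: T_determined => // i j' n x ox.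
have same i' n' y : O y -> lam (rp i' j n' y) = \sum_l lam' (rp i' j n' y *m tm j l).
  move=> oy; rewrite T_rp hL //.
  have oc c : O (y + w0 ^+ n' * teich c) by solveO.
  under eq_bigr => c _ do rewrite hL' // /L' eqxx digD // ?Htres.
  have [le|lt] := leqP n0 n'.
    rewrite (bigD1 (- dig n' y)) //= subrr eqxx mul1r big1 ?addr0 => [|c ne].
      by apply: Lf_cong => //; apply: congI.
    by rewrite addrC addr_eq0 (negbTE ne) mul0r.
  rewrite Lf_small //; case: eqP => [e|_]; last by rewrite big1.
  rewrite -[LHS](z_sum i' j oy) (reindex_inj (addrI (dig n' y))) /=.
  by apply: eq_bigr => c _; apply: (z_cong (esym e)) => //; apply: congI.
case: (eqVneq j' j) => [->|]; first exact: same.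
move=> ne; have -> : j' = ~~ j by case: (j') (j) ne => [] [].
case: n => [|n].
  (* At level 0 an edge of the opposite type is also an edge of type j in the other half. *)
  rewrite (rp0_flip _ _ hl ox ox) (rp0_flip _ _ (T_eqf j hl') ox ox) negbK.
  exact: same.
have c1 := cong_sym (trunc_step n ox).
rewrite (eqf_cong _ _ (T_eqf j hl') ox c1) T_rp_opp //; last exact: truncO.
have oc c : O (trunc n x + w0 ^+ n * teich c) by have := truncO n x => ?; solveO.
rewrite hL // hL'; last exact: truncO.
rewrite {1}/L' (_ : (~~ j == j) = false) ?add0r; last by case: (j).
under eq_bigr => c _ do rewrite hL' // /L' eqxx dig_trunc.
have [le|lt] := leqP n0 n.
  rewrite Lf_step // negbK (bigD1 0) //= eqxx mul1r rmorph0 sub0r.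
  rewrite [X in _ + X]big1 ?addr0 => [|c /negbTE ->]; last by rewrite mul0r mulr0.
  rewrite exprNn /kap mulrA; congr (_ * _).
  apply: Lf_cong => //; apply: cong_trans (congI _ _ _); last exact: HtO.
  by apply: cong_sym; apply: trunc_cong.
case: eqP => [e|ne']; last first.
  rewrite Lf_small; last by rewrite ltn_neqAle lt andbT; apply/eqP.
  by rewrite big1 // => c _; rewrite mulr0.
rewrite e Lf_init (z_init (esym e)) //; apply: eq_bigr => c _; congr (_ * _).
apply: (z_cong (esym e)) => //; apply: cong_trans (congI _ _ _); last exact: HtO.
by apply: cong_sym; apply: trunc_cong.
Qed.

End Functional.

(** * Coordinate functionals on [pi_r] *)

Lemma coord0_ex b : exists lam, [/\ eqf lam,
  forall s, W (EV s) -> pairing lam s = 0,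
  forall i j x, O x -> lam (rp i j 0 x) = (i (+) j == b)%:R &
  forall i j n x, O x ->
    lam (rp i (~~ j) n.+1 x) = kap j * iota (dig n x) ^+ qq j * lam (rp i j n x)].
Proof.
(* Only [i (+) j] matters at level 0: b = false reads the coefficient of [[Id,1]], b = true that of
   [[beta,1]]. *)
pose init (i j : bool) (x : F) : k := (i (+) j == b)%:R.
have [//|_ i j x y _ _|//|i j x _|//|lam [hl hW hL]] := @functional_ex 0 init (fun _ _ _ _ => 0).
- by rewrite /init; case: i; case: j.
- by rewrite big1.
exists lam; split=> // [i j x ox|i j n x ox].
  by rewrite hL // Lf_init.
by rewrite !hL // Lf_step // negbK.
Qed.

(** Orthogonality of powers: the exponent [q-1-(Q-kk)] is chosen so that the term i = kk of the
    expansion is the only one of total exponent q-1. *)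
Lemma sum_pow_coord Q kk b : (kk < Q)%N -> (Q < (p ^ f).-1)%N ->
  \sum_c (iota c - b) ^+ Q * iota c ^+ ((p ^ f).-1 - (Q - kk)) =
  - ('C(Q, kk)%:R * (- b) ^+ kk) :> k.
Proof.
move=> lt ltq; transitivity (\sum_(i < Q.+1) 'C(Q, i)%:R * (- b) ^+ i *
    psum iota (Q - i + ((p ^ f).-1 - (Q - kk)))).
  under eq_bigr => c _ do rewrite exprDn mulr_suml.
  rewrite exchange_big; apply: eq_bigr => i _; rewrite mulr_sumr.
  by apply: eq_bigr => c _; rewrite exprD -mulr_natr; ring.
have kQ : (kk < Q.+1)%N by rewrite ltnS ltnW.
rewrite (bigD1 (Ordinal kQ)) //= big1 ?addr0 => [|i ne].
  rewrite (psum_eq iota Hp Hf HFq Hpk); last by move: lt ltq; clear; lia.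
  rewrite (_ : (Q - kk + _)%N = (p ^ f).-1) ?eqxx ?mulrN1 //.
  by move: lt ltq; clear; lia.
have iQ := ltn_ord i; rewrite (psum_eq iota Hp Hf HFq Hpk); last by move: iQ lt ltq; clear; lia.
rewrite ifF ?mulr0 //; apply/negbTE; apply: contra ne => /eqP e.
by apply/eqP/val_inj; move: e iQ lt ltq => /=; clear; lia.
Qed.

(** The form that reads one moment at one vertex. Domination of kk is what allows it to descend to
    [pi_r]; its vanishing up to level m lets it see the top of a vector only. *)
Lemma coord_ex i0 j0 m y kk : O y -> (kk < qq (~~ j0))%N -> bsub p (qq (~~ j0)) kk ->
  exists lam, [/\ eqf lam, forall s, W (EV s) -> pairing lam s = 0,
  forall i j n x, O x -> (n <= m)%N -> lam (rp i j n x) = 0,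
  forall i j x, O x -> lam (rp i j m.+1 x) =
    [&& i == i0, j == j0 & cong m y x]%:R * iota (dig m x) ^+ kk &
  forall i j n x, O x -> (m < n)%N ->
    lam (rp i (~~ j) n.+1 x) = kap j * iota (dig n x) ^+ qq j * lam (rp i j n x)].
Proof.
move=> oy hk hb; pose B i j x : k := [&& i == i0, j == j0 & cong m y x]%:R.
pose init i j x : k := B i j x * iota (dig m x) ^+ kk.
(* Inverse of the factor from [sum_pow_coord], invertible because kk is dominated by the
   exponent. *)
pose C j : k := - (sgn j * ('C(qq j, kk)%:R * (-1) ^+ kk))^-1.
pose z i j x (c : Fq) : k := B i (~~ j) x * (C j * iota c ^+ ((p ^ f).-1 - (qq j - kk))).
have Bc i j x x' : cong m x x' -> B i j x = B i j x'.
  move=> c; congr (_%:R); congr nat_of_bool; congr [&& _, _ & _].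
  apply/idP/idP => h; first exact: cong_trans c.
  by apply: cong_trans h (cong_sym c).
have [|//|m' [<-]|i j x ox|m' [<-] i j x ox|lam [hl hW hL]] := @functional_ex m.+1 init z.
- by move=> i j x x' ox c; rewrite /init (dig_cong _ ox c) // (Bc _ _ _ _ (congS c)).
- by move=> i j x x' c ox cx; rewrite /z (Bc _ _ _ _ cx).
- rewrite /z -mulr_sumr; case: (boolP (~~ j == j0)) => [/eqP e|ne]; last first.
    by rewrite /B (negbTE ne) andbF mul0r.
  rewrite -mulr_sumr -/(psum iota _) (psum_eq iota Hp Hf HFq Hpk).
    rewrite ifF ?mulr0 //; apply/negbTE; rewrite -e negbK in hk.
    by have := qq_lt j; move: hk; clear; lia.
  by have := qq_lt j; have := qq_gt0 j; clear; lia.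
- rewrite /z /init; case: (boolP (~~ j == j0)) => [/eqP e|ne]; last first.
    by rewrite /B (negbTE ne) andbF mul0r big1 // => c _; rewrite mul0r mulr0.
  rewrite -e negbK in hk hb.
  transitivity (B i (~~ j) x * (sgn j * C j) *
     \sum_c (iota c - iota (dig m x)) ^+ qq j * iota c ^+ ((p ^ f).-1 - (qq j - kk))).
    rewrite sum_pow_coord //; last exact: qq_lt.
    rewrite -mulrA; congr (_ * _).
    have b0 : 'C(qq j, kk)%:R != 0 :> k by rewrite (natr_bin_eq0 Hpk) negbK.
    have s0 := sgn_neq0 j; rewrite exprNn /C.
    have : (-1) ^+ kk != 0 :> k by rewrite signr_eq0.
    by move: ((-1) ^+ kk) => u u0; field; rewrite s0 b0 u0.
  by rewrite mulr_sumr; apply: eq_bigr => c _; ring.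
exists lam; split=> // [i j n x ox le|i j x ox|i j n x ox lt].
- by rewrite hL // Lf_small.
- by rewrite hL // Lf_init.
by rewrite !hL // Lf_step // negbK.
Qed.

(** * The action of the pro-p Iwahori subgroup *)

Definition mob a b c d x : F := (a * x + b) / (w0 * c * x + d).

Lemma mob_den c d x : O c -> O d -> res d = 1 -> O x ->
  O (w0 * c * x + d) /\ res (w0 * c * x + d) = 1.
Proof.
move=> oc od rd ox; split; first by solveO.
by rewrite -mulrA HresD ?res_w0 ?add0r //; solveO.
Qed.

Lemma mobO a b c d x : O a -> O b -> O c -> O d -> res d = 1 -> O x -> O (mob a b c d x).
Proof.
move=> oa ob oc od rd ox; have [o1 r1] := mob_den oc od rd ox.
by apply: OM; [solveO | apply: OV; rewrite ?r1 ?oner_neq0].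
Qed.

Lemma I1_ex h : inI1 v res h -> exists a b c d,
  [/\ [/\ O a, O b, O c & O d], res a = 1, res d = 1 & h = mx2 a b (w0 * c) d].
Proof.
case/and3P => /and5P[h1 h2 h3 h4 _] /eqP r1 /eqP r2.
exists (h i0 i0), (h i0 i1), (w0^-1 * h i1 i0), (h i1 i1); split=> //.
  by split=> //; rewrite -PO_w0 mulVKf.
by rewrite mulVKf // -mx2_eta.
Qed.

(** The matrix carries the normal form of x to that of its Moebius image, with a transition matrix
    of diagonal residues 1; hence no character value appears. *)
Lemma act_false lam a b c d j n x : eqf lam -> O a -> O b -> O c -> O d ->
  res a = 1 -> res d = 1 -> O x ->
  lam (mx2 a b (w0 * c) d *m rp false j n x) = lam (rp false j n (mob a b c d x)).
Proof.
move=> hl oa ob oc od ra rd ox; have [o1 r1] := mob_den oc od rd ox.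
have d0 : w0 * c * x + d != 0 by apply: res_neq0_neq0; rewrite ?r1 ?oner_neq0.
set y := mob a b c d x; have oy : O y by exact: mobO.
have e : mx2 a b (w0 * c) d *m mx2 (w0 ^+ n) x 0 1 =
   mx2 (w0 ^+ n) y 0 1 *m mx2 (a - w0 * (c * y)) 0 (w0 * (w0 ^+ n * c)) (w0 * c * x + d).
  by rewrite !mx2M; congr mx2; try ring; rewrite /y /mob; field.
have o2 : O (a - w0 * (c * y)) by solveO.
have r2 : res (a - w0 * (c * y)) = 1 by rewrite resB ?res_w0 ?subr0 //; solveO.
have o3 : O (w0 ^+ n * c) by solveO.
rewrite /rp !mul1mx !mulmxA e -mulmxA.
case: j; rewrite /= ?mulmx1.
  have -> : mx2 (a - w0 * (c * y)) 0 (w0 * (w0 ^+ n * c)) (w0 * c * x + d) *m betam w0 =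
     betam w0 *m (w0 ^ 0 *: mx2 (w0 * c * x + d) (w0 ^+ n * c) (w0 * 0) (a - w0 * (c * y))).
    by rewrite expr0z scale1r /betam !mx2M; congr mx2; ring.
  rewrite mulmxA eqf_mx ?r1 ?r2 ?oner_neq0 ?rmorph1 ?expr1n ?mul1r //; exact: O0.
rewrite -[X in _ *m X]scale1r -(expr0z w0) eqf_mx ?r1 ?r2 ?oner_neq0 ?rmorph1 ?expr1n ?mul1r //.
exact: O0.
Qed.

Lemma act_true lam a b c d j n x : eqf lam -> O a -> O b -> O c -> O d ->
  res a = 1 -> res d = 1 -> O x ->
  lam (mx2 a b (w0 * c) d *m rp true j n x) = lam (rp true j n (mob d c b a x)).
Proof.
move=> hl oa ob oc od ra rd ox.
have e : mx2 a b (w0 * c) d *m betam w0 = betam w0 *m mx2 d c (w0 * b) a.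
  by rewrite /betam !mx2M; congr mx2; ring.
have rpE y : rp true j n y = betam w0 *m rp false j n y by rewrite /rp /= mul1mx.
rewrite !rpE mulmxA e -mulmxA.
exact: (act_false _ _ (eqfL (betam w0) hl)).
Qed.

Lemma act_I1 h i : inI1 v res h -> exists a b c d,
  [/\ [/\ O a, O b, O c & O d], res a = 1, res d = 1 &
   forall lam j n x, eqf lam -> O x ->
     lam (h *m rp i j n x) = lam (rp i j n (mob a b c d x))].
Proof.
case/I1_ex => a [b] [c] [d] [[oa ob oc od] ra rd ->].
case: i; [exists d, c, b, a | exists a, b, c, d]; split=> // lam j n x hl ox.
  exact: act_true.
exact: act_false.
Qed.

(** Acts as the translation by b on the half i, and as [x / (w0 b x + 1)] on the other half. *)
Definition hb (i : bool) b : 'M[F]_2 := if i then mx2 1 0 (w0 * b) 1 else mx2 1 b (w0 * 0) 1.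

Lemma hb_I1 i b : O b -> inI1 v res (hb i b).
Proof.
move=> ob; rewrite /hb; case: i; rewrite /inI1 /inI !mx2E PO_w0 det_mx2 !(mulr0, mul0r, subr0, mulr1) Hres1 eqxx.
  by rewrite O1 O0 ob -res_neq0 ?Hres1 ?oner_neq0 //; apply: O1.
by rewrite O1 O0 ob -res_neq0 ?Hres1 ?oner_neq0 //; apply: O1.
Qed.

Lemma hb_same i b lam j n x : eqf lam -> O b -> O x ->
  lam (hb i b *m rp i j n x) = lam (rp i j n (x + b)).
Proof.
have e : mob 1 b 0 1 x = x + b by rewrite /mob mulr0 mul0r add0r divr1 mul1r.
move=> hl ob ox; rewrite -e /hb.
by case: i; [rewrite act_true | rewrite act_false] => //; solveO.
Qed.

Lemma hb_opp i b lam j n x : eqf lam -> O b -> O x ->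
  lam (hb i b *m rp (~~ i) j n x) = lam (rp (~~ i) j n (mob 1 0 b 1 x)).
Proof.
by move=> hl ob ox; rewrite /hb; case: i; [rewrite act_false | rewrite act_true] => //; solveO.
Qed.

(** * The candidate basis vectors *)

Local Notation EL := (elem p f w0 teich iota r).
Local Notation TS := (tsum w0 teich).

(** Treats both families at once: in either case the exponent of the last digit is [qq j + p^l]. *)
Definition elix (i j : bool) l n : bidx := if j then BT l n i else BS l n i.

Lemma pair_s_el lam n m : pairing lam (s_el w0 teich iota n m) =
  \sum_(mu : n.-tuple Fq) iota (nth 0 mu n.-1) ^+ m * lam (mx2 (w0 ^+ n) (TS mu n) 0 1).
Proof. by rewrite /pairing /s_el 2!big_map; exact: big_enum. Qed.

Lemma pair_t_el lam n m : pairing lam (t_el w0 teich iota n m) =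
  \sum_(mu : n.-tuple Fq) iota (nth 0 mu n.-1) ^+ m * lam (mx2 (w0 ^+ n.-1) (TS mu n.-1) 0 1 *m
      mx2 1 (teich (nth 0 mu n.-1)) 0 1 *m wm F).
Proof. by rewrite /pairing /t_el 2!big_map; exact: big_enum. Qed.

Lemma pair_elix lam i j l n : eqf lam -> (0 < n)%N -> pairing lam (EL (elix i j l n)) =
  \sum_(mu : n.-tuple Fq) iota (nth 0 mu n.-1) ^+ (qq j + p ^ l) * lam (rp i j n (TS mu n)).
Proof.
move=> hl n0.
(* [t_el] ends in [wm] where the normal form ends in [betam]; the matrices differ by the scalar
   [w0], on which the character is trivial. *)
have key (mu : n.-tuple Fq) b : lam (bt b *m (mx2 (w0 ^+ n.-1) (TS mu n.-1) 0 1 *m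
      mx2 1 (teich (nth 0 mu n.-1)) 0 1 *m wm F)) = lam (rp b true n (TS mu n)).
  rewrite -[RHS](eqf_scale _ (-1)) //; congr (lam _).
  rewrite /rp scalemxAr; congr (_ *m _); rewrite /= /wm /betam !mx2M mx2Z.
  case: n n0 mu => // n _ mu /=; rewrite tsumS exprS.
  by congr mx2; rewrite -exprnN expr1; field.
case: i; case: j; rewrite ?pair_act ?pair_s_el ?pair_t_el //=.
- apply: eq_bigr => mu _; congr (_ * _).
  exact: (key mu true).
- apply: eq_bigr => mu _; congr (_ * _).
  by rewrite /rp /= mulmx1.
- apply: eq_bigr => mu _; congr (_ * _).
  by rewrite -(key mu false) /bt mul1mx.
apply: eq_bigr => mu _; congr (_ * _).
by rewrite /rp /= mulmx1 mul1mx.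
Qed.

Lemma pair_elId lam : eqf lam -> pairing lam (EL BId) = lam (rp false false 0 0).
Proof. by move=> hl; rewrite /pairing big_seq1 mul1r /rp /= !mul1mx mulmx1 expr0 -mx2_1. Qed.
Lemma pair_elBeta lam : eqf lam -> pairing lam (EL BBeta) = lam (rp true false 0 0).
Proof. by move=> hl; rewrite /pairing big_seq1 mul1r /rp /= mulmx1 expr0 -mx2_1 mulmx1. Qed.

(** * Addition of Teichmueller representatives *)

Hypotheses
  (HcharF : [pchar F] =i pred0)
  (Hram : v (p%:R) = Posz ram)
  (Hdig : forall j, (j < f)%N -> (0 < (r %/ p ^ j) %% p < p.-1)%N)
  (Hf1 : f = 1%N -> (2 < r < p - 3)%N).

Lemma frobD (K : comNzRingType) : p \in [pchar K] ->
  forall (x y : K) n, (x + y) ^+ (p ^ n) = x ^+ (p ^ n) + y ^+ (p ^ n).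
Proof.
move=> hK x y n; apply: exprDn_pchar; rewrite pnatX.
by rewrite (eq_pnat _ (pcharf_eq hK)) pnat_id.
Qed.

Lemma pchar_Fq : p \in [pchar Fq].
Proof. exact: card_finPcharP HFq Hp. Qed.

Lemma teichX a n : teich (a ^+ n) = teich a ^+ n.
Proof. by elim: n => [|n IH]; rewrite ?expr0 ?teich1 // !exprS HtM IH. Qed.

Lemma frob_inv (a : Fq) : (a ^+ (p ^ f.-1)) ^+ p = a.
Proof. by rewrite -exprM -expnSr prednK // -HFq expf_card. Qed.

Definition pi0 : F := p%:R / w0.

Lemma pi0E : p%:R = w0 * pi0.
Proof. by rewrite mulrCA divff // mulr1. Qed.

Lemma pi0O : O pi0.
Proof.
have [y oy e] := @res_eq0P p%:R (On p) (etrans (res_nat p) (pcharf0 pchar_Fq)).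
by rewrite /pi0 e mulrC mulKf.
Qed.

Lemma expD_mod S z n : O S -> O z -> exists2 t, O t &
  (S + w0 * z) ^+ n = S ^+ n + w0 * (n%:R * (S ^+ n.-1 * z)) + w0 ^+ 2 * t.
Proof.
move=> oS oz; elim: n => [|[|n] [t ot e]].
- by exists 0; [exact: O0 | rewrite !expr0; ring].
- by exists 0; [exact: O0 | rewrite /= !expr1 expr0; ring].
have on := On n.+1.
exists (n.+1%:R * (S ^+ n * z) * z + t * (S + w0 * z)); first by solveO.
rewrite exprSr e /= -(natr1 n.+1) !exprSr; ring.
Qed.

Definition carry (d a : Fq) : Fq := res ((teich d + teich a - teich (d + a)) / w0).

Lemma carryP d a : exists2 y, O y & res y = carry d a /\
  teich d + teich a = teich (d + a) + w0 * y.
Proof.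
have o1 : O (teich d + teich a - teich (d + a)) by solveO.
have r1 : res (teich d + teich a - teich (d + a)) = 0.
  by rewrite resB ?HresD ?Htres ?subrr //; solveO.
have [y oy e] := res_eq0P o1 r1; exists y => //; split.
  by rewrite /carry e mulrC mulKf.
by rewrite -e [RHS]addrC subrK.
Qed.

(* Modulo [w0] the carry is Witt's polynomial [(x^p + y^p - (x + y)^p) / p],
   evaluated at the [p]-th roots of the digits and scaled by [p / w0]. *)
Lemma carryE d a : carry d a = - res pi0 * \sum_(i < p.-1)
   ('C(p, i.+1) %/ p)%:R * (d ^+ (p ^ f.-1)) ^+ (p - i.+1) * (a ^+ (p ^ f.-1)) ^+ i.+1.
Proof.
set d1 := d ^+ _; set a1 := a ^+ _.
pose A := teich d1; pose B := teich a1.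
have oA : O A by exact: HtO. have oB : O B by exact: HtO.
have eA : teich d = A ^+ p by rewrite /A -teichX frob_inv.
have eB : teich a = B ^+ p by rewrite /B -teichX frob_inv.
have eC : teich (d + a) = teich (d1 + a1) ^+ p.
  rewrite -teichX; congr teich; have := frobD pchar_Fq d1 a1 1.
  by rewrite expn1 !frob_inv => ->.
have [y oy [_ ey]] := carryP d1 a1; rewrite -/A -/B in ey.
have ez : teich (d1 + a1) = A + B + w0 * (- y) by rewrite ey; ring.
have oAB : O (A + B) by solveO. have oy' := ON oy.
(* The linear term carries the factor p, a multiple of [w0], so the carry y of the p-th roots
   disappears modulo [w0^2]. *)
have [t ot et] := expD_mod p oAB oy'.
have opi := pi0O.
pose S := \sum_(i < p.-1) ('C(p, i.+1) %/ p)%:R * A ^+ (p - i.+1) * B ^+ i.+1.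
have eS : (A + B) ^+ p = A ^+ p + B ^+ p + w0 * pi0 * S.
  rewrite exprDn -(big_mkord xpredT (fun i => A ^+ (p - i) * B ^+ i *+ 'C(p, i))).
  rewrite big_nat_recr //= big_ltn ?prime_gt0 // big_add1 subn0 expr0 mulr1 bin0 mulr1n.
  rewrite binn subnn expr0 mul1r mulr1n addrAC; congr (_ + _).
  rewrite -pi0E big_mkord /S mulr_sumr; apply: eq_bigr => i _.
  have /divnK e : (p %| 'C(p, i.+1))%N.
    by apply: prime_dvd_bin => //; have := ltn_ord i; clear; lia.
  by rewrite -[in LHS]e -mulr_natl natrM; ring.
have oS : O S by apply: Osum => i _; solveO.
rewrite pi0E in et.
have e : teich d + teich a - teich (d + a) =
   w0 * (- (pi0 * S) - w0 * (pi0 * ((A + B) ^+ p.-1 * - y) + t)).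
  by rewrite eA eB eC ez et eS; ring.
rewrite /carry e mulrC mulKf //.
have oAB' := OX p.-1 oAB.
rewrite resB; [|by solveO|by solveO].
rewrite res_w0 ?subr0 ?resN; try by solveO.
rewrite (HresM opi oS) mulNr.
congr (- (_ * _)); rewrite /S res_sum; last by move=> i _; solveO.
apply: eq_bigr => i _; rewrite !HresM ?resX ?Htres ?res_nat //; solveO.
Qed.

Lemma pi0_eq0 : (res pi0 == 0) = (ram != 1%N).
Proof.
have p0 : p%:R != 0 :> F.
  by have := HcharF p; rewrite !inE Hp /= => ->.
have pi00 : pi0 != 0 by rewrite mulf_neq0 ?invr_eq0.
apply/negb_inj; rewrite res_neq0 ?pi0O // /unitO pi00 /= negbK /pi0.
by rewrite HvM ?invr_eq0 // vV // Hram Hvw0; clear; lia.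
Qed.

(** * Invariance of the candidate vectors *)

(** The digits of q-1-r are p-1 minus those of r, so the hypothesis on r is symmetric in the two
    types. *)
Lemma digit_bounds j l : (l < f)%N -> (0 < (qq j %/ p ^ l) %% p < p.-1)%N.
Proof.
move=> lf; have := Hdig lf; rewrite /qq; case: j => //.
rewrite digit_compl //; first by move: (_ %% p)%N => x; clear; lia.
by move: Hr; clear; lia.
Qed.

Lemma p_ge3 : (2 < p)%N.
Proof. by have := digit_bounds false Hf; move: (_ %% p)%N => x; clear; lia. Qed.

Lemma qq_ltq j : (qq j < p ^ f)%N.
Proof. by have := qq_lt j; clear; lia. Qed.

Lemma exp_le_qq j l : (l < f)%N -> (p ^ l <= qq j)%N.
Proof.
by move=> /(digit_bounds j)/andP[h _]; apply: (bsub_le (p := p)); rewrite bsub_exp.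
Qed.

Lemma exp_small l : (l < f)%N -> (p ^ l < (p ^ f).-1)%N.
Proof. by move=> lf; apply: leq_ltn_trans (exp_le_qq false lf) (qq_lt false). Qed.

Lemma bsub_qq j l : (l < f)%N -> bsub p (qq j) (qq j - p ^ l).
Proof. by move=> /(digit_bounds j)/andP[h _]; apply: bsub_sub_exp. Qed.

(* For [Q = qq j] this makes [Sum_a g(a) rp i (~~ j) n.+1 (x + w0^n [a])] vanish in [pi_r]. *)
Definition short (Q : nat) (g : Fq -> k) : Prop := forall m, bsub p Q m -> moment g m = 0.

Lemma short_ext Q g g' : g =1 g' -> short Q g -> short Q g'.
Proof. by move=> e h m hm; rewrite -[RHS](h m hm); apply: eq_bigr => a _; rewrite e. Qed.
Lemma shortD Q g g' : short Q g -> short Q g' -> short Q (fun a => g a + g' a).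
Proof.
move=> h h' m hm; transitivity (moment g m + moment g' m); last by rewrite h ?h' ?addr0.
by rewrite -big_split; apply: eq_bigr => a _; rewrite mulrDl.
Qed.
Lemma shortZ Q c g : short Q g -> short Q (fun a => c * g a).
Proof.
move=> h m hm; transitivity (c * moment g m); last by rewrite h ?mulr0.
by rewrite mulr_sumr; apply: eq_bigr => a _; rewrite mulrA.
Qed.
Lemma short0 Q : short Q (fun=> 0).
Proof. by move=> m _; rewrite /power_moment big1 // => a _; rewrite mul0r. Qed.
(** Domination is transitive, so translation mixes the visible moments only among themselves. *)
Lemma short_shift Q g b : short Q g -> short Q (fun a => g (a - b)).
Proof.
move=> h m hm; rewrite /power_moment (reindex_inj (addIr b)) /=.
under eq_bigr => a _ do rewrite addrK.
rewrite moment_shift big1 // => i _.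
have [hi|ni] := boolP (bsub p m i); first by rewrite h ?mul0r //; apply: bsub_trans hm hi.
have /eqP -> : 'C(m, i)%:R == 0 :> k by rewrite (natr_bin_eq0 Hpk).
by rewrite mulr0 mul0r.
Qed.

(** The power sum of exponent [i p^l + m] could be nonzero only at q-1. For f = 1 the bounds 2 < r <
    p-3 give [qq j + 2 < p - 1] for both types; for f > 1 [bsub_no_carry] excludes q-1 for every i <
    p. *)
Lemma short_mono j i l : (i < p)%N -> (l < f)%N ->
  (f = 1%N -> (i < 3)%N) -> short (qq j) (fun a => iota a ^+ (i * p ^ l)).
Proof.
move=> ip lf hi m hm; rewrite /power_moment.
under eq_bigr => a _ do rewrite -exprD.
rewrite -/(psum iota _).
have mQ := bsub_le hm; have Qq := qq_lt j.
have [f1|f1] := leqP f 1.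
  have ef : f = 1%N by move: f1 Hf; clear; lia.
  have [h3 [h1 h2]] : [/\ (i < 3)%N, (2 < r)%N & (r < p - 3)%N].
    by have /andP[] := Hf1 ef; split=> //; apply: hi.
  have l0 : l = 0%N by move: lf; rewrite ef; clear; lia.
  have hQ : (qq j + 2 < (p ^ f).-1)%N.
    by rewrite /qq ef expn1; case: (j); move: h1 h2; clear; lia.
  rewrite l0 expn0 muln1 (psum_eq iota Hp Hf HFq Hpk); last by move: hQ mQ h3; clear; lia.
  by rewrite ifF //; apply/negbTE; move: hQ mQ h3; clear; lia.
have ne : (i * p ^ l + m != (p ^ f).-1)%N.
  apply: (bsub_no_carry Hp f1 (qq_ltq j) _ hm ip lf) => t tf.
  by have /andP[] := digit_bounds j tf.
have tl : (i * p ^ l < (p ^ f).-1)%N.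
  have h1 : (i * p ^ l <= p.-1 * p ^ f.-1)%N.
    by apply: leq_mul; rewrite ?leq_exp2l ?prime_gt1 //; move: ip lf; clear; lia.
  have h2 : (p <= p ^ f.-1)%N by rewrite -{1}(expn1 p) leq_exp2l ?prime_gt1 //; move: f1; clear; lia.
  have h3 : (p ^ f = p * p ^ f.-1)%N by rewrite -expnS prednK.
  by move: p_ge3 h1 h2; rewrite h3; move: (p ^ f.-1)%N => P; clear; nia.
rewrite (psum_eq iota Hp Hf HFq Hpk) ?(negbTE ne) //.
by move: tl mQ Qq; clear; lia.
Qed.

(** The power [p^(f-1)] inverts Frobenius on the residue field, so l is lowered by 1, cyclically. *)
Lemma frob_exp l : (l < f)%N -> exists2 l', (l' < f)%N &
  forall a : Fq, iota (a ^+ (p ^ f.-1)) ^+ (p ^ l) = iota a ^+ (p ^ l').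
Proof.
case: l => [|l] lf.
  by exists f.-1; [rewrite prednK | move=> a; rewrite expn0 expr1 rmorphXn].
exists l; first exact: ltnW.
move=> a; rewrite -!rmorphXn expnS exprM -!exprM; congr (iota _).
by rewrite !exprM frob_inv.
Qed.

(** The power [p^l] is additive, so this condition is linear in h and can be checked on
    monomials. *)
Definition fshort j l (h : Fq -> Fq) : Prop := short (qq j) (fun a => iota (h a) ^+ (p ^ l)).

Lemma fshort_ext j l h h' : h =1 h' -> fshort j l h -> fshort j l h'.
Proof. by move=> e; apply: short_ext => a; rewrite e. Qed.
Lemma fshortD j l h h' : fshort j l h -> fshort j l h' -> fshort j l (fun a => h a + h' a).
Proof.
move=> s1 s2; apply: short_ext (shortD s1 s2) => a.
by rewrite rmorphD (frobD Hpk).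
Qed.
Lemma fshortZ j l c h : fshort j l h -> fshort j l (fun a => c * h a).
Proof.
by move=> s1; apply: short_ext (shortZ (iota c ^+ (p ^ l)) s1) => a; rewrite rmorphM exprMn.
Qed.
Lemma fshort_sum j l n (h : nat -> Fq -> Fq) : (forall i, (i < n)%N -> fshort j l (h i)) ->
  fshort j l (fun a => \sum_(i < n) h i a).
Proof.
elim: n => [|n IH] H.
  apply: short_ext (@short0 _) => a; rewrite big_ord0 rmorph0 expr0n.
  by rewrite gtn_eqF // expn_gt0 prime_gt0.
have s1 : fshort j l (fun a => \sum_(i < n) h i a) by apply: IH => i il; apply/H/ltnW.
apply: fshort_ext (fshortD s1 (H n (ltnSn n))) => a.
by rewrite big_ord_recr.
Qed.
Lemma fshort_mono j l i : (i < 3)%N -> (l < f)%N -> fshort j l (fun a => a ^+ i).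
Proof.
move=> i3 lf; have s1 := @short_mono j i l (leq_trans i3 p_ge3) lf (fun=> i3).
by apply: short_ext s1 => a; rewrite rmorphXn exprM.
Qed.

(** * Moebius transformations on digits, and invariance when F is not Q_p *)

Section AwayFromQp.
Hypothesis NotQp : ~~ ((ram == 1%N) && (f == 1%N)).

(** If F is ramified the carry is 0. Otherwise f > 1, and then [short_mono] admits all the exponents
    below p that occur in [carryE]. *)
Lemma fshort_carry j l d : (l < f)%N -> fshort j l (carry d).
Proof.
move=> lf; apply: (@fshort_ext j l (fun a => - res pi0 * \sum_(i < p.-1)
  (('C(p, i.+1) %/ p)%:R * (d ^+ (p ^ f.-1)) ^+ (p - i.+1)) * (a ^+ (p ^ f.-1)) ^+ i.+1)).
  by move=> a; rewrite carryE.
have [e|ne] := eqVneq (res pi0) 0.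
  apply: (@fshort_ext j l (fun a => 0 * a ^+ 0)); first by move=> a; rewrite e oppr0 !mul0r.
  by apply: fshortZ; apply: fshort_mono.
have f1 : f != 1%N.
  by move: NotQp ne; rewrite pi0_eq0 negbK => h /eqP e; rewrite e eqxx in h.
apply: fshortZ; apply: (@fshort_sum j l p.-1 (fun i a => (('C(p, i.+1) %/ p)%:R *
  (d ^+ (p ^ f.-1)) ^+ (p - i.+1)) * (a ^+ (p ^ f.-1)) ^+ i.+1)) => i ip.
apply: fshortZ; have [l' l'f e] := frob_exp lf.
have i1p : (i.+1 < p)%N by move: ip; clear; lia.
have s1 : short (qq j) (fun a => iota a ^+ (i.+1 * p ^ l')).
  by apply: short_mono => // e1; rewrite e1 in f1.
apply: short_ext s1 => a.
by rewrite [iota (_ ^+ i.+1)]rmorphXn exprAC e mulnC exprM.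
Qed.

Section Mobius.
Variables a b c d : F.
Hypotheses (oa : O a) (ob : O b) (oc : O c) (od : O d) (ra : res a = 1) (rd : res d = 1).
Local Notation sg := (mob a b c d).
Local Notation den x := (w0 * c * x + d).
Local Notation dt := (a * d - w0 * b * c).

Lemma dt_unit : O dt /\ res dt = 1.
Proof.
split; first by solveO.
rewrite resB; [|by solveO|by solveO].
by rewrite HresM // ra rd -(mulrA w0) res_w0 ?subr0 ?mulr1 //; solveO.
Qed.

Lemma den_neq0 x : O x -> den x != 0.
Proof.
by move=> ox; have [o1 r1] := mob_den oc od rd ox; apply: res_neq0_neq0; rewrite ?r1 ?oner_neq0.
Qed.

Lemma denV x : O x -> O (den x)^-1 /\ res (den x)^-1 = 1.
Proof.
move=> ox; have [o1 r1] := mob_den oc od rd ox.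
by split; [apply: OV | rewrite resV]; rewrite ?r1 ?invr1 ?oner_neq0.
Qed.

Lemma mob_sub x y : O x -> O y -> sg y - sg x = (y - x) * (dt * (den x)^-1 * (den y)^-1).
Proof.
move=> ox oy; have dx := den_neq0 ox; have dy := den_neq0 oy.
by rewrite /mob; field; rewrite ?dx ?dy.
Qed.

(** The difference quotient of the transformation is 1 modulo [w0], since the diagonal residues are
    1. *)
Lemma mob_step m x z : O x -> O z -> cong m.+1 (sg (x + w0 ^+ m * z)) (sg x + w0 ^+ m * z).
Proof.
move=> ox oz; have oy : O (x + w0 ^+ m * z) by solveO.
have [o1 r1] := dt_unit; have [o2 r2] := denV ox; have [o3 r3] := denV oy.
set U := dt * (den x)^-1 * (den (x + w0 ^+ m * z))^-1.
have oU : O U by rewrite /U; apply: OM => //; apply: OM.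
have rU : res (U - 1) = 0.
  by rewrite resB ?Hres1 /U ?HresM ?r1 ?r2 ?r3 ?mulr1 ?subrr //; solveO.
have oU1 : O (U - 1) by solveO.
have [t ot et] := res_eq0P oU1 rU.
have e := mob_sub ox oy; rewrite -/U in e.
have -> : sg (x + w0 ^+ m * z) = sg x + w0 ^+ m * z + w0 ^+ m.+1 * (t * z).
  have eU : U = 1 + w0 * t by rewrite -et addrC subrK.
  rewrite -[LHS](subrK (sg x)) e eU exprS; ring.
by apply: cong_sym; apply: congI; solveO.
Qed.

Lemma mob_inj m x y : O x -> O y -> cong m (sg x) (sg y) -> cong m x y.
Proof.
move=> ox oy; have [o1 r1] := dt_unit; have [o2 _] := mob_den oc od rd ox.
have [o3 _] := mob_den oc od rd oy.
have d1 : dt != 0 by apply: res_neq0_neq0; rewrite ?r1 ?oner_neq0.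
have oV : O dt^-1 by apply: OV; rewrite ?r1 ?oner_neq0.
rewrite /cong mob_sub // => h.
have -> : (y - x) / w0 ^+ m =
    (y - x) * (dt * (den x)^-1 * (den y)^-1) / w0 ^+ m * (dt^-1 * den x * den y).
  have dx := den_neq0 ox; have dy := den_neq0 oy; have wm0 := expf_neq0 m Hw0.
  by field; rewrite ?d1 ?dx ?dy ?wm0.
by apply: OM => //; apply: OM => //; apply: OM.
Qed.

(** With [t = w0^m [u]], the difference quotient is [1 + w0 (A - c t V)], which contributes a linear
    term and, through t, a quadratic one (nonzero only for m = 0). The carry comes from adding u to
    digit m of the image. *)
Lemma mob_digit m x : O x -> exists C0 C1 C2 : Fq, forall u : Fq,
  dig m.+1 (sg (x + w0 ^+ m * teich u)) =
  C0 + C1 * u + C2 * u ^+ 2 + carry (dig m (sg x)) u.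
Proof.
move=> ox; have [o1 r1] := dt_unit; have [o2 r2] := denV ox.
have oU : O (dt * (den x)^-1 * (den x)^-1 - 1) by solveO.
have rU : res (dt * (den x)^-1 * (den x)^-1 - 1) = 0.
  by rewrite resB ?Hres1 ?HresM ?r1 ?r2 ?mulr1 ?subrr //; solveO.
have [A oA eA] := res_eq0P oU rU.
set y := sg x; have oy : O y by apply: mobO.
set y1 := iter m.+1 shift y; have oy1 : O y1 by apply: iter_shiftO.
have ey : y = trunc m y + w0 ^+ m * (teich (dig m y) + w0 * y1).
  by rewrite {1}[y](expansion m) [iter m shift y]shiftE.
clearbody y1.
exists (res y1), (res A), (- res c * res (w0 ^+ m)) => u.
set t := w0 ^+ m * teich u; have ot : O t by rewrite /t; solveO.
have et : t = w0 ^+ m * teich u by []; clearbody t.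
have oxt : O (x + t) by solveO.
have [o3 r3] := denV oxt.
pose V := dt * (den x)^-1 * (den x)^-1 * (den (x + t))^-1.
have oV : O V by rewrite /V; do 3!apply: OM => //.
have rV : res V = 1 by rewrite /V !HresM ?r1 ?r2 ?r3 ?mulr1 //; solveO.
have eV : V = dt * (den x)^-1 * (den x)^-1 * (den (x + t))^-1 by [].
clearbody V.
have es : sg (x + t) = y + t * (1 + w0 * (A - c * t * V)).
  have eU : dt * (den x)^-1 * (den x)^-1 = 1 + w0 * A by rewrite -eA [RHS]addrC subrK.
  have -> : t * (1 + w0 * (A - c * t * V)) = t * (dt * (den x)^-1 * (den x)^-1) - t * w0 * c * t * V.
    by rewrite eU; ring.
  rewrite -[LHS](subrK y) mob_sub // addrC; congr (_ + _); rewrite eV.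
  have dx := den_neq0 ox; have dy := den_neq0 oxt.
  by field; rewrite ?dx ?dy.
have [cy ocy [rcy ecy]] := carryP (dig m y) u.
have -> : sg (x + t) = trunc m y + w0 ^+ m * teich (dig m y + u) +
    w0 ^+ m.+1 * (cy + y1 + teich u * (A - c * t * V)).
  rewrite es {1}ey exprS et.
  have -> : teich (dig m y + u) = teich (dig m y) + teich u - w0 * cy by rewrite ecy addrK.
  ring.
have oT := truncO m y.
rewrite digD; [|by solveO|by solveO].
have -> : dig m.+1 (trunc m y + w0 ^+ m * teich (dig m y + u)) = 0.
  by rewrite /trunc -tsum_rcons dig_tsum_top.
rewrite add0r !HresD ?HresM ?resB ?Htres ?rcy; try by solveO.
rewrite !HresM ?Htres ?rV; try by solveO.
by rewrite et HresM ?Htres; [ring | solveO | solveO].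
Qed.

End Mobius.

(** As [qq j + qq (~~ j) = q - 1], the candidate has a single nonzero moment in the visible range:
    this is the origin of its exponent. *)
Lemma moment_power j l m : (l < f)%N -> (m <= qq (~~ j))%N ->
  moment (fun a => iota a ^+ (qq j + p ^ l)) m =
  if m == (qq (~~ j) - p ^ l)%N then -1 else 0.
Proof.
move=> lf mQ; rewrite /power_moment; under eq_bigr => a _ do rewrite -exprD.
have h1 := exp_small lf; have h2 := exp_le_qq (~~ j) lf; have h3 := qq_compl j.
rewrite -/(psum iota _) (psum_eq iota Hp Hf HFq Hpk); last by move: mQ h1 h3; clear; lia.
congr (if _ then _ else _); apply/eqP/eqP; move: mQ h1 h2 h3; clear; lia.
Qed.

(** By [moment_shift] only the moment of order [Q - p^l] feeds the others, with the factor
    ['C(m, Q - p^l)]. That factor is 0 in [k] for dominated m strictly below Q, by [bsub_top], so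
    the change is felt at order Q only. *)
Lemma shifted_power j l (u : Fq) : (l < f)%N ->
  let phi a := (iota a - iota u) ^+ (qq j + p ^ l) - iota a ^+ (qq j + p ^ l) in
  null_moments (qq (~~ j)) phi /\
  moment phi (qq (~~ j)) = - 'C(qq (~~ j), qq (~~ j) - p ^ l)%:R * iota u ^+ (p ^ l).
Proof.
move=> lf phi; set Q := qq (~~ j); have lQ : (p ^ l <= Q)%N by apply: exp_le_qq.
have P0 : (0 < p ^ l)%N by rewrite expn_gt0 prime_gt0.
pose A m : k := if (Q - p ^ l <= m)%N then - 'C(m, Q - p ^ l)%:R * iota u ^+ (m - (Q - p ^ l)) else 0.
pose B m : k := if m == (Q - p ^ l)%N then -1 else 0.
have e m : (m <= Q)%N -> moment phi m = A m - B m.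
  move=> mQ; rewrite /B -(moment_power lf mQ) /A.
  rewrite {1}/power_moment; under eq_bigr => a _ do rewrite mulrBl.
  rewrite sumrB; congr (_ - _).
  transitivity (\sum_a iota a ^+ (qq j + p ^ l) * iota (a + u) ^+ m).
    rewrite (reindex_inj (addIr u)) /=; apply: eq_bigr => a _.
    by rewrite -rmorphB addrK.
  rewrite moment_shift; case: leqP => [le|lt].
    have lt : (Q - p ^ l < m.+1)%N by [].
    rewrite (bigD1 (Ordinal lt)) //= moment_power ?leq_subr // -/Q eqxx mulN1r big1 ?addr0 // => i ne.
    rewrite moment_power ?ifF ?mul0r //.
      by apply/negbTE; apply: contra ne => /eqP e; apply/eqP/val_inj.
    by apply: leq_trans mQ; rewrite -ltnS.
  rewrite big1 // => i _; have il := ltn_ord i.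
  rewrite moment_power ?ifF ?mul0r //; first by apply/negbTE; move: il lt; clear; lia.
  by apply: leq_trans mQ; rewrite -ltnS.
split=> [m mQ hm|].
  rewrite e ?(ltnW mQ) // /A /B; have [lt|lt|->] := ltngtP m (Q - p ^ l).
  - exact: subrr.
  - have /eqP -> : 'C(m, Q - p ^ l)%:R == 0 :> k by rewrite (natr_bin_eq0 Hpk); apply: bsub_top hm lt.
    by rewrite oppr0 mul0r addr0.
  - by rewrite binn subnn expr0 mulr1; exact: subrr.
rewrite e // /A /B leq_subr ifF; last by apply/negbTE; move: lQ P0; clear; lia.
by rewrite subr0 subKn.
Qed.

Lemma inv_elix i j l n : (l < f)%N -> (2 <= n)%N ->
  I1invariant v w0 res teich iota r (EL (elix i j l n)).
Proof.
case: n => [|[|m]] // lf _ h hI.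
have [a [b [c [d [[oa ob oc od] ra rd act]]]]] := act_I1 i hI.
set N := m.+1; set s := (qq j + p ^ l)%N; set Q := qq (~~ j).
pose sg := mob a b c d.
have sgO x : O x -> O (sg x) by move=> ox; apply: mobO.
pose pi (nu : N.-tuple Fq) := digs N (sg (TS nu N)).
pose psi (nu : seq Fq) := dig N (sg (TS nu N)).
pose G (nu : N.-tuple Fq) u X := BR (rp i j N.+1 (TS (pi nu) N + w0 ^+ N * teich u)) X.
have oTS mu n : O (TS mu n) by apply: tsumO.
have nthE (nu : N.-tuple Fq) u : nth 0 (rcons nu u) N.+1.-1 = u.
  by rewrite nth_rcons size_tuple ltnn eqxx.
have E1 X : EV (actL h (EL (elix i j l N.+1))) X =
    \sum_(nu : N.-tuple Fq) \sum_u (iota u - iota (psi nu)) ^+ s * G nu u X.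
  have hl := @eqf_br X; rewrite EVE pair_act pair_elix //; last by apply: (eqfL h hl).
  rewrite (@sum_rcons _ (fun mu => iota (nth 0 mu N.+1.-1) ^+ s * BR (h *m rp i j N.+1 (TS mu N.+1)) X)).
  apply: eq_bigr => nu _; rewrite [RHS](reindex_inj (addIr (psi nu))) /=.
  apply: eq_bigr => u _; rewrite nthE -rmorphB addrK; congr (_ * _).
  rewrite (act (fun g => BR g X)) //.
  have ox := oTS nu N; have ot : O (teich u) by exact: HtO.
  have oy : O (TS nu N + w0 ^+ N * teich u) by solveO.
  rewrite tsum_rcons /G -/sg; apply: (eqf_cong _ _ hl); first exact: sgO.
  apply: cong_trans (mob_step oa ob oc od ra rd N ox ot) _.
  rewrite -/(sg _) /pi; have h0 := trunc_step N (sgO _ ox).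
  have [y1 oy1 e1] := congE h0; rewrite {1}e1.
  have [y2 oy2 [_ e2]] := carryP (psi nu) u.
  rewrite -/(trunc _ _) -/(psi nu).
  have -> : teich (u + psi nu) = teich (psi nu) + teich u - w0 * y2 by rewrite e2 addrC addrK.
  apply: cong_sym; set D := teich (psi nu); set T := trunc N _.
  have -> : T + w0 ^+ N * D + w0 ^+ N.+1 * y1 + w0 ^+ N * teich u =
     T + w0 ^+ N * (D + teich u - w0 * y2) + w0 ^+ N.+1 * (y1 + y2) by rewrite exprS; ring.
  by apply: congI; apply: OD.
have E2 X : EV (EL (elix i j l N.+1)) X =
    \sum_(nu : N.-tuple Fq) \sum_u iota u ^+ s * G nu u X.
  have hl := @eqf_br X; rewrite EVE pair_elix //.
  rewrite (@sum_rcons _ (fun mu => iota (nth 0 mu N.+1.-1) ^+ s * BR (rp i j N.+1 (TS mu N.+1)) X)).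
  have pi_inj : injective pi.
    move=> nu nu' e; rewrite -[nu]digs_tsum -[nu']digs_tsum; apply: digs_cong => //.
    apply: (mob_inj oa ob oc od ra rd) => //; rewrite -!/(sg _).
    apply: cong_trans (cong_sym (trunc_cong N (sgO _ (oTS _ _)))) _.
    by rewrite /trunc -/(pi nu') -e; apply: trunc_cong; apply: sgO.
  rewrite (reindex_inj pi_inj); apply: eq_bigr => nu _; apply: eq_bigr => u _.
  by rewrite tsum_rcons; congr (iota _ ^+ _ * _); exact: nthE.
pose phi (nu : N.-tuple Fq) u := (iota u - iota (psi nu)) ^+ s - iota u ^+ s.
have phiM nu := @shifted_power j l (psi nu) lf.
pose C := kap (~~ j) * - 'C(Q, Q - p ^ l)%:R.
(* [R1] is a sum of relations from [inW_moment]; [R2] is the remaining defect, one level lower. *)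
pose R1 X := \sum_nu (\sum_u phi nu u * G nu u X
    - kap (~~ j) * moment (phi nu) Q * BR (rp i (~~ j) N (TS (pi nu) N)) X).
pose R2 X := \sum_(nu : N.-tuple Fq) iota (psi nu) ^+ (p ^ l) * BR (rp i (~~ j) N (TS (pi nu) N)) X.
refine (@inW_ext (fun X => R1 X + C * R2 X) _ _ _).
  move=> X; rewrite E1 E2 /R1 /R2 -sumrB mulr_sumr -big_split; apply: eq_bigr => nu _ /=.
  rewrite (proj2 (phiM nu)) -/Q -sumrB.
  under [X in _ = X]eq_bigr => u _ do rewrite -mulrBl.
  by rewrite -/(phi nu _) /C !mulrA subrK.
apply: inWD.
  apply: inW_sum => nu; have := @inW_moment i (~~ j) N (TS (pi nu) N) (phi nu) (oTS _ _) (proj1 (phiM nu)).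
  by rewrite negbK.
apply: inWZ.
(* The defect as a function of the last digit of the truncation. It exists because N is at least 1,
   that is n at least 2. *)
pose H nu'' u := iota (psi (rcons nu'' u)) ^+ (p ^ l).
apply: (@inW_ext (fun X => \sum_(nu'' : m.-tuple Fq) \sum_u H nu'' u *
   BR (rp i (~~ j) N (trunc m (sg (TS nu'' m)) + w0 ^+ m * teich (u + dig m (sg (TS nu'' m))))) X)).
  move=> X; apply: etrans (esym (@sum_rcons m (fun nu => iota (psi nu) ^+ (p ^ l) * BR (rp i (~~ j) N (trunc N (sg (TS nu N)))) X))).
  apply: eq_bigr => nu'' _; apply: eq_bigr => u _; congr (_ * _).
  have ox := oTS nu'' m; have ot : O (teich u) by exact: HtO.
  have oy : O (TS nu'' m + w0 ^+ m * teich u) by solveO.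
  rewrite tsum_rcons; symmetry; apply: (eqf_cong _ _ (@eqf_br X)); first exact: truncO.
  apply: cong_trans (trunc_cong _ (sgO _ oy)) _.
  apply: cong_trans (mob_step oa ob oc od ra rd m ox ot) _.
  rewrite -/(sg _); have h0 := trunc_step m (sgO _ ox).
  have [y1 oy1 e1] := congE h0; rewrite {1}e1.
  have [y2 oy2 [_ e2]] := carryP (dig m (sg (TS nu'' m))) u.
  have -> : teich (u + dig m (sg (TS nu'' m))) = teich (dig m (sg (TS nu'' m))) + teich u - w0 * y2.
    by rewrite e2 addrC addrK.
  apply: cong_sym; set D := teich (dig _ _); set T := trunc m _.
  have -> : T + w0 ^+ m * D + w0 ^+ m.+1 * y1 + w0 ^+ m * teich u =
     T + w0 ^+ m * (D + teich u - w0 * y2) + w0 ^+ m.+1 * (y1 + y2) by rewrite exprS; ring.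
  by apply: congI; apply: OD.
apply: inW_sum => nu''.
set d0 := dig m _; set T := trunc m _.
have sh : short (qq j) (H nu'').
  have [C0 [C1 [C2 eC]]] := mob_digit oa ob oc od ra rd m (oTS nu'' m).
  apply: (@fshort_ext j l (fun u => C0 * u ^+ 0 + C1 * u ^+ 1 + C2 * u ^+ 2 + carry d0 u)).
    move=> u; rewrite /= expr0 mulr1 expr1 -eC /psi.
    by case: (nu'') => t /= /eqP st; rewrite -(tsum_rcons (Tuple (introT eqP st))).
  apply: fshortD; last exact: fshort_carry.
  by apply: fshortD; [apply: fshortD|]; apply: fshortZ; apply: fshort_mono.
(* Recentring: h also translates digit m, by [d0], and shortness is stable under translation. *)
pose g u := H nu'' (u - d0).
have shg : short (qq j) g by apply: short_shift.
have := @inW_moment i j m T g (truncO _ _) (fun t tQ ht => shg t ht).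
have bQ : bsub p (qq j) (qq j) by rewrite /bsub binn Euclid_dvd1.
apply: inW_ext => X; rewrite (shg _ bQ) mulr0 mul0r subr0.
rewrite (reindex_inj (addIr d0)) /=; apply: eq_bigr => u _.
by rewrite /g addrK.
Qed.

End AwayFromQp.

(** At level 0 all integral x represent the same coset. *)
Lemma inv_base i : I1invariant v w0 res teich iota r (EL (if i then BBeta else BId)).
Proof.
move=> h hI; have [a [b [c [d [[oa ob oc od] ra rd act]]]]] := act_I1 i hI.
apply: inW_ext inW0 => X; have hl := @eqf_br X; have hl' := eqfL h hl.
have e lam : eqf lam -> pairing lam (EL (if i then BBeta else BId)) = lam (rp i false 0 0).
  by move=> hlam; case: (i); rewrite ?pair_elId ?pair_elBeta.
rewrite !EVE pair_act (e _ hl') (e _ hl) (act (fun g => BR g X)) //; last exact: O0.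
have oy : O (mob a b c d 0) by apply: mobO => //; apply: O0.
by rewrite -(eqf_cong (lam := fun g => BR g X) i false hl O0 (cong0 O0 oy)) subrr.
Qed.

(** * Linear independence *)

Lemma cong_tuple m y (nu : m.-tuple Fq) : O y -> cong m y (TS nu m) = (nu == digs m y).
Proof.
move=> oy; apply/idP/eqP => [h|->].
  by rewrite -(digs_cong oy h) digs_tsum.
by apply: cong_sym; apply: cong_digs.
Qed.

Lemma cong_shift m x y z : O z -> cong m x (y + w0 ^+ m * z) = cong m x y.
Proof.
move=> oz; apply/idP/idP => h; last exact: cong_trans h (congI _ _ oz).
exact: cong_trans h (cong_sym (congI _ _ oz)).
Qed.

Lemma nth_rcons_size n (nu : n.-tuple Fq) u : nth 0 (rcons nu u) n = u.
Proof. by rewrite nth_rcons size_tuple ltnn eqxx. Qed.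

Lemma psum_above l : (l < f)%N -> psum iota ((p ^ f).-1 + p ^ l) = 0.
Proof.
move=> lf; have h := exp_small lf; have P0 : (0 < p ^ l)%N by rewrite expn_gt0 prime_gt0.
rewrite (psum_eq iota Hp Hf HFq Hpk); last by move: h; clear; lia.
by rewrite ifF //; apply/negbTE; move: P0; clear; lia.
Qed.

(** A form continued upwards reads the last digit with exponent [qq (~~ j)]; together with the
    exponent of the candidate this makes [q-1+p^l], whose power sum is 0. *)
Lemma pair_elix_step lam i j l n : eqf lam -> (l < f)%N ->
  (forall x, O x -> lam (rp i j n.+1 x) =
     kap (~~ j) * iota (dig n x) ^+ qq (~~ j) * lam (rp i (~~ j) n x)) ->
  pairing lam (EL (elix i j l n.+1)) = 0.
Proof.
move=> hl lf st; rewrite pair_elix //.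
rewrite (@sum_rcons _ (fun mu => iota (nth 0 mu n.+1.-1) ^+ (qq j + p ^ l) * lam (rp i j n.+1 (TS mu n.+1)))).
apply: big1 => nu _.
transitivity (\sum_u kap (~~ j) * lam (rp i (~~ j) n (TS nu n)) * iota u ^+ ((p ^ f).-1 + p ^ l)).
  apply: eq_bigr => u _; rewrite nth_rcons size_tuple ltnn eqxx tsum_rcons st; last first.
    by have := tsumO nu n => ?; solveO.
  rewrite digD ?dig_tsum_top ?add0r ?Htres; [|exact: tsumO|exact: HtO].
  rewrite (eqf_cong i (~~ j) hl (tsumO nu n) (congI n _ (HtO u))).
  by rewrite -(qq_compl j) !exprD; ring.
by rewrite -mulr_sumr -/(psum iota _) psum_above // mulr0.
Qed.

Lemma coord_read lam i0 j0 m y kk i j (phi : seq Fq -> k) : O y ->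
  (forall i j x, O x -> lam (rp i j m.+1 x) =
    [&& i == i0, j == j0 & cong m y x]%:R * iota (dig m x) ^+ kk) ->
  \sum_(mu : m.+1.-tuple Fq) phi mu * lam (rp i j m.+1 (TS mu m.+1)) =
  ((i == i0) && (j == j0))%:R * moment (fun u => phi (rcons (digs m y) u)) kk.
Proof.
move=> oy st.
rewrite (@sum_rcons _ (fun mu => phi mu * lam (rp i j m.+1 (TS mu m.+1)))).
have E (nu : m.-tuple Fq) u : lam (rp i j m.+1 (TS (rcons nu u) m.+1)) =
    ((i == i0) && (j == j0))%:R * (nu == digs m y)%:R * iota u ^+ kk.
  rewrite tsum_rcons st; last by have := tsumO nu m => ?; solveO.
  rewrite digD ?dig_tsum_top ?add0r ?Htres; [|exact: tsumO|exact: HtO].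
  rewrite cong_shift; last exact: HtO.
  by rewrite cong_tuple // -natrM mulnb andbA.
set D := digs m y in E *; clearbody D; rewrite (bigD1 D) //= [X in _ + X]big1 ?addr0 => [|nu ne]; last first.
  by apply: big1 => u _; rewrite E (negbTE ne) mulr0 mul0r mulr0.
rewrite mulr_sumr; apply: eq_bigr => u _; rewrite E eqxx mulr1; ring.
Qed.

Definition valid (i : bidx) : bool :=
  match i with
  | BId | BBeta => true
  | BS l n _ | BT l n _ => [&& ~~ ((ram == 1%N) && (f == 1%N)), (l < f)%N & (2 <= n)%N]
  end.

Lemma valid_cases b : valid b -> b = BId \/ b = BBeta \/
  exists i j l n, [/\ b = elix i j l n.+2, (l < f)%N & ~~ ((ram == 1%N) && (f == 1%N))].
Proof.
case: b => [||l n i|l n i] /=; first [by left | by right; left | idtac].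
  case/and3P => nq lf; case: n => [|[|n]] // _; right; right.
  by exists i, false, l, n.
case/and3P => nq lf; case: n => [|[|n]] // _; right; right.
by exists i, true, l, n.
Qed.

Lemma elix_eq i j l n i' j' l' n' : (elix i j l n == elix i' j' l' n') =
  [&& i == i', j == j', l == l' & n == n'].
Proof.
apply/eqP/idP => [|/and4P[/eqP -> /eqP -> /eqP -> /eqP ->] //].
by rewrite /elix; case: j; case: j' => //= -[-> -> ->]; rewrite !eqxx.
Qed.

Lemma dual_base i0 : exists lam, [/\ eqf lam, forall s, W (EV s) -> pairing lam s = 0 &
  forall b, valid b -> pairing lam (EL b) = (b == if i0 then BBeta else BId)%:R].
Proof.
have [lam [hl hW h0 st]] := coord0_ex i0; exists lam; split=> // b.
case/valid_cases => [->|[->|[i [j [l [n [-> lf _]]]]]]].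
- by rewrite pair_elId // h0; [case: (i0) | exact: O0].
- by rewrite pair_elBeta // h0; [case: (i0) | exact: O0].
rewrite pair_elix_step //; last by move=> x ox; rewrite -st // negbK.
by case: (i0); rewrite /elix; case: (j).
Qed.

(** The form reads the moment of order [Q - p^l0] over the truncation 0. It ignores lower levels,
    kills higher ones by [pair_elix_step], and on its own level separates the values of l; the sign
    is the power sum of exponent q-1. *)
Lemma dual_elix i0 j0 l0 m : (l0 < f)%N -> exists lam, [/\ eqf lam,
  forall s, W (EV s) -> pairing lam s = 0 &
  forall b, valid b -> pairing lam (EL b) = - (b == elix i0 j0 l0 m.+1)%:R].
Proof.
move=> lf0; have P0 l : (0 < p ^ l)%N by rewrite expn_gt0 prime_gt0.
have le0 := exp_le_qq (~~ j0) lf0; have hk : (qq (~~ j0) - p ^ l0 < qq (~~ j0))%N.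
  by move: (P0 l0) le0; clear; lia.
have [lam [hl hW h0 hm st]] := coord_ex i0 m O0 hk (bsub_qq (~~ j0) lf0).
exists lam; split=> // b /valid_cases[->|[->|[i [j [l [n [-> lf _]]]]]]].
- by rewrite pair_elId // h0 //; [rewrite /elix; case: (j0); rewrite oppr0 | exact: O0].
- by rewrite pair_elBeta // h0 //; [rewrite /elix; case: (j0); rewrite oppr0 | exact: O0].
rewrite elix_eq eqSS; case: (ltngtP n.+1 m) => [lt|lt|e].
- rewrite !andbF oppr0 pair_elix // big1 // => mu _.
  by rewrite h0 ?mulr0 //; exact: tsumO.
- rewrite !andbF oppr0 pair_elix_step // => x ox.
  by rewrite -st ?negbK.
rewrite e pair_elix // (coord_read i j (fun mu => iota (nth 0 mu m.+1.-1) ^+ (qq j + p ^ l)) O0 hm).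
rewrite andbT andbA; case: (i == i0); rewrite ?mul0r ?oppr0 //=.
case: eqP => [ej|]; rewrite ?mul0r ?oppr0 //= mul1r -ej in le0 *.
transitivity (moment (fun a => iota a ^+ (qq j + p ^ l)) (qq (~~ j) - p ^ l0)).
  by apply: eq_bigr => u _; congr (iota _ ^+ _ * _); exact: (nth_rcons_size (digs m 0)).
rewrite moment_power ?leq_subr //.
have le1 := exp_le_qq (~~ j) lf.
have -> : (qq (~~ j) - p ^ l0 == qq (~~ j) - p ^ l)%N = (l == l0).
  rewrite -(eqn_exp2l l l0 (prime_gt1 Hp)); apply/eqP/eqP; move: le0 le1; clear; lia.
by case: (l == l0); rewrite ?oppr0.
Qed.

Local Notation CB := (comb p f w0 teich iota r).

Lemma pair_comb lam L : pairing lam (CB L) = \sum_(c <- L) c.1 * pairing lam (EL c.2).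
Proof.
rewrite /comb; elim: L => [|c L IH]; first by rewrite /pairing !big_nil.
by rewrite big_cons -IH /= pair_cat pair_scale.
Qed.

Lemma independent (L : seq (k * bidx)) : uniq (map snd L) -> all valid (map snd L) ->
  W (EV (CB L)) -> forall c, c \in L -> c.1 = 0.
Proof.
move=> uL vL hW c cL.
have vc b : b \in L -> valid b.2 by move=> bL; apply: (allP vL); apply: map_f.
have [lam [C C0 [hl lamW dual]]] : exists lam, exists2 C, C != 0 & [/\ eqf lam,
    forall s, W (EV s) -> pairing lam s = 0 &
    forall b, valid b -> pairing lam (EL b) = C * (b == c.2)%:R].
  case: (valid_cases (vc c cL)) => [->|[->|[i [j [l [n [-> lf _]]]]]]].
  - have [lam [h1 h2 h3]] := dual_base false; exists lam; exists 1; first exact: oner_neq0.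
    by split=> // b vb; rewrite mul1r h3.
  - have [lam [h1 h2 h3]] := dual_base true; exists lam; exists 1; first exact: oner_neq0.
    by split=> // b vb; rewrite mul1r h3.
  have [lam [h1 h2 h3]] := dual_elix i j n.+1 lf; exists lam; exists (-1); first by rewrite oppr_eq0 oner_neq0.
  by split=> // b vb; rewrite mulN1r h3.
have := lamW _ hW; rewrite pair_comb (bigD1_seq c) ?(map_uniq uL) //= big1_seq => [|b].
  rewrite addr0 dual ?eqxx ?mulr1; last exact: vc.
  by move/eqP; rewrite mulf_eq0 (negbTE C0) orbF => /eqP.
case/andP => ne bL; rewrite dual; last exact: vc.
case: eqP => [e|_]; last by rewrite !mulr0.
exfalso; move/negP: ne; apply; apply/eqP.
have ib : index b.2 (map snd L) = index c.2 (map snd L) by rewrite e.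
(* Second components being distinct, a pair is recovered from the position of its second
   component. *)
have key (z : k * bidx) : z \in L -> nth z L (index z.2 (map snd L)) = z.
  move=> zL; have iz := zL; rewrite -index_mem in iz.
  have -> : index z.2 [seq u.2 | u <- L] = index z L.
    have sz : (index z L < size (map snd L))%N by rewrite size_map.
    by rewrite -(index_uniq (snd z) sz uL) (nth_map z) ?nth_index.
  exact: nth_index.
rewrite -(key b bL) -(key c cL) ib; apply: set_nth_default.
by rewrite -(size_map snd) index_mem map_f.
Qed.

(** * Spanning *)

Definition formf N (phi : bool -> bool -> seq Fq -> k) : fsum F k :=
  fs (fun t : bool * bool * N.-tuple Fq => phi t.1.1 t.1.2 t.2)
     (fun t => rp t.1.1 t.1.2 N (TS t.2 N)).

Lemma pair_formf lam N phi : pairing lam (formf N phi) =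
  \sum_i \sum_j \sum_(mu : N.-tuple Fq) phi i j mu * lam (rp i j N (TS mu N)).
Proof. by rewrite pair_fs !pair_big. Qed.

Definition congW (phi psi : 'M[F]_2 -> k) : Prop := W (fun X => phi X - psi X).

Lemma congW_refl phi psi : phi =1 psi -> congW phi psi.
Proof. by move=> e; apply: inW_ext inW0 => X; rewrite e subrr. Qed.
Lemma congW_sym phi psi : congW phi psi -> congW psi phi.
Proof. by move=> /(inWZ (-1)); apply: inW_ext => X; rewrite mulN1r opprB. Qed.
Lemma congW_trans phi psi chi : congW phi psi -> congW psi chi -> congW phi chi.
Proof. by move=> h1 h2; apply: inW_ext (inWD h1 h2) => X; rewrite addrA subrK. Qed.
Lemma congWD phi psi phi' psi' : congW phi psi -> congW phi' psi' ->
  congW (fun X => phi X + phi' X) (fun X => psi X + psi' X).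
Proof. by move=> h1 h2; apply: inW_ext (inWD h1 h2) => X; ring. Qed.
Lemma congWZ c phi psi : congW phi psi -> congW (fun X => c * phi X) (fun X => c * psi X).
Proof. by move=> /(inWZ c); apply: inW_ext => X; rewrite mulrBr. Qed.

Definition repN N phi := exists g, congW phi (EV (formf N g)).

Lemma repND N phi psi : repN N phi -> repN N psi -> repN N (fun X => phi X + psi X).
Proof.
move=> [g hg] [h hh]; exists (fun i j mu => g i j mu + h i j mu).
apply: congW_trans (congWD hg hh) _; apply: congW_refl => X.
rewrite !EVE !pair_formf -big_split; apply: eq_bigr => i _; rewrite -big_split.
by apply: eq_bigr => j _; rewrite -big_split; apply: eq_bigr => mu _; rewrite /= mulrDl.
Qed.

Lemma repNZ N c phi : repN N phi -> repN N (fun X => c * phi X).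
Proof.
move=> [g hg]; exists (fun i j mu => c * g i j mu).
apply: congW_trans (congWZ c hg) _; apply: congW_refl => X.
rewrite !EVE !pair_formf mulr_sumr; apply: eq_bigr => i _; rewrite mulr_sumr.
by apply: eq_bigr => j _; rewrite mulr_sumr; apply: eq_bigr => mu _; rewrite mulrA.
Qed.

Lemma repN_ext N phi psi : congW psi phi -> repN N phi -> repN N psi.
Proof. by move=> h [g hg]; exists g; apply: congW_trans h hg. Qed.

Lemma repN_sum N (I : finType) (phi : I -> 'M[F]_2 -> k) :
  (forall i, repN N (phi i)) -> repN N (fun X => \sum_i phi i X).
Proof.
move=> h; elim: (index_enum I) => [|i s IH].
  exists (fun _ _ _ => 0); apply: congW_refl => X; rewrite big_nil EVE pair_formf.
  by rewrite big1 // => i _; rewrite big1 // => j _; rewrite big1 // => mu _; rewrite mul0r.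
by apply: repN_ext (repND (h i) IH); apply: congW_refl => X; rewrite big_cons.
Qed.

Lemma repN_rp N i j x : O x -> repN N (BR (rp i j N x)).
Proof.
move=> ox; exists (fun (i' j' : bool) (mu : seq Fq) => [&& i' == i, j' == j & mu == digs N x :> seq Fq]%:R).
apply: congW_refl => X; rewrite EVE pair_formf.
rewrite (bigD1 i) //= [X in _ + X]big1 ?addr0 => [|i' /negbTE ne]; last first.
  by rewrite big1 // => j' _; rewrite big1 // => mu _; rewrite ne mul0r.
rewrite (bigD1 j) //= [X in _ + X]big1 ?addr0 => [|j' /negbTE ne]; last first.
  by rewrite big1 // => mu _; rewrite ne andbF mul0r.
rewrite (bigD1 (digs N x)) // big1 ?addr0 => [|mu ne]; last first.
  by rewrite -val_eqE in ne; rewrite (negbTE ne) !andbF mul0r.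
rewrite !eqxx /= mul1r addr0.
by apply/esym; apply: (eqf_cong (lam := fun g => BR g X)) => //; [exact: eqf_br|exact: tsumO|exact: cong_digs].
Qed.

(* The relation for [a^(qq (~~ j))] expresses an edge of level [N] by edges of level [N.+1]. *)
Lemma repN_step N i j x : O x -> repN N.+1 (BR (rp i j N x)).
Proof.
move=> ox; pose g (u : Fq) : k := iota u ^+ qq (~~ j).
have qs := qq_compl j; have q1 := qq_gt0 (~~ j); have q2 := qq_lt j.
have gM m : (m <= qq j)%N -> moment g m = if m == qq j then -1 else 0.
  move=> mQ; rewrite /power_moment /g; under eq_bigr => a _ do rewrite -exprD.
  rewrite -/(psum iota _) (psum_eq iota Hp Hf HFq Hpk); last by move: mQ qs q1 q2; clear; lia.
  by congr (if _ then _ else _); apply/eqP/eqP; move: mQ qs q1 q2; clear; lia.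
have gN : null_moments (qq j) g by move=> m mQ _; rewrite gM ?(ltnW mQ) // ltn_eqF.
have := inW_moment i N ox gN; rewrite gM // eqxx mulrN1 => hW.
have k0 := kap_neq0 j.
apply: (@repN_ext _ (fun X => \sum_u (- (kap j)^-1 * g u) *
   BR (rp i (~~ j) N.+1 (x + w0 ^+ N * teich u)) X)).
  apply: congW_sym; apply: inW_ext (inWZ (- (kap j)^-1) hW) => X.
  rewrite mulrBr mulr_sumr; congr (_ - _); last by field.
  by apply: eq_bigr => u _; rewrite mulrA.
apply: repN_sum => u; apply: repNZ; apply: repN_rp.
by have := HtO u => ?; solveO.
Qed.

Lemma repN_S N phi : repN N phi -> repN N.+1 phi.
Proof.
move=> [g hg]; apply: (repN_ext hg).
apply: (@repN_ext _ (fun X => \sum_i \sum_j \sum_(mu : N.-tuple Fq) g i j mu * BR (rp i j N (TS mu N)) X)).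
  by apply: congW_refl => X; rewrite EVE pair_formf.
apply: repN_sum => i; apply: repN_sum => j; apply: repN_sum => mu; apply: repNZ.
by apply: repN_step; apply: tsumO.
Qed.

Lemma repN_le N M phi : (N <= M)%N -> repN N phi -> repN M phi.
Proof. by move=> /subnKC <- h; elim: (M - N)%N => [|d IH]; rewrite ?addn0 // addnS; apply: repN_S. Qed.

Lemma repN_ex s : exists N, repN N (EV s).
Proof.
elim: s => [|[c g] s [N hN]].
  by exists 0%N; exists (fun _ _ _ => 0); apply: congW_refl => X; rewrite !EVE pair_formf /pairing big_nil
    big1 // => i _; rewrite big1 // => j _; rewrite big1 // => mu _; rewrite mul0r.
have [M hM] : exists M, repN M (BR g).
  have [/eqP D|/normal_form[i [j [n [x [h [ox hh ->]]]]]]] := eqVneq (\det g) 0.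
    exists 0%N; exists (fun _ _ _ => 0); apply: congW_refl => X; rewrite EVE pair_formf.
    rewrite big1 => [|i _]; last by rewrite big1 // => j _; rewrite big1 // => mu _; rewrite mul0r.
    rewrite /br chiTN //; apply/negP => /inIZ_unit.
    by rewrite unitmxE det_mulmx (eqP D) mulr0 unitr0.
  exists n; apply: (@repN_ext _ (fun X => chiT v w0 res iota r h * BR (rp i j n x) X)).
    by apply: congW_refl => X; exact: eqf_br.
  by apply: repNZ; apply: repN_rp.
exists (maxn M N); apply: (@repN_ext _ (fun X => c * BR g X + EV s X)).
  by apply: congW_refl => X; rewrite /ev big_cons.
apply: repND; last exact: repN_le (leq_maxr _ _) hN.
by apply: repNZ; exact: repN_le (leq_maxl _ _) hM.
Qed.

Lemma descend N g : (forall i j (nu : N.-tuple Fq), null_moments (qq (~~ j)) (fun u => g i j (rcons nu u))) ->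
  repN N (EV (formf N.+1 g)).
Proof.
move=> h; apply: (@repN_ext _ (fun X => \sum_i \sum_j \sum_(nu : N.-tuple Fq)
   kap (~~ j) * moment (fun u => g i j (rcons nu u)) (qq (~~ j)) * BR (rp i (~~ j) N (TS nu N)) X)).
  apply: (@inW_ext (fun X => \sum_i \sum_j \sum_(nu : N.-tuple Fq)
    ((\sum_u g i j (rcons nu u) * BR (rp i j N.+1 (TS nu N + w0 ^+ N * teich u)) X)
     - kap (~~ j) * moment (fun u => g i j (rcons nu u)) (qq (~~ j)) * BR (rp i (~~ j) N (TS nu N)) X))).
    move=> X; rewrite EVE pair_formf -sumrB; apply: eq_bigr => i _; rewrite -sumrB.
    apply: eq_bigr => j _; rewrite sumrB; congr (_ - _).
    rewrite (@sum_rcons _ (fun mu => g i j mu * BR (rp i j N.+1 (TS mu N.+1)) X)).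
    by apply: eq_bigr => nu _; apply: eq_bigr => u _; rewrite tsum_rcons.
  apply: inW_sum => i; apply: inW_sum => j; apply: inW_sum => nu.
  by have := inW_moment i N (tsumO nu N) (h i j nu); rewrite negbK.
apply: repN_sum => i; apply: repN_sum => j; apply: repN_sum => nu; apply: repNZ.
by apply: repN_rp; apply: tsumO.
Qed.

Definition Inv (phi : 'M[F]_2 -> k) : Prop :=
  forall h, inI1 v res h -> congW (fun X => phi (X *m h)) phi.

Lemma InvE s : I1invariant v w0 res teich iota r s <-> Inv (EV s).
Proof. by split=> H h /H; apply: inW_ext => X; rewrite EV_act. Qed.

Lemma Inv_cong phi psi : congW phi psi -> Inv phi -> Inv psi.
Proof.
move=> c H h hI; refine (congW_trans _ c); refine (congW_trans _ (H h hI)).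
by apply: congW_sym; exact: (inW_act h c).
Qed.
Lemma InvD phi psi : Inv phi -> Inv psi -> Inv (fun X => phi X + psi X).
Proof. by move=> H1 H2 h hI; apply: congWD; [exact: H1 | exact: H2]. Qed.
Lemma InvZ c phi : Inv phi -> Inv (fun X => c * phi X).
Proof. by move=> H h hI; apply: congWZ; exact: H. Qed.
Lemma Inv_sum (I : finType) (phi : I -> 'M[F]_2 -> k) :
  (forall i, Inv (phi i)) -> Inv (fun X => \sum_i phi i X).
Proof.
move=> h; elim: (index_enum I) => [|i s IH].
  by apply: (@Inv_cong (fun=> 0)); [apply: congW_refl => X; rewrite big_nil | move=> g _; exact: congW_refl].
by apply: Inv_cong (InvD (h i) IH); apply: congW_refl => X; rewrite big_cons.
Qed.

Lemma Inv_pair s lam h : Inv (EV s) -> (forall t, W (EV t) -> pairing lam t = 0) ->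
  inI1 v res h -> pairing (fun g => lam (h *m g)) s = pairing lam s.
Proof.
move=> H hW hI; apply/eqP; rewrite -subr_eq0 -mulN1r -pair_act -pair_scale -pair_cat; apply/eqP.
apply: hW; apply: inW_ext (H h hI) => X.
by rewrite [RHS]EVE pair_cat pair_scale mulN1r -!EVE EV_act.
Qed.

Lemma tsum_digs0 N : TS (digs N 0) N = 0.
Proof.
have z i : dig i 0 = 0.
  suff : iter i shift 0 = 0 by rewrite /dig => ->; exact: res0.
  by elim: i => //= i ->; rewrite /shift res0 Ht0 subrr mul0r.
by apply: big1 => i _; rewrite -tnth_nth tnth_mktuple z Ht0 mul0r.
Qed.

(** * Moments of the top level of an invariant vector *)

Section TopLevel.
Variables (N : nat) (g : bool -> bool -> seq Fq -> k).
Hypothesis HI : Inv (EV (formf N.+1 g)).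
Local Notation mom i j nu := (moment (fun u => g i j (rcons nu u))).

Lemma sum_single i (j : bool) lam (h : 'M[F]_2) :
  (forall i' j' mu, ~~ ((i' == i) && (j' == j)) -> lam (h *m rp i' j' N.+1 (TS mu N.+1)) = 0) ->
  pairing (fun x => lam (h *m x)) (formf N.+1 g) =
  \sum_(nu : N.-tuple Fq) \sum_u g i j (rcons nu u) * lam (h *m rp i j N.+1 (TS nu N + w0 ^+ N * teich u)).
Proof.
move=> z; rewrite pair_formf.
rewrite (bigD1 i) //= [X in _ + X]big1 ?addr0 => [|i' /negbTE ne]; last first.
  by rewrite big1 // => j' _; rewrite big1 // => mu _; rewrite z ?mulr0 // ne.
rewrite (bigD1 j) //= [X in _ + X]big1 ?addr0 => [|j' /negbTE ne]; last first.
  by rewrite big1 // => mu _; rewrite z ?mulr0 // ne andbF.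
rewrite (@sum_rcons _ (fun mu => g i j mu * lam (h *m rp i j N.+1 (TS mu N.+1)))).
by apply: eq_bigr => nu _; apply: eq_bigr => u _; rewrite tsum_rcons.
Qed.

(** Invariance under [hb i b] is tested against the form of [coord_ex] at the vertex nu, which
    vanishes on the other half and hence ignores the non-translation there. *)
Lemma inv_coord i j (nu : N.-tuple Fq) m b : O b -> (m < qq (~~ j))%N -> bsub p (qq (~~ j)) m ->
  \sum_(nu' : N.-tuple Fq) \sum_u g i j (rcons nu' u) *
    ((cong N (TS nu N) (TS nu' N + w0 ^+ N * teich u + b))%:R
      * iota (dig N (TS nu' N + w0 ^+ N * teich u + b)) ^+ m) = mom i j nu m.
Proof.
move=> ob hm hb'.
have [lam [hl hW _ h1 _]] := coord_ex i N (tsumO nu N) hm hb'.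
have oT (nu' : N.-tuple Fq) u : O (TS nu' N + w0 ^+ N * teich u).
  by have := tsumO nu' N => ?; solveO.
have e := Inv_pair HI hW (hb_I1 i ob).
rewrite (@sum_single i j) in e; last first.
  move=> i' j' mu; have oS := tsumO mu N.+1; have [->|ne] := eqVneq i' i.
    by rewrite hb_same // => /= ne; rewrite h1 ?(negbTE ne) ?andbF ?mul0r //; solveO.
  have -> : i' = ~~ i by case: (i') (i) ne => [] [].
  have oM : O (mob 1 0 b 1 (TS mu N.+1)) by apply: mobO => //; solveO.
  by rewrite hb_opp // h1 //; case: (i); rewrite mul0r.
transitivity (pairing lam (formf N.+1 g)).
  rewrite -e; apply: eq_bigr => nu' _; apply: eq_bigr => u _; congr (_ * _).
  have oTu := oT nu' u.
  by rewrite hb_same // h1 ?eqxx //; solveO.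
rewrite pair_formf (bigD1 i) //= [X in _ + X]big1 ?addr0 => [|i' /negbTE ne]; last first.
  by rewrite big1 // => j' _; rewrite (coord_read i' j' (g i' j') (tsumO nu N) h1) ne mul0r.
rewrite (bigD1 j) //= [X in _ + X]big1 ?addr0 => [|j' /negbTE ne]; last first.
  by rewrite (coord_read i j' (g i j') (tsumO nu N) h1) ne andbF mul0r.
by rewrite (coord_read i j (g i j) (tsumO nu N) h1) !eqxx mul1r digs_tsum.
Qed.

Lemma top_shift i j (nu : N.-tuple Fq) m c : (m < qq (~~ j))%N -> bsub p (qq (~~ j)) m ->
  \sum_u g i j (rcons nu u) * iota (u + c) ^+ m = mom i j nu m.
Proof.
move=> hm hb'; have ob : O (w0 ^+ N * teich c) by have := HtO c => ?; solveO.
rewrite -(inv_coord i nu ob hm hb') (bigD1 nu) //= [X in _ + X]big1 ?addr0 => [|nu' ne].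
  apply: eq_bigr => u _; have oT := tsumO nu N; have oc := HtO c.
  rewrite cong_shift // cong_shift; last exact: HtO.
  rewrite cong_refl mul1r digD ?Htres //; last by have := HtO u => ?; solveO.
  by rewrite digD ?dig_tsum_top ?add0r ?Htres //; exact: HtO.
apply: big1 => u _; rewrite cong_shift ?cong_shift; try exact: HtO.
by rewrite cong_tuple ?digs_tsum ?(negbTE ne) ?mul0r ?mulr0 //; exact: tsumO.
Qed.

(** [bsub_between] provides an order m2 < Q dominating m; that moment is invariant under shifts by
    [top_shift], which kills the moment of order m. *)
Lemma top_moment0 i j (nu : N.-tuple Fq) m : (m < qq (~~ j))%N -> bsub p (qq (~~ j)) m ->
  (forall l, (l < f)%N -> m != qq (~~ j) - p ^ l)%N -> mom i j nu m = 0.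
Proof.
move=> hm hb' ne; have [m2 [lt1 lt2 b1 b2]] := bsub_between Hp (qq_ltq (~~ j)) hm hb' ne.
apply: (moment_shift_inv Hp Hf HFq Hpk (m := m2)) => //.
  by apply: ltn_trans lt2 (qq_ltq _).
by move=> c; exact: top_shift.
Qed.

(** The translation by the truncation nu brings 0 to nu without any carry, so the last digit is
    unchanged. *)
Lemma top_const i j (nu : N.-tuple Fq) m : (m < qq (~~ j))%N -> bsub p (qq (~~ j)) m ->
  mom i j nu m = mom i j (digs N 0) m.
Proof.
move=> hm hb'; have ob := tsumO nu N; rewrite -(inv_coord i nu ob hm hb').
set D := digs N 0; have TD : TS D N = 0 by exact: tsum_digs0.
rewrite (bigD1 D) //= [X in _ + X]big1 ?addr0 => [|nu' ne].
  apply: eq_bigr => u _; rewrite TD add0r addrC cong_shift ?cong_refl ?mul1r; last exact: HtO.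
  by rewrite digD ?dig_tsum_top ?add0r ?Htres //; exact: HtO.
apply: big1 => u _; rewrite addrAC cong_shift; last exact: HtO.
have -> : cong N (TS nu N) (TS nu' N + TS nu N) = cong N 0 (TS nu' N).
  by rewrite /cong addrK subr0.
by rewrite cong_tuple ?(negbTE ne) ?mul0r ?mulr0 //; exact: O0.
Qed.

End TopLevel.

Lemma sum_tuple0 (G : seq Fq -> k) : \sum_(mu : 0.-tuple Fq) G mu = G [::].
Proof.
rewrite (bigD1 [tuple]) //= big1 ?addr0 // => mu /eqP[].
exact: tuple0.
Qed.

Lemma tsum_seq1 u : TS [:: u] 1 = teich u.
Proof. by rewrite /tsum big_ord1 expr0 mulr1. Qed.

(** At level 1 the level-0 form reads the moment of order Q itself, and its invariance under shifts
    kills all dominated lower orders, [Q - p^l] included. On the other half the element acts by [x /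
    (w0 [c] x + 1)], which keeps digit 0, so those terms cancel. *)
Lemma top_level1 g i j m : Inv (EV (formf 1 g)) -> (m < qq (~~ j))%N ->
  bsub p (qq (~~ j)) m -> moment (fun u => g i j [:: u]) m = 0.
Proof.
move=> HI hm hb'; have [lam [hl hW h0 h1]] := coord0_ex (i (+) ~~ j).
apply: (moment_shift_inv Hp Hf HFq Hpk (m := qq (~~ j))) => //; first exact: qq_ltq.
have st i' j' x : O x -> lam (rp i' j' 1 x) =
    kap (~~ j') * iota (dig 0 x) ^+ qq (~~ j') * (i' (+) ~~ j' == i (+) ~~ j)%:R.
  by move=> ox; have := h1 i' (~~ j') 0%N x ox; rewrite negbK => ->; rewrite h0.
move=> c; have oc : O (teich c) by exact: HtO.
have := Inv_pair HI hW (hb_I1 i oc); rewrite !pair_formf.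
rewrite (bigD1 i) // [in RHS](bigD1 i) //=.
rewrite [X in _ + X = _](_ : _ = \sum_(i' | i' != i) \sum_j' \sum_(mu : 1.-tuple Fq) g i' j' mu * lam (rp i' j' 1 (TS mu 1))); last first.
  apply: eq_bigr => i' ne; apply: eq_bigr => j' _; apply: eq_bigr => mu _; congr (_ * _).
  have -> : i' = ~~ i by case: (i') (i) ne => [] [].
  have oS := tsumO mu 1; rewrite hb_opp // !st //; last by apply: mobO => //; solveO.
  congr (_ * iota _ ^+ _ * _); rewrite /dig /= /mob.
  have o1 : O (w0 * teich c * TS mu 1 + 1) by solveO.
  have r1 : res (w0 * teich c * TS mu 1 + 1) = 1.
    by rewrite -mulrA HresD ?res_w0 ?add0r ?Hres1 //; solveO.
  rewrite mul1r addr0 HresM ?resV ?r1 ?invr1 ?mulr1 ?oner_neq0 //.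
  by apply: OV; rewrite ?r1 ?oner_neq0.
move/addIr; rewrite (bigD1 j) // [in RHS](bigD1 j) //=.
have other b j' : O b -> j' != j -> \sum_(mu : 1.-tuple Fq) g i j' mu * lam (rp i j' 1 (TS mu 1 + b)) = 0.
  move=> ob ne; apply: big1 => mu _; have oS := tsumO mu 1; rewrite st; last by solveO.
  have -> : (i (+) ~~ j' == i (+) ~~ j) = false by move: ne; case: (i); case: (j); case: (j').
  by rewrite !mulr0.
rewrite [X in _ + X = _]big1 => [|j' ne]; last first.
  rewrite -[RHS](other (teich c) j' oc ne); apply: eq_bigr => mu _.
  by rewrite hb_same //; exact: tsumO.
rewrite [X in _ = _ + X]big1 => [|j' ne]; last first.
  by rewrite -[RHS](other 0 j' O0 ne); apply: eq_bigr => mu _; rewrite addr0.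
rewrite !addr0 (@sum_rcons 0 (fun mu => g i j mu * lam (hb i (teich c) *m rp i j 1 (TS mu 1)))).
rewrite (@sum_rcons 0 (fun mu => g i j mu * lam (rp i j 1 (TS mu 1)))).
rewrite (sum_tuple0 (fun nu => \sum_u g i j (rcons nu u) * lam (hb i (teich c) *m rp i j 1 (TS (rcons nu u) 1)))).
rewrite (sum_tuple0 (fun nu => \sum_u g i j (rcons nu u) * lam (rp i j 1 (TS (rcons nu u) 1)))) /=.
move=> e; apply: (mulfI (kap_neq0 (~~ j))); rewrite /power_moment !mulr_sumr.
transitivity (\sum_u g i j [:: u] * lam (hb i (teich c) *m rp i j 1 (TS [:: u] 1))).
  apply: eq_bigr => u _; have ou := HtO u; rewrite tsum_seq1 hb_same // st; last by solveO.
  by rewrite /dig /= HresD // !Htres eqxx mulr1; ring.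
rewrite e; apply: eq_bigr => u _; have ou := HtO u; rewrite tsum_seq1 st //.
by rewrite /dig /= !Htres eqxx mulr1; ring.
Qed.

(** Only the monomial [a^(p-1)] of the carry has a nonzero sum, namely -1, and its coefficient is
    [- res pi0] because ['C(p, 1) / p = 1]. *)
Lemma carry_sum : f = 1%N -> \sum_a iota (carry a 1) = iota (res pi0).
Proof.
move=> f1; have p3 := p_ge3.
transitivity (\sum_a \sum_(i < p.-1) - iota (res pi0) * ('C(p, i.+1) %/ p)%:R * iota a ^+ (p - i.+1)).
  apply: eq_bigr => a _; rewrite carryE f1 rmorphM rmorphN rmorph_sum mulr_sumr.
  apply: eq_bigr => i _. rewrite expn0 expr1 !expr1n mulr1. rewrite rmorphM rmorphXn rmorph_nat; ring.
have ps m : (m < p.*2.-2)%N -> psum iota m = if m == p.-1 then -1 else 0.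
  by move=> h; rewrite (psum_eq iota Hp Hf HFq Hpk) f1 expn1 //; move: h p3; clear; lia.
rewrite exchange_big; have lt : (0 < p.-1)%N by move: p3; clear; lia.
rewrite (bigD1 (Ordinal lt)) //= -mulr_sumr -/(psum iota _) ps; last by move: p3; clear; lia.
rewrite subn1 eqxx bin1 divnn prime_gt0 // mulr1 mulrN1 opprK big1 ?addr0 // => i ne.
rewrite -mulr_sumr -/(psum iota _) ps; last by move: (ltn_ord i) p3; clear; lia.
rewrite ifF ?mulr0 //; apply/negbTE; apply: contra ne => /eqP e; apply/eqP/val_inj => /=.
by move: (ltn_ord i) e p3; clear; lia.
Qed.

(** Only the order Q-1 is left, with a moment independent of the truncation. The form of order 0 one
    level lower reads, on the top level, the sum over the digit a of the moments of order Q.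
    Translation by [w0^N [1]] adds [carry a 1] to the last digit and so changes this reading by
    ['C(Q, Q-1) * m_(Q-1)] times the sum of the carries, which is the nonzero residue of
    [p / w0]. *)
Lemma top_levelQp N g i j (nu : N.+1.-tuple Fq) m : f = 1%N -> ram = 1%N ->
  Inv (EV (formf N.+2 g)) -> (m < qq (~~ j))%N -> bsub p (qq (~~ j)) m ->
  moment (fun u => g i j (rcons nu u)) m = 0.
Proof.
move=> f1 ram1 HI; set Q := qq (~~ j); pose D := digs N.+1 0.
have Q0 : (0 < Q)%N by exact: qq_gt0.
have lf : (0 < f)%N by rewrite f1.
have bQ := bsub_qq (~~ j) lf; rewrite expn0 -/Q in bQ.
have Q1 : (Q - 1 < Q)%N by move: Q0; clear; lia.
have K1 (nu' : N.+1.-tuple Fq) t : (t < Q)%N -> t != (Q - 1)%N -> 'C(Q, t)%:R * moment (fun u => g i j (rcons nu' u)) t = 0.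
  move=> tQ ne; have [bt|nb] := boolP (bsub p Q t); last first.
    by have /eqP -> : 'C(Q, t)%:R == 0 :> k; rewrite ?mul0r // (natr_bin_eq0 Hpk).
  rewrite (top_moment0 HI) ?mulr0 // => l; rewrite f1 ltnS leqn0 => /eqP ->.
  by rewrite expn0.
have [lam [hl hW _ h1 st]] := @coord_ex i (~~ j) N 0 0 O0 (qq_gt0 _) (bsub0 _).
have lamE i' j' x : O x -> lam (rp i' j' N.+2 x) =
    kap (~~ j') * iota (dig N.+1 x) ^+ qq (~~ j') * [&& i' == i, j' == j & cong N 0 x]%:R.
  move=> ox; have := st i' (~~ j') N.+1 x ox (ltnSn N); rewrite negbK => ->.
  by rewrite h1 // expr0 mulr1 (inj_eq negb_inj).
have ob : O (w0 ^+ N * teich 1) by have := HtO 1 => ?; solveO.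
have e := Inv_pair HI hW (hb_I1 i ob).
have oT n (mu : seq Fq) := tsumO mu n.
rewrite (@sum_single _ _ i j) in e; last first.
  move=> i' j' mu; have oS := oT N.+2 mu; have [->|ne] := eqVneq i' i.
    by rewrite hb_same // => /= ne; rewrite lamE ?(negbTE ne) ?andbF ?mulr0 //; solveO.
  have -> : i' = ~~ i by case: (i') (i) ne => [] [].
  have oM : O (mob 1 0 (w0 ^+ N * teich 1) 1 (TS mu N.+2)) by apply: mobO => //; solveO.
  by rewrite hb_opp // lamE //; case: (i); rewrite mulr0.
have e2 := @eq_pair (fun x => lam (1%:M *m x)) lam (formf N.+2 g) (fun x => congr1 lam (mul1mx x)).
rewrite (@sum_single _ _ i j) in e2; last first.
  by move=> i' j' mu /negbTE ne; rewrite mul1mx lamE // andbA ne mulr0.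
rewrite -{}e2 in e.
have [D0 eD0] : exists D0 : N.-tuple Fq, D0 = digs N 0 by exists (digs N 0).
(* The reading when the last digit is moved by [z a], apart from a permutation of the a; used with z
   = 0 and with the carry. *)
have red (h : 'M[F]_2) (z : Fq -> Fq) : (forall (nu'' : N.-tuple Fq) a u, lam (h *m rp i j N.+2
      (TS (rcons nu'' a) N.+1 + w0 ^+ N.+1 * teich u)) =
      kap (~~ j) * iota (u + z a) ^+ Q * (nu'' == D0)%:R) ->
   \sum_(nu : N.+1.-tuple Fq) \sum_u g i j (rcons nu u) *
      lam (h *m rp i j N.+2 (TS nu N.+1 + w0 ^+ N.+1 * teich u)) =
   kap (~~ j) * \sum_a (moment (fun u => g i j (rcons (rcons D0 a) u)) Q
     + 'C(Q, Q - 1)%:R * moment (fun u => g i j (rcons D u)) (Q - 1) * iota (z a)).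
  move=> hz; rewrite (@sum_rcons _ (fun nu => \sum_u g i j (rcons nu u) *
      lam (h *m rp i j N.+2 (TS nu N.+1 + w0 ^+ N.+1 * teich u)))).
  rewrite (bigD1 D0) //= [X in _ + X]big1 ?addr0 => [|nu'' /negbTE ne]; last first.
    by rewrite big1 // => a _; rewrite big1 // => u _; rewrite hz ne !mulr0.
  rewrite mulr_sumr; apply: eq_bigr => a _.
  transitivity (kap (~~ j) * \sum_u g i j (rcons (rcons D0 a) u) * iota (u + z a) ^+ Q).
    by rewrite mulr_sumr; apply: eq_bigr => u _; rewrite hz eqxx mulr1; ring.
  congr (_ * _); rewrite moment_shift big_ord_recr /= binn subnn expr0 !mulr1 addrC; congr (_ + _).
  have lt : (Q - 1 < Q)%N by [].
  rewrite (bigD1 (Ordinal lt)) //= [X in _ + X]big1 ?addr0 => [|t ne]; last first.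
    rewrite [moment _ t * _]mulrC; have := K1 [tuple of rcons D0 a] t (ltn_ord t).
    by rewrite -val_eqE /= in ne; move=> ->; rewrite ?mul0r.
  rewrite (subKn Q0) expr1 [moment _ _ * _]mulrC; congr (_ * _ * _).
  exact: (top_const HI i [tuple of rcons D0 a] lt bQ).
have addE (nu'' : N.-tuple Fq) a z : TS (rcons nu'' a) N.+1 + w0 ^+ N.+1 * z =
    TS nu'' N + w0 ^+ N * (teich a + w0 * z).
  by rewrite tsum_rcons exprS; ring.
rewrite (red 1%:M (fun=> 0)) in e; last first.
  move=> nu'' a u; have o1 := oT N nu''; have o2 := HtO a; have o3 := HtO u.
  have o4 := oT N.+1 (rcons nu'' a).
  rewrite mul1mx lamE; last by solveO.
  rewrite digD // ?Htres dig_tsum_top add0r addr0 addE cong_shift; last by solveO.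
  by rewrite cong_tuple ?eqxx ?eD0 //; exact: O0.
rewrite (red (hb i (w0 ^+ N * teich 1)) (fun a => carry a 1)) in e; last first.
  move=> nu'' a u; have o1 := oT N nu''; have o2 := HtO a; have o3 := HtO u.
  have o4 := HtO 1; have [y oy [ry ey]] := carryP a 1.
  have o5 : O (TS (rcons nu'' a) N.+1 + w0 ^+ N.+1 * teich u) by rewrite addE; solveO.
  rewrite hb_same // lamE; last by solveO.
  have E1 : TS (rcons nu'' a) N.+1 + w0 ^+ N.+1 * teich u + w0 ^+ N * teich 1 =
     TS (rcons nu'' (a + 1)) N.+1 + w0 ^+ N.+1 * (teich u + y).
    rewrite addE tsum_rcons exprS.
    have -> : teich (a + 1) = teich a + teich 1 - w0 * y by rewrite ey addrK.
    by ring.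
  rewrite E1 digD; [|exact: oT|by solveO].
  rewrite HresD // Htres ry dig_tsum_top add0r addE.
  rewrite cong_shift; last by have := HtO (a + 1) => ?; solveO.
  by rewrite cong_tuple ?eqxx ?eD0 //; exact: O0.
have aQ : moment (fun u => g i j (rcons D u)) (Q - 1) = 0.
  have := mulfI (kap_neq0 (~~ j)) e; rewrite !big_split /= => /addrI.
  rewrite -mulr_sumr carry_sum // rmorph0 mulr0 sumr_const mul0rn => /eqP.
  rewrite !mulf_eq0 (natr_bin_eq0 Hpk) bQ fmorph_eq0 pi0_eq0 ram1 eqxx orbF /=.
  by move/eqP.
move=> hm hb'; have [em|ne] := eqVneq m (Q - 1)%N; first by rewrite em (top_const HI i nu Q1 bQ).
have := K1 nu m hm ne => /eqP; rewrite mulf_eq0 (natr_bin_eq0 Hpk) hb' /=.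
by move/eqP.
Qed.

Lemma spanning s : Inv (EV s) -> exists L, all valid (map snd L) /\ congW (EV s) (EV (CB L)).
Proof.
have [N [g hg]] := repN_ex s => HI; have HIg := Inv_cong hg HI.
suff [L [vL hL]] : exists L, all valid (map snd L) /\ congW (EV (formf N g)) (EV (CB L)).
  by exists L; split=> //; exact: congW_trans hg hL.
move: HIg; clear HI hg.
elim: N g => [|N IH] g HI.
  exists [:: (g false false [::] + g true true [::], BId); (g true false [::] + g false true [::], BBeta)].
  split=> //; apply: congW_refl => X; have hl := @eqf_br X.
  rewrite !EVE pair_comb pair_formf !big_cons big_nil pair_elId // pair_elBeta // addr0.
  have E i j : \sum_(mu : 0.-tuple Fq) g i j mu * BR (rp i j 0 (TS mu 0)) X =
      g i j [::] * BR (rp i j 0 0) X.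
    rewrite (sum_tuple0 (fun mu => g i j mu * BR (rp i j 0 (TS mu 0)) X)).
    by rewrite /tsum big_ord0.
  rewrite !big_bool /= !E (rp0_flip true true hl O0 O0) (rp0_flip false true hl O0 O0) /=; ring.
(* It suffices to correct the vector by candidates of level N+1 until its visible lower moments
   vanish; then it descends to level N. *)
suff [g' [L0 [vL0 hg' HI' null]]] : exists g' L0, [/\ all valid (map snd L0),
    congW (EV (formf N.+1 g)) (fun X => EV (formf N.+1 g') X + EV (CB L0) X),
    Inv (EV (formf N.+1 g')) &
    forall i j (nu : N.-tuple Fq), null_moments (qq (~~ j)) (fun u => g' i j (rcons nu u))].
  have [g2 hg2] := descend null; have [L [vL hL]] := IH g2 (Inv_cong hg2 HI').
  exists (L ++ L0); split; first by rewrite map_cat all_cat vL vL0.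
  apply: congW_trans hg' _; apply: congW_trans (congWD (congW_trans hg2 hL) (congW_refl (frefl _))) _.
  by apply: congW_refl => X; rewrite !EVE !pair_comb big_cat.
have empty : (forall i j (nu : N.-tuple Fq), null_moments (qq (~~ j)) (fun u => g i j (rcons nu u))) ->
   exists g' L0, [/\ all valid (map snd L0),
    congW (EV (formf N.+1 g)) (fun X => EV (formf N.+1 g') X + EV (CB L0) X),
    Inv (EV (formf N.+1 g')) &
    forall i j (nu : N.-tuple Fq), null_moments (qq (~~ j)) (fun u => g' i j (rcons nu u))].
  move=> null; exists g, [::]; split=> //; apply: congW_refl => X.
  by rewrite [EV (CB _) X]EVE pair_comb big_nil addr0.
have [nq|] := boolP (~~ ((ram == 1%N) && (f == 1%N))); last first.
  rewrite negbK => /andP[/eqP ram1 /eqP f1]; apply: empty => i j nu m hm hb'.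
  case: N g HI nu {IH} => [|M] g HI nu; last exact: top_levelQp HI hm hb'.
  by rewrite (tuple0 nu); exact: top_level1 HI hm hb'.
have [N0|N0] := posnP N.
  apply: empty => i j nu m hm hb'; move: N0 HI nu {IH} => -> HI nu.
  by rewrite (tuple0 nu); exact: top_level1 HI hm hb'.
(* By [moment_power] a candidate has moment -1 at order [Q - p^l], so adding [al] times it cancels
   that moment. One coefficient serves all truncations because of [top_const]; [L0] takes the
   correction back. *)
pose al i j l : k := moment (fun u => g i j (rcons (digs N 0) u)) (qq (~~ j) - p ^ l).
pose g' i j mu : k := g i j mu + \sum_(l < f) al i j l * iota (nth 0 mu N) ^+ (qq j + p ^ l).
pose L0 := [seq (- al t.1.1 t.1.2 (nat_of_ord t.2), elix t.1.1 t.1.2 t.2 N.+1)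
  | t : bool * bool * 'I_f <- enum {: bool * bool * 'I_f}].
have EVg X : EV (formf N.+1 g') X = EV (formf N.+1 g) X +
    \sum_(t : bool * bool * 'I_f) al t.1.1 t.1.2 t.2 * EV (EL (elix t.1.1 t.1.2 t.2 N.+1)) X.
  have hl := @eqf_br X.
  have -> : \sum_(t : bool * bool * 'I_f) al t.1.1 t.1.2 t.2 * EV (EL (elix t.1.1 t.1.2 t.2 N.+1)) X =
      \sum_i \sum_j \sum_(l < f) al i j l * EV (EL (elix i j l N.+1)) X by rewrite !pair_big.
  rewrite !EVE !pair_formf -big_split; apply: eq_bigr => i _; rewrite -big_split.
  apply: eq_bigr => j _.
  have -> : \sum_(l < f) al i j l * EV (EL (elix i j l N.+1)) X =
      \sum_(mu : N.+1.-tuple Fq) \sum_(l < f) al i j l * iota (nth 0 mu N) ^+ (qq j + p ^ l) * BR (rp i j N.+1 (TS mu N.+1)) X.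
    rewrite exchange_big; apply: eq_bigr => l _; rewrite EVE pair_elix // mulr_sumr.
    by apply: eq_bigr => mu _; rewrite mulrA.
  by rewrite -big_split; apply: eq_bigr => mu _; rewrite /= mulrDl mulr_suml.
exists g', L0; split.
- by apply/allP => b /mapP[c /mapP[[[i j] l] _ -> ->]]; rewrite /elix /=; case: j; rewrite /= nq ltn_ord.
- apply: congW_refl => X; rewrite EVg -addrA [EV (CB _) X]EVE pair_comb big_map big_enum -big_split.
  by rewrite big1 ?addr0 // => t _; rewrite /= mulNr -EVE subrr.
- have HE (t : bool * bool * 'I_f) : Inv (fun X => al t.1.1 t.1.2 t.2 * EV (EL (elix t.1.1 t.1.2 t.2 N.+1)) X).
    by apply/InvZ/InvE; apply: inv_elix.
  refine (Inv_cong _ (InvD HI (Inv_sum HE))).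
  by apply: congW_refl => X; rewrite EVg.
move=> i j nu m hm hb'.
have -> : moment (fun u => g' i j (rcons nu u)) m = moment (fun u => g i j (rcons nu u)) m +
    \sum_(l < f) al i j l * moment (fun u => iota u ^+ (qq j + p ^ l)) m.
  have -> : \sum_(l < f) al i j l * moment (fun u => iota u ^+ (qq j + p ^ l)) m =
      \sum_u \sum_(l < f) al i j l * iota u ^+ (qq j + p ^ l) * iota u ^+ m.
    rewrite exchange_big; apply: eq_bigr => l _; rewrite mulr_sumr.
    by apply: eq_bigr => u _; rewrite mulrA.
  by rewrite -big_split; apply: eq_bigr => u _; rewrite /g' nth_rcons_size /= mulrDl mulr_suml.
have P0 l : (0 < p ^ l)%N by rewrite expn_gt0 prime_gt0.
case: (pickP [pred l : 'I_f | m == qq (~~ j) - p ^ l]%N) => [l0 /eqP em|ne].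
  rewrite (bigD1 l0) //= [X in _ + (_ + X)]big1 ?addr0 => [|l nel].
    rewrite moment_power ?(ltnW hm) // em eqxx mulrN1.
    by rewrite (top_const HI i nu) -?em // /al -em subrr.
  rewrite moment_power ?(ltnW hm) // ifF ?mulr0 //; apply/negbTE; apply: contra nel.
  rewrite em => /eqP e; apply/eqP/val_inj/eqP; rewrite -(eqn_exp2l _ _ (prime_gt1 Hp)).
  have le0 := exp_le_qq (~~ j) (ltn_ord l0); have le1 := exp_le_qq (~~ j) (ltn_ord l).
  by apply/eqP; move: e le0 le1 => /=; clear; lia.
rewrite (top_moment0 HI) // => [|l lf]; last by have := ne (Ordinal lf) => /= ->.
rewrite add0r big1 // => l _; rewrite moment_power ?(ltnW hm) //.
by have := ne l => /= ->; rewrite mulr0.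
Qed.

Lemma basis_theorem :
  (forall b, valid b -> I1invariant v w0 res teich iota r (EL b)) /\
  (forall L : seq (k * bidx), uniq (map snd L) -> all valid (map snd L) ->
     W (EV (CB L)) -> forall c, c \in L -> c.1 = 0) /\
  (forall s : fsum F k, I1invariant v w0 res teich iota r s ->
     exists L, all valid (map snd L) /\ W (fun X => EV s X - EV (CB L) X)).
Proof.
split; [|split].
- move=> b /valid_cases[->|[->|[i [j [l [n [-> lf nq]]]]]]].
  + exact: inv_base false.
  + exact: inv_base true.
  exact: inv_elix.
- exact: independent.
by move=> s /InvE; exact: spanning.
Qed.

End Iwahori.

Theorem theorem1p4
  (p f e : nat) (F : fieldType) (v : F -> int) (w0 : F)
  (Fq : finFieldType) (res : F -> Fq) (teich : Fq -> F)
  (k : closedFieldType) (iota : {rmorphism Fq -> k}) (r : nat)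
  (* p prime, q = p^f *)
  (Hp : prime p) (Hf : (0 < f)%N)
  (* F: complete discretely valued field of characteristic 0 *)
  (HcharF : [pchar F] =i pred0)
  (HvM : forall x y : F, x != 0 -> y != 0 -> v (x * y) = v x + v y)
  (HvD : forall x y : F, x != 0 -> y != 0 -> x + y != 0 ->
           Num.min (v x) (v y) <= v (x + y))
  (Hw0 : w0 != 0) (Hvw0 : v w0 = 1)
  (Hcompl : forall u : nat -> F,
     (forall N : int, exists M : nat, forall m n : nat, (M <= m)%N -> (M <= n)%N ->
        vge v (u m - u n) N) ->
     exists l : F, forall N : int, exists M : nat, forall n : nat, (M <= n)%N ->
        vge v (u n - l) N)
  (* ramification index e *)
  (He : v (p%:R) = e%:Z)
  (* residue field F_q *)
  (HFq : #|Fq| = (p ^ f)%N)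
  (HresD : forall x y, inO v x -> inO v y -> res (x + y) = res x + res y)
  (HresM : forall x y, inO v x -> inO v y -> res (x * y) = res x * res y)
  (Hres1 : res 1 = 1)
  (Hresker : forall x, inO v x -> (res x == 0) = inPO v x)
  (* Teichmueller representatives *)
  (Ht0 : teich 0 = 0) (HtM : forall a b, teich (a * b) = teich a * teich b)
  (HtO : forall a, inO v (teich a)) (Htres : forall a, res (teich a) = a)
  (* k = algebraic closure of F_p containing F_q (via iota) *)
  (Hchark : (p \in [pchar k])%N)
  (Halg : forall x : k, exists n : nat, (0 < n)%N /\ x ^+ (p ^ n) = x)
  (* conditions on r *)
  (Hr : (0 < r < (p ^ f).-1)%N)
  (Hdig : forall j, (j < f)%N -> (0 < (r %/ p ^ j) %% p < p.-1)%N)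
  (Hf1 : f = 1%N -> (2 < r < p - 3)%N) :
  let valid (i : bidx) : bool :=
    match i with
    | BId | BBeta => true
    | BS l n _ | BT l n _ => [&& ~~ ((e == 1%N) && (f == 1%N)), (l < f)%N & (2 <= n)%N]
    end in
  let inv := I1invariant v w0 res teich iota r in
  let W := inW v w0 res teich iota r in
  let el := elem p f w0 teich iota r in
  let cb := comb p f w0 teich iota r in
  (* images lie in pi_r^{I(1)} *)
  (forall i, valid i -> inv (el i)) /\
  (* images are linearly independent in pi_r *)
  (forall L : seq (k * bidx), uniq (map snd L) -> all valid (map snd L) ->
     W (ev v w0 res iota r (cb L)) -> forall c, c \in L -> c.1 = 0) /\
  (* images span pi_r^{I(1)} *)
  (forall s : fsum F k, inv s ->
     exists L : seq (k * bidx), all valid (map snd L) /\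
       W (fun x => ev v w0 res iota r s x - ev v w0 res iota r (cb L) x)).
Proof.
exact: (@basis_theorem p f e).
Qed.
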